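(* There is an absolute constant $C>0$ such that for every $\alpha>0$ there is $\varepsilon_\alpha>0$ with $\varepsilon_\alpha = \exp(-O(1/\alpha^3))$ (i.e. $\varepsilon_\alpha \ge \exp(-C/\alpha^3)$) for which the following holds. For all sufficiently large $n$, if $G$ is an $n$-vertex graph with $\mathrm{SA}_{n^\alpha}(G) \ge 1-\varepsilon_\alpha$, then there is a cut of $G$ whose value is at least $\frac12+\varepsilon_\alpha$, and there is a polynomial-time rounding algorithm which, given a degree-$n^\alpha$ Sherali–Adams solution (local pseudodistribution) of value at least $1-\varepsilon_\alpha$, produces such a cut. Consequently, the degree-$n^\alpha$ Sherali–Adams LP value provides a $(\frac12+\varepsilon_\alpha)$-approximation to Max-Cut.
   Context: A graph $G$ on $n$ vertices is given by nonnegative edge weights $w_{ij}\ge 0$ on unordered pairs, normalized so that $\sum_{ij} w_{ij}=1$; graphs are simple, undirected, with no isolated vertices. The value of a cut (an assignment $x\in\{\pm1\}^n$) is $\sum_{\{i,j\}} w_{ij}\,\mathbf 1[x_i\ne x_j]$. A Boolean $t$-local pseudodistribution on $n$ variables is a collection $\{\mu_S\}_{|S|= t}$ of probability distributions $\mu_S$ on $\{\pm1\}^S$ such that for every $S'$ with $|S'|\le t$, all $\mu_S$ with $S\supseteq S'$ have the same marginal on $S'$; we write $X_1,\dots,X_n$ for the associated ''$t$-local random variables'', for which only events involving at most $t$ variables are defined. The degree-$t$ Sherali–Adams value is $\mathrm{SA}_t(G)=\max \sum_{\{i,j\}} w_{ij}\Pr_{\mu_{ij}}[X_i\ne X_j]$,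 the maximum over all Boolean $t$-local pseudodistributions, where $\mu_{ij}$ is the common marginal on $\{i,j\}$. The set of such pseudodistributions is a polytope with $n^{O(t)}$ variables and constraints (the degree-$t$ Sherali–Adams LP).
   Formalization: The bound on ε_α is stated as ε_α ≥ exp(-C/min(α,1)^3), and the degree n^α is rounded down and capped at n, because for α>1 the degree exceeds n and for large α the literal bound would force ε_α>1/2, making a cut of value 1/2+ε_α impossible. *)

(* Defs.v *)
From HB Require Import structures.
From mathcomp Require Import all_boot all_order all_algebra.
From mathcomp Require Import boolp classical_sets reals sequences exp.

Set Implicit Arguments.
Unset Strict Implicit.
Unset Printing Implicit Defensive.

Import Order.TTheory GRing.Theory Num.Theory.
Local Open Scope ring_scope.

(* Everything is generic in the number field F: it is used with F a realType
   for arbitrary weights and with F = rat for the inputs of algorithms. *)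
Record wgraph (F : numFieldType) (n : nat) := WGraph {
  weight :> 'I_n -> 'I_n -> F;
  weight_ge0 : forall i j, 0 <= weight i j;
  weight_sym : forall i j, weight i j = weight j i;
  weight_loopless : forall i, weight i i = 0;
  weight_no_isolated : forall i, exists j, 0 < weight i j;
  weight_sum : \sum_(i < n) \sum_(j < n | (i < j)%N) weight i j = 1
}.

(* A cut x in {+1,-1}^n is a boolean function, true standing for +1. *)
Definition gcut (n : nat) := {ffun 'I_n -> bool}.

Definition cut_value (F : numFieldType) (n : nat) (G : wgraph F n)
    (x : gcut n) : F :=
  \sum_(i < n) \sum_(j < n | (i < j)%N) G i j * (x i != x j)%:R.

Definition max_cut (R : realType) (n : nat) (G : wgraph R n) : R :=
  \big[Num.max/0]_(x : gcut n) cut_value G x.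

(* {+1,-1}^S *)
Definition assignment (n : nat) (S : {set 'I_n}) :=
  {ffun {i : 'I_n | i \in S} -> bool}.

(* The assignments x and z coincide on S :&: T; in particular, when
   T \subset S, z is the restriction of x to T. *)
Definition agree (n : nat) (S T : {set 'I_n})
    (x : assignment S) (z : assignment T) : bool :=
  [forall a, forall b, (val a == val b) ==> (x a == z b)].

Definition marginal (F : numFieldType) (n : nat) (S T : {set 'I_n})
    (p : assignment S -> F) (z : assignment T) : F :=
  \sum_(x : assignment S | agree x z) p x.

(* Only the values at sets S with #|S| = t are meaningful. *)
Record local_pseudodist (F : numFieldType) (n t : nat) := LocalPseudodist {
  pd :> forall S : {set 'I_n}, assignment S -> F;
  pd_ge0 : forall S : {set 'I_n}, #|S| = t ->
    forall x : assignment S, 0 <= pd x;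
  pd_sum : forall S : {set 'I_n}, #|S| = t ->
    \sum_(x : assignment S) pd x = 1;
  pd_consistent : forall T S1 S2 : {set 'I_n},
    (#|T| <= t)%N -> #|S1| = t -> #|S2| = t ->
    T \subset S1 -> T \subset S2 ->
    forall z : assignment T,
      marginal (@pd S1) z = marginal (@pd S2) z
}.

(* The common marginal on T, read off from some S of size t containing T
   (the choice is irrelevant by pd_consistent when #|T| <= t); the junk
   value 0 is only returned when there is no such S. *)
Definition local_marginal (F : numFieldType) (n t : nat)
    (mu : local_pseudodist F n t) (T : {set 'I_n}) (z : assignment T) : F :=
  if [pick S : {set 'I_n} | (#|S| == t) && (T \subset S)] is Some S0
  then marginal (@pd F n t mu S0) z else 0.

Definition separates (n : nat) (T : {set 'I_n}) (i j : 'I_n)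
    (z : assignment T) : bool :=
  [exists a, exists b, [&& val a == i, val b == j & z a != z b]].

(* Pr_{mu_ij}[X_i != X_j] *)
Definition pr_neq (F : numFieldType) (n t : nat)
    (mu : local_pseudodist F n t) (i j : 'I_n) : F :=
  \sum_(z : assignment [set i; j]%SET | separates i j z) local_marginal mu z.

Definition pd_value (F : numFieldType) (n t : nat) (G : wgraph F n)
    (mu : local_pseudodist F n t) : F :=
  \sum_(i < n) \sum_(j < n | (i < j)%N) G i j * pr_neq mu i j.

(* The maximum of a linear functional over a polytope, written as a sup. *)
Definition SA (R : realType) (t n : nat) (G : wgraph R n) : R :=
  sup (range (fun mu : local_pseudodist R n t => pd_value G mu)).

(* The integer degree meant by n^alpha. Degree n is already exact, and there
   is no set of more than n variables, hence the cap at n (which is inactive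
   for alpha <= 1). *)
Definition sa_degree (R : realType) (n : nat) (alpha : R) : nat :=
  minn n (Num.truncn (n%:R `^ alpha)).

(* Model of computation: structured programs for a random access machine over
   the natural numbers with logarithmic cost (every operation is charged the
   bit length of its operands, addresses and result), which is polynomially
   equivalent to Turing machines. The input is a read-only array s; the
   working memory is a separate array, initially zero. *)
Definition memory := nat -> nat.

Definition blen (k : nat) : nat := (trunc_log 2 k).+1.

Inductive binop := OpAdd | OpSub | OpMul | OpDiv.

Definition binop_eval (o : binop) : nat -> nat -> nat :=
  match o with
  | OpAdd => addn | OpSub => subn | OpMul => muln | OpDiv => divn
  end.

Inductive expr :=
  | Const of nat
  | Input of expr
  | Mem of expr
  | Bin of binop & expr & expr.

Fixpoint eval (s : seq nat) (m : memory) (e : expr) : nat :=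
  match e with
  | Const k => k
  | Input a => nth 0%N s (eval s m a)
  | Mem a => m (eval s m a)
  | Bin o a b => binop_eval o (eval s m a) (eval s m b)
  end.

Fixpoint eval_cost (s : seq nat) (m : memory) (e : expr) : nat :=
  match e with
  | Const k => blen k
  | Input a | Mem a =>
      (eval_cost s m a + blen (eval s m a) + blen (eval s m e))%N
  | Bin _ a b =>
      (eval_cost s m a + eval_cost s m b +
       blen (eval s m a) + blen (eval s m b) + blen (eval s m e))%N
  end.

Inductive prog :=
  | Skip
  | Store of expr & expr
  | Seq of prog & prog
  | If of expr & prog & prog
  | While of expr & prog.

Definition upd (m : memory) (a v : nat) : memory :=
  fun b => if b == a then v else m b.

(* exec s m p c m': on input s, from memory m, p halts with memory m' at
   total cost c. *)
Inductive exec (s : seq nat) : memory -> prog -> nat -> memory -> Prop :=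
  | ExecSkip m : exec s m Skip 1 m
  | ExecStore m a e :
      exec s m (Store a e)
        (1 + eval_cost s m a + eval_cost s m e +
         blen (eval s m a) + blen (eval s m e))%N
        (upd m (eval s m a) (eval s m e))
  | ExecSeq m1 m2 m3 p q c d :
      exec s m1 p c m2 -> exec s m2 q d m3 ->
      exec s m1 (Seq p q) (1 + c + d)%N m3
  | ExecIfTrue m m' e p q c :
      eval s m e != 0%N -> exec s m p c m' ->
      exec s m (If e p q) (1 + eval_cost s m e + c)%N m'
  | ExecIfFalse m m' e p q c :
      eval s m e = 0%N -> exec s m q c m' ->
      exec s m (If e p q) (1 + eval_cost s m e + c)%N m'
  | ExecWhileTrue m1 m2 m3 e p c d :
      eval s m1 e != 0%N -> exec s m1 p c m2 -> exec s m2 (While e p) d m3 ->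
      exec s m1 (While e p) (1 + eval_cost s m1 e + c + d)%N m3
  | ExecWhileFalse m e p :
      eval s m e = 0%N ->
      exec s m (While e p) (1 + eval_cost s m e)%N m.

Definition input_size (s : seq nat) : nat := (\sum_(k <- s) blen k)%N.

(* The result is related to the instance by Q; the running time is bounded by
   a polynomial in the bit size of the encoded instance, on all instances of
   the promise problem P. *)
Definition polytime_on (I : Type) (O : I -> Type) (enc : I -> seq nat)
    (dec : forall x : I, memory -> O x) (P : I -> Prop)
    (Q : forall x : I, O x -> Prop)
    (p : prog) : Prop :=
  exists k : nat, forall x : I, P x ->
    exists (c : nat) (m : memory),
      [/\ exec (enc x) (fun=> 0%N) p c m,
          (c <= k * input_size (enc x) ^ k + k)%N
        & Q x (dec x m)].

Definition enc_rat (q : rat) : seq nat := [:: `|numq q|%N; `|denq q|%N].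

(* The row for mu_S(x): one digit per variable (0 outside S, 1 for -1 and
   2 for +1), followed by the probability. *)
Definition enc_row (n t : nat) (mu : local_pseudodist rat n t)
    (S : {set 'I_n}) (x : assignment S) : seq nat :=
  [seq if insub i is Some a then (x a).+1 else 0%N | i <- enum 'I_n]
    ++ enc_rat (mu S x).

Definition pd_table (n t : nat) (mu : local_pseudodist rat n t) :
    seq (seq nat) :=
  flatten [seq [seq enc_row mu x | x <- enum {: assignment U}]
          | U : {set 'I_n} <- enum [set U : {set 'I_n} | #|U| == t]%SET].

(* An instance consists of the number of vertices, the degree, a graph and a
   local pseudodistribution, the last two with rational data. *)
Record rounding_instance := RoundingInstance {
  ri_n : nat;
  ri_t : nat;
  ri_graph : wgraph rat ri_n;
  ri_pd : local_pseudodist rat ri_n ri_t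
}.

Definition enc_instance (x : rounding_instance) : seq nat :=
  [:: ri_n x; ri_t x; size (pd_table (ri_pd x))]
    ++ flatten [seq enc_rat (ri_graph x i j)
               | i <- enum 'I_(ri_n x), j <- enum 'I_(ri_n x)]
    ++ flatten (pd_table (ri_pd x)).

Definition dec_cut (x : rounding_instance) (m : memory) : gcut (ri_n x) :=
  [ffun i : 'I_(ri_n x) => m i != 0%N].

(* Main.v *)
Require Import Defs.
From HB Require Import structures.
From mathcomp Require Import all_boot all_order all_algebra.
From mathcomp Require Import ring lra zify.
From mathcomp Require Import boolp classical_sets reals sequences exp.

(* The pseudo-moments M_ij = E[X_i X_j] come from honest distributions on sets of
   m <= n^alpha vertices, so M is nearly positive semidefinite: v M v is at least
   - |v|_1^2 / (m - 1). On the graph induced by the vertices not placed yet, with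
   adjacency matrix A and degree matrix D, let L = (I - D^-1 A) / 2 and let b_k be
   the degree-weighted average of M against L^k. A value of at least 1 - eps gives
   b_1 >= 1 - 2 eps, and near-positivity gives b_2k >= b_k^2 - 4 / (m - 1), so
   b_k >= (1 - 3 eps)^k for k of order log n, as long as this dominates n^-alpha.
   If every vector L^j e_l with j <= k had Rayleigh quotient at most 63 / 64, then
   b_k <= n (63 / 64)^k, a contradiction when eps is a small multiple of alpha.
   Hence some L^j e_l is close to the bottom of the spectrum of D^-1 A, and a
   threshold rounding of it (Trevisan) is a partial cut which cuts most of the
   weight meeting its support. Placing such partial cuts greedily, each with the
   better of its two signs, until less than half of the weight is left, and then
   the remaining vertices one by one, gives a cut of value at least 9 / 16.
   The pseudodistribution is needed only for the existence of a good candidate: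
   the program reads the graph alone and tries all l, j and thresholds. *)

Import Order.TTheory GRing.Theory Num.Theory.
Local Open Scope ring_scope.

(** * The walk on the induced graph *)

(** The obstacle is that near-positivity of [M] is paid for with the square of the l1 norm of the
    test vector. A unit eigenvector of the walk may have l1 norm of order sqrt n, so testing [M]
    against it says nothing unless the degree exceeds n. Rows of powers of [halfwalk] have l1 norm
    at most 1 whatever n is, so the argument uses only those rows, and the diagonal entries of the
    powers in place of eigenvalues. No spectral theorem and no square root occurs: everything holds
    in any ordered field, and the same lemmas serve real weights and the rational inputs of the
    program. The shift and the halving in L make it positive for the degree-weighted inner product
    while its rows keep absolute sum at most 1; a vector on which L is almost 1 is one on which
    neighbours are almost opposite. The walk length is a power of two because the lower bound on b_k
    is obtained by doubling k. The resulting gap is linear in min(alpha, 1), far above the required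
    exp(-O(1/alpha^3)). *)

Section Walk.
Context (F : realFieldType) (n : nat) (A : 'I_n -> 'I_n -> F).
Hypothesis A_ge0 : forall i j, 0 <= A i j.
Hypothesis A_sym : forall i j, A i j = A j i.

Definition deg (i : 'I_n) : F := \sum_j A i j.
Definition volume : F := \sum_i deg i.
Definition halfwalk : 'M[F]_n :=
  \matrix_(i, j) (((i == j)%:R - (deg i)^-1 * A i j) / 2).

Local Notation L := halfwalk.

Lemma deg_ge0 i : 0 <= deg i.
Proof. by apply: sumr_ge0. Qed.

Lemma volume_ge0 : 0 <= volume.
Proof. by apply: sumr_ge0 => i _; apply: deg_ge0. Qed.

Lemma deg0_A i j : deg i = 0 -> A i j = 0.
Proof.
move=> /eqP; rewrite psumr_eq0 // => /allP /(_ j).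
by rewrite mem_index_enum => /(_ isT) /eqP.
Qed.

(** A vertex of degree 0 has a zero row and 0^-1 = 0, so the cancellation has no side condition.
    Induced graphs do have such vertices: those already placed. *)
Lemma degVA i j : deg i * ((deg i)^-1 * A i j) = A i j.
Proof.
have [d0|d0] := eqVneq (deg i) 0; first by rewrite d0 mul0r deg0_A.
by rewrite mulVKf.
Qed.

Lemma deg_halfwalk i j : deg i * L i j = (deg i * (i == j)%:R - A i j) / 2.
Proof. by rewrite mxE mulrA mulrBr degVA. Qed.

Lemma deg_halfwalk_sym i j : deg i * L i j = deg j * L j i.
Proof.
rewrite !deg_halfwalk A_sym eq_sym.
by case: eqVneq => [->|]; rewrite ?mulr0.
Qed.

Lemma halfwalkX_sym k i j : deg i * (L ^+ k) i j = deg j * (L ^+ k) j i.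
Proof.
elim: k i j => [|k IH] i j.
  rewrite expr0 !mxE eq_sym; case: eqVneq => [->//|_]; by rewrite !mulr0.
rewrite {1}exprS exprSr mxE [X in _ = _ * X]mxE !mulr_sumr.
apply: eq_bigr => l _.
by rewrite mulrA deg_halfwalk_sym mulrAC IH mulrA.
Qed.

(** A row of [L] has absolute sum at most (1 + 1) / 2, and row bounds multiply. This is what the
    normalisation by the degree buys. *)
Lemma halfwalkX_norm k i : \sum_j `|(L ^+ k) i j| <= 1.
Proof.
elim: k i => [|k IH] i.
  rewrite (bigD1 i) //= big1 ?mxE ?eqxx ?normr1 ?addr0 // => j ji.
  by rewrite expr0 !mxE eq_sym (negPf ji) normr0.
apply: (@le_trans _ _ (\sum_l `|L i l| * \sum_j `|(L ^+ k) l j|)).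
  under [leRHS]eq_bigr do rewrite mulr_sumr; rewrite exchange_big /=.
  apply: ler_sum => j _; rewrite exprS mxE (le_trans (ler_norm_sum _ _ _)) //.
  by apply: ler_sum => l _; rewrite normrM.
apply: (@le_trans _ _ (\sum_l `|L i l|)).
  by apply: ler_sum => l _; rewrite ler_piMr.
apply: (@le_trans _ _ (\sum_l ((i == l)%:R + (deg i)^-1 * A i l) / 2)).
  apply: ler_sum => l _; rewrite mxE normrM (@ger0_norm _ 2^-1) ?invr_ge0 ?ler0n //.
  rewrite ler_pM2r ?invr_gt0 ?ltr0n // (le_trans (ler_normB _ _)) //.
  rewrite normr_nat lerD2l normrM !ger0_norm ?invr_ge0 //; exact: deg_ge0.
rewrite -mulr_suml big_split /= -mulr_sumr -/(deg i) (bigD1 i) //= eqxx big1 ?addr0.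
  rewrite ler_pdivrMr ?ltr0n // mul1r mulrC.
  rewrite mulr1n; have [->|d0] := eqVneq (deg i) 0; first by rewrite mul0r; lra.
  by rewrite divff //; lra.
by move=> l; rewrite eq_sym => /negPf ->.
Qed.

(** The matrix D L is half the graph Laplacian, so the form is a quarter of the Dirichlet energy of
    [f] over ordered pairs. *)
Lemma halfwalk_psd (f : 'I_n -> F) :
  0 <= \sum_i deg i * f i * \sum_j L i j * f j.
Proof.
have -> : \sum_i deg i * f i * \sum_j L i j * f j
  = 4^-1 * \sum_i \sum_j A i j * (f i - f j) ^+ 2.
  have E i : deg i * f i * \sum_j L i j * f j
      = (deg i * f i ^+ 2 - \sum_j A i j * (f i * f j)) / 2.
    transitivity (f i * \sum_j (deg i * L i j) * f j).
      by rewrite -mulrA mulrCA; congr (_ * _); rewrite mulr_sumr; apply: eq_bigr => j _; rewrite mulrA.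
    under eq_bigr do rewrite deg_halfwalk.
    transitivity ((f i * \sum_j (deg i * (i == j)%:R * f j) - \sum_j A i j * (f i * f j)) / 2).
      rewrite mulrBl !mulr_sumr !mulr_suml -sumrB; apply: eq_bigr => j _; ring.
    congr ((_ - _) / 2); rewrite (bigD1 i) //= eqxx mulr1n big1 ?addr0; first by ring.
    by move=> j; rewrite eq_sym => /negPf ->; rewrite mulr0 mul0r.
  under eq_bigr do rewrite E.
  have E2 : \sum_i \sum_j A i j * f i ^+ 2 = \sum_i deg i * f i ^+ 2.
    by apply: eq_bigr => i _; rewrite mulr_suml.
  have E3 : \sum_i \sum_j A i j * f j ^+ 2 = \sum_i deg i * f i ^+ 2.
    rewrite exchange_big -E2; apply: eq_bigr => i _; apply: eq_bigr => j _.
    by rewrite A_sym.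
  transitivity (4^-1 * (\sum_i \sum_j A i j * f i ^+ 2 + \sum_i \sum_j A i j * f j ^+ 2
     - 2 * \sum_i \sum_j A i j * (f i * f j))).
    by rewrite E2 E3 -mulr_suml sumrB; field.
  congr (_ * _); rewrite mulr_sumr -big_split -sumrB /=; apply: eq_bigr => i _.
  rewrite mulr_sumr -big_split -sumrB /=; apply: eq_bigr => j _; ring.
apply: mulr_ge0; first by rewrite invr_ge0 ler0n.
by apply: sumr_ge0 => i _; apply: sumr_ge0 => j _; rewrite mulr_ge0 ?sqr_ge0.
Qed.

(** The moment <e_l, L^k e_l> for the degree-weighted inner product. Since L is self-adjoint, the
    Rayleigh quotient of L^j e_l is the ratio of the moments of orders 2j + 1 and 2j. *)
Definition return_weight (l : 'I_n) (k : nat) : F := deg l * (L ^+ k) l l.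

Lemma return_weightE l a b :
  \sum_i deg i * (L ^+ a) i l * (L ^+ b) i l = return_weight l (a + b).
Proof.
rewrite /return_weight exprD mxE mulr_sumr; apply: eq_bigr => i _.
by rewrite halfwalkX_sym mulrA.
Qed.

(* Positivity of L at the vector y - L y / kappa, where y = L^j e_l. *)
Lemma return_weight_step (kappa : F) l j : 0 < kappa ->
  return_weight l j.*2.+1 <= kappa * return_weight l j.*2 ->
  return_weight l j.+1.*2.+1 <= kappa * return_weight l j.+1.*2 ->
  return_weight l j.+1.*2 <= kappa ^+ 2 * return_weight l j.*2.
Proof.
move=> k0 H1 H2; set c := kappa^-1.
have := halfwalk_psd (fun i => (L ^+ j) i l - c * (L ^+ j.+1) i l).
have LE a i : \sum_j L i j * (L ^+ a) j l = (L ^+ a.+1) i l by rewrite exprS mxE.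
under eq_bigr => i _.
  under eq_bigr do rewrite mulrBr mulrCA.
  rewrite sumrB -mulr_sumr !LE.
  have -> : deg i * ((L ^+ j) i l - c * (L ^+ j.+1) i l)
       * ((L ^+ j.+1) i l - c * (L ^+ j.+2) i l)
    = deg i * (L ^+ j) i l * (L ^+ j.+1) i l
      - c * (deg i * (L ^+ j.+1) i l * (L ^+ j.+1) i l)
      - c * (deg i * (L ^+ j) i l * (L ^+ j.+2) i l)
      + c ^+ 2 * (deg i * (L ^+ j.+1) i l * (L ^+ j.+2) i l) by ring.
  over.
rewrite big_split /= sumrB sumrB -!mulr_sumr !return_weightE.
have -> : (j + j.+1 = j.*2.+1)%N by lia.
have -> : (j.+1 + j.+1 = j.+1.*2)%N by lia.
have -> : (j + j.+2 = j.+1.*2)%N by lia.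
have -> : (j.+1 + j.+2 = j.+1.*2.+1)%N by lia.
move: H1 H2; set a := return_weight l j.*2; set b := return_weight _ _.
set e := return_weight _ _; set d := return_weight _ _ => H1 H2 H3.
have kc : kappa * c = 1 by rewrite divff // gt_eqF.
have c0 : 0 < c by rewrite invr_gt0.
have H4 : c ^+ 2 * e <= c * d.
  have -> : c * d = c ^+ 2 * (kappa * d) by rewrite -[LHS]mul1r -kc; ring.
  by rewrite ler_pM2l ?exprn_gt0.
have H5 : c * d <= b by lra.
have : kappa * (c * d) <= kappa * b by rewrite ler_pM2l.
rewrite mulrA kc mul1r => H6; apply: (le_trans H6).
by rewrite expr2 -mulrA ler_pM2l.
Qed.

Lemma return_weight_le (kappa : F) l k : 0 < kappa ->
  (forall j, (j <= k)%N ->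
     return_weight l j.*2.+1 <= kappa * return_weight l j.*2) ->
  return_weight l k.*2 <= kappa ^+ k.*2 * deg l.
Proof.
move=> k0; elim: k => [|k IH] H.
  by rewrite /return_weight !expr0 mul1r mxE eqxx mulr1.
apply: le_trans (return_weight_step _ _ _ k0 (H k (leqnSn k)) (H k.+1 (leqnn _))) _.
rewrite doubleS !exprS expr0 mulr1 -!mulrA !ler_pM2l //; apply: IH => j jk.
by apply: H; apply: leq_trans jk _.
Qed.

Definition correlation (M : 'I_n -> 'I_n -> F) (k : nat) : F :=
  \sum_i \sum_j deg i * (L ^+ k) i j * M i j.

(** AM-GM with weight s = kappa^k is applied to each entry of L^k. The squares in column l sum, with
    degree weights, to the return weight of order 2k, at most s^2 times the degree of l, so both
    halves come out proportional to s. *)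
Lemma correlation_le (M : 'I_n -> 'I_n -> F) (kappa : F) k : 0 < kappa ->
  (forall i j, `|M i j| <= 1) ->
  (forall l j, (j <= k)%N ->
     return_weight l j.*2.+1 <= kappa * return_weight l j.*2) ->
  correlation M k <= n%:R * kappa ^+ k * volume.
Proof.
move=> k0 M1 H; set s := kappa ^+ k; have s0 : 0 < s by rewrite exprn_gt0.
have E i l : deg i * (L ^+ k) i l * M i l
    <= (s * deg i + s^-1 * (deg i * (L ^+ k) i l * (L ^+ k) i l)) / 2.
  set T := (L ^+ k) i l.
  apply: (@le_trans _ _ (deg i * `|T|)).
    rewrite -mulrA ler_wpM2l ?deg_ge0 // (le_trans (ler_norm _)) // normrM.
    by rewrite ler_piMr.
  have -> : (s * deg i + s^-1 * (deg i * T * T)) / 2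
     = deg i * ((s + s^-1 * `|T| ^+ 2) / 2).
    by rewrite real_normK ?num_real //; ring.
  rewrite ler_wpM2l ?deg_ge0 //.
  have : 0 <= s^-1 * (s - `|T|) ^+ 2 by rewrite mulr_ge0 ?sqr_ge0 ?invr_ge0 ?ltW.
  have -> : s^-1 * (s - `|T|) ^+ 2 = s^-1 * s * s - s^-1 * s * (2 * `|T|) + s^-1 * `|T| ^+ 2.
    by ring.
  by rewrite mulVf ?gt_eqF //; lra.
apply: (@le_trans _ _ (\sum_l \sum_i (s * deg i + s^-1 * (deg i * (L ^+ k) i l * (L ^+ k) i l)) / 2)).
  rewrite exchange_big /=; apply: ler_sum => i _; apply: ler_sum => l _; exact: E.
apply: (@le_trans _ _ (\sum_(l < n) (s * volume + s * deg l) / 2)).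
  apply: ler_sum => l _; rewrite -mulr_suml ler_pM2r ?invr_gt0 ?ltr0n //.
  rewrite big_split /= -!mulr_sumr return_weightE addnn lerD2l.
  rewrite ler_pdivrMl // (le_trans (return_weight_le _ _ _ k0 (fun j => H l j))) //.
  by rewrite -addnn exprD -mulrA.
rewrite -mulr_suml big_split /= sumr_const card_ord -(mulr_natl (s * volume)) -mulr_sumr -/volume.
rewrite ler_pdivrMr ?ltr0n // -(mulrA n%:R s).
have V0 : 0 <= s * volume by rewrite mulr_ge0 ?volume_ge0 ?ltW.
(* What has been reached is (n + 1) / 2 times s times the volume; it is below n times that as soon
   as there is a vertex. *)
have [n0|n0] := posnP n; last first.
  have n1 : 1 <= n%:R :> F by rewrite ler1n.
  nra.
have -> : volume = 0 by rewrite /volume big1 // => -[i Hi]; exfalso; move: Hi; rewrite n0.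
by rewrite !(mulr0, mul0r) addr0.
Qed.

(* Near-positivity of M is applied to the rows of L^k shifted by c e_l, where c
   is the average correlation at distance k, and averaged over l. *)
Lemma correlation_double (M : 'I_n -> 'I_n -> F) (e : F) k :
  0 < volume -> 0 <= e ->
  (forall i, M i i = 1) -> (forall i j, M i j = M j i) ->
  (forall i j, `|M i j| <= 1) ->
  (forall v : 'I_n -> F,
     - (e * (\sum_i `|v i|) ^+ 2) <= \sum_i \sum_j v i * v j * M i j) ->
  (correlation M k / volume) ^+ 2 - 4 * e <= correlation M k.*2 / volume.
Proof.
move=> V0 e0 M1 Ms Ml psd; set c := correlation M k / volume.
pose T := L ^+ k; rewrite -/T.
have row_le i : \sum_j `|T i j| <= 1 by apply: halfwalkX_norm.
have cE : \sum_l deg l * \sum_j T l j * M l j = correlation M k.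
  by apply: eq_bigr => l _; rewrite mulr_sumr; apply: eq_bigr => j _; rewrite mulrA.
have c1 : `|c| <= 1.
  rewrite normrM normfV (gtr0_norm V0) ler_pdivrMr // mul1r -cE.
  rewrite (le_trans (ler_norm_sum _ _ _)) //; apply: ler_sum => l _.
  rewrite normrM (ger0_norm (deg_ge0 _)) ler_piMr ?deg_ge0 //.
  rewrite (le_trans (ler_norm_sum _ _ _)) // (le_trans _ (row_le l)) //.
  by apply: ler_sum => j _; rewrite normrM ler_piMr.
have key l : - (4 * e) <= (\sum_i \sum_j T l i * T l j * M i j)
     - 2 * c * (\sum_j T l j * M l j) + c ^+ 2.
  have := psd (fun i => T l i - c * (i == l)%:R).
  have -> : \sum_i \sum_j (T l i - c * (i == l)%:R) * (T l j - c * (j == l)%:R) * M i j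
    = (\sum_i \sum_j T l i * T l j * M i j) - 2 * c * (\sum_j T l j * M l j) + c ^+ 2.
    transitivity (\sum_i \sum_j T l i * T l j * M i j
      - c * (\sum_i T l i * \sum_j (j == l)%:R * M i j)
      - c * (\sum_i (i == l)%:R * \sum_j T l j * M i j)
      + c ^+ 2 * (\sum_i (i == l)%:R * \sum_j (j == l)%:R * M i j)).
      rewrite !mulr_sumr -!sumrB -big_split /=; apply: eq_bigr => i _.
      rewrite !mulr_sumr -!sumrB -big_split /=; apply: eq_bigr => j _; ring.
    have D (f : 'I_n -> F) : \sum_i (i == l)%:R * f i = f l.
      rewrite (bigD1 l) //= eqxx mul1r big1 ?addr0 // => i /negPf ->.
      by rewrite mul0r.
    under [X in _ - c * X - _]eq_bigr do rewrite D.
    under [X in _ + _ * X]eq_bigr do rewrite D.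
    rewrite !D M1 mulr1; under [X in _ - c * X - _]eq_bigr do rewrite Ms.
    ring.
  apply: le_trans; rewrite lerN2 [leRHS]mulrC ler_wpM2l //.
  (* The row and the shift each have l1 norm at most 1; the square of 2 is the 4 of the
     statement. *)
  have : \sum_i `|T l i - c * (i == l)%:R| <= 2.
    apply: (@le_trans _ _ (\sum_i (`|T l i| + (i == l)%:R))).
      apply: ler_sum => i _; rewrite (le_trans (ler_normB _ _)) // lerD2l.
      by rewrite normrM normr_nat ler_piMl.
    rewrite big_split /= (_ : 2 = 1 + 1) // lerD //.
    by rewrite (bigD1 l) //= eqxx big1 ?addr0 // => i /negPf ->.
  have : 0 <= \sum_i `|T l i - c * (i == l)%:R| by apply: sumr_ge0.
  set S := \sum_i _; nra.
have E2 : correlation M k.*2 = \sum_l deg l * \sum_i \sum_j T l i * T l j * M i j.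
  rewrite /correlation -addnn exprD -/T.
  transitivity (\sum_i \sum_j \sum_l deg l * (T l i * T l j * M i j)).
    apply: eq_bigr => i _; apply: eq_bigr => j _; rewrite mxE mulr_sumr mulr_suml.
    by apply: eq_bigr => l _; rewrite !mulrA halfwalkX_sym.
  under eq_bigr do rewrite exchange_big /=.
  rewrite exchange_big /=; apply: eq_bigr => l _; rewrite mulr_sumr.
  by apply: eq_bigr => i _; rewrite mulr_sumr.
have : \sum_l deg l * (- (4 * e)) <= \sum_l deg l * ((\sum_i \sum_j T l i * T l j * M i j)
     - 2 * c * (\sum_j T l j * M l j) + c ^+ 2).
  by apply: ler_sum => l _; rewrite ler_wpM2l ?deg_ge0.
have -> : \sum_l deg l * ((\sum_i \sum_j T l i * T l j * M i j)
     - 2 * c * (\sum_j T l j * M l j) + c ^+ 2)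
  = correlation M k.*2 - 2 * c * correlation M k + c ^+ 2 * volume.
  rewrite E2 -cE !mulr_sumr -sumrB -big_split /=; apply: eq_bigr => l _; ring.
rewrite -mulr_suml -/volume.
have -> : correlation M k = c * volume by rewrite /c divfK // gt_eqF.
rewrite ler_pdivlMr //; move=> H.
have -> : (c ^+ 2 - 4 * e) * volume = volume * - (4 * e) + c ^+ 2 * volume by ring.
by move: H; set X := correlation M _; nra.
Qed.

Lemma correlation1 (M : 'I_n -> 'I_n -> F) (e : F) :
  (forall i, M i i = 1) ->
  \sum_i \sum_j A i j * (1 + M i j) <= 4 * e * volume ->
  (1 - 2 * e) * volume <= correlation M 1.
Proof.
move=> M1.
have -> : \sum_i \sum_j A i j * (1 + M i j) = volume + \sum_i \sum_j A i j * M i j.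
  rewrite /volume -big_split /=; apply: eq_bigr => i _; rewrite /deg -big_split /=.
  by apply: eq_bigr => j _; rewrite mulrDr mulr1.
have -> : correlation M 1 = (volume - \sum_i \sum_j A i j * M i j) / 2.
  rewrite /volume -sumrB mulr_suml; apply: eq_bigr => i _; rewrite expr1.
  under eq_bigr do rewrite deg_halfwalk.
  transitivity ((\sum_j deg i * (i == j)%:R * M i j - \sum_j A i j * M i j) / 2).
    rewrite -sumrB mulr_suml; apply: eq_bigr => j _; ring.
  congr ((_ - _) / 2); rewrite (bigD1 i) //= eqxx big1 ?addr0 ?M1 ?mulr1 //.
  by move=> j; rewrite eq_sym => /negPf ->; rewrite mulr0 mul0r.
lra.
Qed.

(** The factor 1 + eps closes the induction: with u = (1 - 3 eps)^(2^r), squaring (1 + eps) u leaves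
    an extra eps u^2, which pays for the loss 4 e of one doubling. It is available at the start
    because (1 + eps) (1 - 3 eps) <= 1 - 2 eps. The powers decrease, so the bound on e at the last
    level implies it at all earlier ones. *)
Lemma correlation_ge (M : 'I_n -> 'I_n -> F) (eps e : F) r :
  0 < volume -> 0 <= e -> 0 < eps -> 3 * eps < 1 ->
  (forall i, M i i = 1) -> (forall i j, M i j = M j i) ->
  (forall i j, `|M i j| <= 1) ->
  (forall v : 'I_n -> F,
     - (e * (\sum_i `|v i|) ^+ 2) <= \sum_i \sum_j v i * v j * M i j) ->
  \sum_i \sum_j A i j * (1 + M i j) <= 4 * eps * volume ->
  4 * e <= eps * (1 - 3 * eps) ^+ (2 ^ r) ->
  (1 + eps) * (1 - 3 * eps) ^+ (2 ^ r) <= correlation M (2 ^ r) / volume.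
Proof.
move=> V0 e0 eps0 eps1 M1 Ms Ml psd edges; set th := 1 - 3 * eps.
have th0 : 0 < th by rewrite /th; lra.
have th1 : th <= 1 by rewrite /th; lra.
elim: r => [|r IH] He.
  rewrite expn0 expr1 ler_pdivlMr //.
  apply: le_trans (correlation1 _ _ M1 edges); rewrite ler_wpM2r ?ltW // /th; nra.
have He' : 4 * e <= eps * th ^+ (2 ^ r).
  apply: (le_trans He); rewrite (ler_wpM2l (ltW eps0)) //.
  by rewrite (ler_wiXn2l (ltW th0) th1) // leq_exp2l.
have {}IH : (1 + eps) * th ^+ (2 ^ r) <= correlation M (2 ^ r) / volume.
  exact: IH.
have := correlation_double M e (2 ^ r) V0 e0 M1 Ms Ml psd.
have E2 : (2 ^ r.+1 = (2 ^ r).*2)%N by rewrite expnS mul2n.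
rewrite E2; apply: le_trans.
move: IH He; rewrite E2 -addnn exprD; set u := th ^+ _; set X := correlation M _ / _.
have u0 : 0 < u by rewrite exprn_gt0.
move=> IH He.
have : ((1 + eps) * u) ^+ 2 <= X ^+ 2.
  by rewrite ler_sqr ?nnegrE ?(le_trans _ IH) // mulr_ge0 ?(ltW u0) //; lra.
have -> : ((1 + eps) * u) ^+ 2 = (1 + eps) * (u * u) + eps * (u * u) + eps ^+ 2 * (u * u) by ring.
have : 0 <= eps ^+ 2 * (u * u) by rewrite !mulr_ge0 ?ltW // exprn_gt0.
lra.
Qed.

Lemma large_rayleigh (M : 'I_n -> 'I_n -> F) (eps e kappa : F) r :
  0 < kappa ->
  0 < volume -> 0 <= e -> 0 < eps -> 3 * eps < 1 ->
  (forall i, M i i = 1) -> (forall i j, M i j = M j i) ->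
  (forall i j, `|M i j| <= 1) ->
  (forall v : 'I_n -> F,
     - (e * (\sum_i `|v i|) ^+ 2) <= \sum_i \sum_j v i * v j * M i j) ->
  \sum_i \sum_j A i j * (1 + M i j) <= 4 * eps * volume ->
  4 * e <= eps * (1 - 3 * eps) ^+ (2 ^ r) ->
  n%:R * kappa ^+ (2 ^ r) <= (1 - 3 * eps) ^+ (2 ^ r) ->
  exists l j, (j <= 2 ^ r)%N /\
    kappa * return_weight l j.*2 < return_weight l j.*2.+1.
Proof.
move=> k0 V0 e0 eps0 eps1 M1 Ms Ml psd edges He Hn.
apply/not_existsP => H.
have H' l j : (j <= 2 ^ r)%N ->
     return_weight l j.*2.+1 <= kappa * return_weight l j.*2.
  move=> jr; rewrite leNgt; apply/negP => lt; apply: (H l); exists j; by split.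
have := correlation_le M kappa (2 ^ r) k0 Ml H'.
have := correlation_ge M eps e r V0 e0 eps0 eps1 M1 Ms Ml psd edges He.
rewrite ler_pdivlMr // => H1 /(le_trans H1); rewrite ler_pM2r //.
move=> /le_trans /(_ Hn).
have : 0 < (1 - 3 * eps) ^+ (2 ^ r) by rewrite exprn_gt0 // subr_gt0.
(* The two bounds now read (1 + eps) u <= u with u positive. *)
set u := (_ ^+ _) => u0; nra.
Qed.

End Walk.

(** * Threshold rounding *)

(** The weights [c] replace the density of a random threshold. The jump from the next smaller value
    (or from 0) up to [a k] is shared equally by all indices with that value, which avoids sorting
    and treats ties symmetrically. *)
Lemma layer_cake (F : realFieldType) (I : finType) (a : I -> F) :
  (forall i, 0 <= a i) ->
  exists c : I -> F, [/\ forall k, 0 <= c k, forall k, a k = 0 -> c k = 0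
    & forall i, \sum_(k | a k <= a i) c k = a i].
Proof.
move=> a0; pose prev i := \big[Num.max/0]_(j | a j < a i) a j.
have prev_le i : prev i <= a i by apply: bigmax_le => // j /ltW.
pose c k := (a k - prev k) / #|[pred j | a j == a k]|%:R.
exists c; split=> [k|k ak|i].
- by rewrite divr_ge0 // subr_ge0.
- rewrite /c ak /prev ak big_pred0 ?subr0 ?mul0r // => j.
  by apply/negbTE; rewrite -leNgt.
have [m] := ubnP #|[pred j | a j < a i]|; elim: m i => // m IH i Hm.
rewrite (bigID (fun k => a k == a i)) /=.
have -> : \sum_(k | (a k <= a i) && (a k == a i)) c k = a i - prev i.
  rewrite (eq_bigl (fun k => k \in [pred j | a j == a i])); last first.
    by move=> k; rewrite inE andbC; case: eqVneq => [->|]; rewrite ?lexx.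
  rewrite (eq_bigr (fun=> c i)); last first.
    by move=> k; rewrite inE => /eqP E; rewrite /c /prev E.
  rewrite sumr_const -mulr_natl /c mulrC divfK // pnatr_eq0 -lt0n.
  by apply/card_gt0P; exists i; rewrite inE.
rewrite (eq_bigl (fun k => a k < a i)); last first.
  by move=> k; rewrite lt_neqAle andbC.
case: (pickP (fun j => a j < a i)) => [j0 Hj0|H0]; last first.
  rewrite /prev (big_pred0 _ _ _ _ H0) (big_pred0 _ _ _ _ H0); ring.
case: (@arg_maxP _ _ _ j0 (fun j => a j < a i) a Hj0) => j Hj Hmax.
have -> : prev i = a j.
  apply/eqP; rewrite eq_le; apply/andP; split; first by apply: bigmax_le.
  by apply: le_bigmax_cond.
rewrite (eq_bigl (fun k => a k <= a j)).
  rewrite IH; first by ring.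
  rewrite -ltnS (leq_trans _ Hm) // ltnS; apply: proper_card; apply/properP; split.
    by apply/fintype.subsetP => k; rewrite !inE => /lt_trans; apply.
  by exists j; rewrite !inE // ltxx.
move=> k; apply/idP/idP => [/Hmax //|/le_lt_trans]; exact.
Qed.

Section Threshold.
Context (F : realFieldType) (n : nat) (A : 'I_n -> 'I_n -> F).
Hypothesis A_ge0 : forall i j, 0 <= A i j.
Hypothesis A_sym : forall i j, A i j = A j i.

Definition threshold (y : 'I_n -> F) (k i : 'I_n) : F :=
  Num.sg (y i) * (`|y k| <= `|y i|)%R%:R.

(** The threshold is drawn on the scale of the squares. For entries of equal sign the triangle
    inequality is enough, because |y_i + y_j| = |y_i| + |y_j|. For opposite signs the two entries
    cancel whenever both survive, so only thresholds between the two squares count, and their total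
    weight is the difference of the squares. *)
Lemma threshold_layer (y : 'I_n -> F) :
  exists c : 'I_n -> F, [/\ forall k, 0 <= c k,
    forall i, \sum_k c k * `|threshold y k i| = y i ^+ 2
    & forall i j, \sum_k c k * `|threshold y k i + threshold y k j|
        <= `|y i + y j| * (`|y i| + `|y j|)].
Proof.
have [c [c0 cz cE]] := layer_cake F _ (fun i => y i ^+ 2) (fun i => sqr_ge0 (y i)).
have cE' i : \sum_k c k * (`|y k| <= `|y i|)%R%:R = y i ^+ 2.
  rewrite -cE big_mkcond [RHS]big_mkcond; apply: eq_bigr => k _ /=.
  rewrite -(real_normK (num_real (y k))) -(real_normK (num_real (y i))).
  by rewrite ler_sqr ?nnegrE //; case: ifP; rewrite ?mulr1 ?mulr0.
have zE i : \sum_k c k * `|threshold y k i| = y i ^+ 2.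
  have [y0|y0] := eqVneq (y i) 0.
    rewrite y0 big1 ?expr0n //= => k _.
    by rewrite /threshold y0 sgr0 mul0r normr0 mulr0.
  rewrite -cE'; apply: eq_bigr => k _; congr (_ * _).
  by rewrite normrM normr_sg y0 mul1r normr_nat.
exists c; split=> // i j.
have tri : \sum_k c k * `|threshold y k i + threshold y k j| <= y i ^+ 2 + y j ^+ 2.
  rewrite -!zE -big_split /=; apply: ler_sum => k _.
  by rewrite -mulrDr ler_wpM2l // ler_normD.
have same : 0 <= y i * y j -> `|y i + y j| = `|y i| + `|y j|.
  move=> yij; have [->|/eqP] := eqVneq (y i) 0; first by rewrite normr0 !add0r.
  move=> /eqP yi0; apply/eqP; rewrite -(@eqrXn2 _ 2) ?addr_ge0 //.
  rewrite real_normK ?num_real // !sqrrD !real_normK ?num_real //.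
  by rewrite -normrM (ger0_norm yij).
have opp i' j' : y i' * y j' < 0 -> `|y j'| <= `|y i'| ->
    \sum_k c k * `|threshold y k i' + threshold y k j'|
        <= `|y i' + y j'| * (`|y i'| + `|y j'|).
  move=> yij le_ji.
  have yi0 : y i' != 0 by apply: contraTneq yij => ->; rewrite mul0r ltxx.
  have sg : Num.sg (y j') = - Num.sg (y i').
    have [yi|yi|yi] := ltgtP (y i') 0; last by rewrite yi eqxx in yi0.
    - by rewrite (ltr0_sg yi) opprK gtr0_sg // -(nmulr_rlt0 _ yi).
    - by rewrite (gtr0_sg yi) ltr0_sg // -(pmulr_rlt0 _ yi).
  have -> : \sum_k c k * `|threshold y k i' + threshold y k j'| = y i' ^+ 2 - y j' ^+ 2.
    rewrite -!cE' -sumrB; apply: eq_bigr => k _; rewrite -mulrBr /threshold.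
    rewrite sg mulNr -mulrBr normrM normr_sg yi0 mul1r.
    have [h|h] := leP `|y k| `|y j'|.
      by rewrite (le_trans h le_ji) subrr normr0.
    by rewrite subr0 normr_nat.
  rewrite -(real_normK (num_real (y i'))) -(real_normK (num_real (y j'))) subr_sqr.
  by rewrite ler_wpM2r ?addr_ge0 // lerB_normD.
have [yij|yij] := leP 0 (y i * y j).
  by apply: (le_trans tri); rewrite (same yij) -(real_normK (num_real (y i)))
    -(real_normK (num_real (y j))) mulrDr !mulrDl -!expr2 addrA lerD2r -addrA
    lerDl addr_ge0 ?mulr_ge0.
have [|/ltW] := leP `|y j| `|y i|; first exact: opp.
rewrite mulrC in yij => /(opp _ _ yij).
by under eq_bigr do rewrite addrC; rewrite addrC [X in _ <= _ * X -> _]addrC.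
Qed.

Local Notation deg := (deg F n A).

Lemma threshold_round (y : 'I_n -> F) :
  16 * (\sum_i \sum_j A i j * (y i + y j) ^+ 2) < \sum_i deg i * y i ^+ 2 ->
  exists k, 2 * (\sum_i \sum_j A i j * `|threshold y k i + threshold y k j|)
            < \sum_i deg i * `|threshold y k i|.
Proof.
move=> H; apply/not_existsP => Hk.
have [c [c0 c1 c2]] := threshold_layer y.
have E1 : \sum_i \sum_j A i j * y i ^+ 2 = \sum_i deg i * y i ^+ 2.
  by apply: eq_bigr => i _; rewrite mulr_suml.
have E2 : \sum_i \sum_j A i j * y j ^+ 2 = \sum_i deg i * y i ^+ 2.
  rewrite exchange_big -E1; apply: eq_bigr => i _; apply: eq_bigr => j _.
  by rewrite A_sym.
have : \sum_k c k * (\sum_i deg i * `|threshold y k i|)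
   <= \sum_k c k * (2 * \sum_i \sum_j A i j * `|threshold y k i + threshold y k j|).
  by apply: ler_sum => k _; rewrite ler_wpM2l // leNgt; apply/negP/Hk.
have -> : \sum_k c k * (\sum_i deg i * `|threshold y k i|) = \sum_i deg i * y i ^+ 2.
  under eq_bigr do rewrite mulr_sumr.
  rewrite exchange_big; apply: eq_bigr => i _; rewrite -c1 mulr_sumr.
  by apply: eq_bigr => k _; rewrite mulrCA.
have -> : \sum_k c k * (2 * \sum_i \sum_j A i j * `|threshold y k i + threshold y k j|)
  = 2 * \sum_i \sum_j A i j * \sum_k c k * `|threshold y k i + threshold y k j|.
  under eq_bigr do rewrite mulrCA; rewrite -mulr_sumr; congr (2 * _).
  under eq_bigr do rewrite mulr_sumr.
  rewrite exchange_big; apply: eq_bigr => i _.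
  under eq_bigr do rewrite mulr_sumr.
  rewrite exchange_big; apply: eq_bigr => j _; rewrite mulr_sumr.
  by apply: eq_bigr => k _; rewrite mulrCA.
apply/negP; rewrite -ltNge.
(* In place of Cauchy-Schwarz: s (u + v) <= 4 s^2 + (u + v)^2 / 16 and (u + v)^2 <= 2 (u^2 + v^2).
   After summation this is 8 times the energy plus half of the norm, and the factor 16 of the
   hypothesis makes it smaller than the norm. *)
apply: (@le_lt_trans _ _ (2 * \sum_i \sum_j A i j * (4 * (y i + y j) ^+ 2 + 8^-1 * (y i ^+ 2 + y j ^+ 2)))).
  rewrite ler_pM2l //; apply: ler_sum => i _; apply: ler_sum => j _; rewrite ler_wpM2l //.
  apply: (le_trans (c2 i j)).
  rewrite -(real_normK (num_real (y i + y j))) -(real_normK (num_real (y i)))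
    -(real_normK (num_real (y j))).
  set s := `|y i + y j|; set u := `|y i|; set v := `|y j|.
  have : 0 <= (8 * s - (u + v)) ^+ 2 by apply: sqr_ge0.
  have : 0 <= (u - v) ^+ 2 by apply: sqr_ge0.
  nra.
have -> : \sum_i \sum_j A i j * (4 * (y i + y j) ^+ 2 + 8^-1 * (y i ^+ 2 + y j ^+ 2))
  = 4 * (\sum_i \sum_j A i j * (y i + y j) ^+ 2)
   + 8^-1 * (\sum_i \sum_j A i j * y i ^+ 2 + \sum_i \sum_j A i j * y j ^+ 2).
  rewrite mulrDr !mulr_sumr -!big_split /=; apply: eq_bigr => i _.
  rewrite !mulr_sumr -!big_split /=; apply: eq_bigr => j _; ring.
rewrite E1 E2; move: H; set P := \sum_i \sum_j _; set Q := \sum_i _; lra.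
Qed.

Local Notation L := (halfwalk F n A).

(** With m and m' the return weights of orders 2j and 2j + 1, the sum of A_ij (y_i + y_j)^2 for y =
    L^j e_l is 4 (m - m'). The constant 63 / 64 is exactly what puts it below m / 16. *)
Lemma rayleigh_round l j :
  63 / 64 * return_weight F n A l j.*2 < return_weight F n A l j.*2.+1 ->
  exists k, let z := threshold (fun i => (L ^+ j) i l) k in
     2 * (\sum_i \sum_j A i j * `|z i + z j|) < \sum_i deg i * `|z i|.
Proof.
move=> H; apply: threshold_round; set y := fun i => (L ^+ j) i l.
have N : \sum_i deg i * y i ^+ 2 = return_weight F n A l j.*2.
  rewrite -addnn -(return_weightE _ _ _ A_ge0 A_sym); apply: eq_bigr => i _; rewrite -mulrA -expr2 //.
have Ly : \sum_i deg i * y i * \sum_j L i j * y j = return_weight F n A l j.*2.+1.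
  rewrite (_ : j.*2.+1 = j + j.+1)%N; last by lia.
  rewrite -(return_weightE _ _ _ A_ge0 A_sym); apply: eq_bigr => i _.
  by rewrite exprS mxE.
have Ay : \sum_i \sum_j A i j * (y i * y j) = return_weight F n A l j.*2 - 2 * return_weight F n A l j.*2.+1.
  rewrite -Ly -N mulr_sumr -sumrB; apply: eq_bigr => i _.
  have -> : deg i * y i * (\sum_j L i j * y j) = y i * \sum_j (deg i * L i j) * y j.
    by rewrite -mulrA mulrCA; congr (_ * _); rewrite mulr_sumr; apply: eq_bigr => k _; rewrite mulrA.
  have -> : \sum_j (deg i * L i j) * y j = (deg i * y i - \sum_j A i j * y j) / 2.
    under eq_bigr do rewrite (deg_halfwalk _ _ _ A_ge0).
    transitivity ((\sum_j deg i * (i == j)%:R * y j - \sum_j A i j * y j) / 2).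
      by rewrite -sumrB mulr_suml; apply: eq_bigr => k _; ring.
    congr ((_ - _) / 2); rewrite (bigD1 i) //= eqxx mulr1n mulr1 big1 ?addr0 //.
    by move=> k; rewrite eq_sym => /negPf ->; rewrite mulr0 mul0r.
  have -> : \sum_j A i j * (y i * y j) = y i * \sum_j A i j * y j.
    by rewrite mulr_sumr; apply: eq_bigr => k _; rewrite mulrCA.
  by field.
have E1 : \sum_i \sum_j A i j * y i ^+ 2 = \sum_i deg i * y i ^+ 2.
  by apply: eq_bigr => i _; rewrite mulr_suml.
have E2 : \sum_i \sum_j A i j * y j ^+ 2 = \sum_i deg i * y i ^+ 2.
  rewrite exchange_big -E1; apply: eq_bigr => i _; apply: eq_bigr => k _.
  by rewrite A_sym.
have -> : \sum_i \sum_j A i j * (y i + y j) ^+ 2 = \sum_i \sum_j A i j * y i ^+ 2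
   + \sum_i \sum_j A i j * y j ^+ 2 + 2 * \sum_i \sum_j A i j * (y i * y j).
  rewrite mulr_sumr -!big_split /=; apply: eq_bigr => i _.
  rewrite mulr_sumr -!big_split /=; apply: eq_bigr => k _; ring.
rewrite E1 E2 Ay N; lra.
Qed.

End Threshold.

(** * Pseudo-moments *)

Lemma superset_of_card (T : finType) (A : {set T}) (k : nat) :
  (#|A| <= k)%N -> (k <= #|T|)%N -> exists2 S : {set T}, #|S| = k & A \subset S.
Proof.
elim: k => [|k IH] Ak kT.
  by exists A => //; apply/eqP; rewrite -leqn0.
move: Ak; rewrite leq_eqVlt => /predU1P[|Ak]; first by exists A.
have [S Sk AS] := IH Ak (ltnW kT).
have : (0 < #|~: S|)%N by have := cardsC S; rewrite Sk; lia.
case/card_gt0P => x; rewrite inE => xS.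
exists (x |: S)%SET; first by rewrite cardsU1 xS Sk.
by apply: fintype.subset_trans AS _; apply: finset.subsetUr.
Qed.

Section Moments.
Context (F : realFieldType) (n t : nat) (mu : local_pseudodist F n t).

(** Assignments live on a subtype; a total version with a default value spares the membership
    proofs. *)
Definition value_at (S : {set 'I_n}) (x : assignment S) (i : 'I_n) : bool :=
  if insub i is Some a then x a else false.

Lemma value_at_val (S : {set 'I_n}) (x : assignment S) (a : {i | i \in S}) :
  value_at S x (val a) = x a.
Proof. by rewrite /value_at valK. Qed.

Definition restrict (S T : {set 'I_n}) (x : assignment S) : assignment T :=
  [ffun a => value_at S x (val a)].

Lemma agree_restrict (S T : {set 'I_n}) (x : assignment S) (z : assignment T) :
  T \subset S -> agree x z = (z == restrict S T x).
Proof.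
move=> TS; apply/idP/eqP => [/forallP H|->].
  apply/ffunP => b; rewrite ffunE.
  have bS : val b \in S by apply: (fintype.subsetP TS); apply: valP.
  have /forallP /(_ b) := H (Sub (val b) bS); rewrite SubK eqxx /= => /eqP <-.
  by rewrite -value_at_val SubK.
apply/forallP => a; apply/forallP => b; apply/implyP => /eqP E.
by rewrite ffunE -E value_at_val.
Qed.

Lemma separates_restrict (S T : {set 'I_n}) (x : assignment S) i j :
  i \in T -> j \in T ->
  separates i j (restrict S T x) = (value_at S x i != value_at S x j).
Proof.
move=> iT jT; apply/existsP/idP => [[a /existsP[b /and3P[/eqP <- /eqP <-]]]|H].
  by rewrite !ffunE.
exists (Sub i iT); apply/existsP; exists (Sub j jT).
by rewrite !SubK !eqxx !ffunE !SubK.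
Qed.

Lemma local_marginalE (S T : {set 'I_n}) (z : assignment T) :
  #|S| = t -> T \subset S -> local_marginal mu z = marginal (mu S) z.
Proof.
move=> St TS; rewrite /local_marginal; case: pickP => [S' /andP[/eqP S't TS']|].
  by apply: pd_consistent => //; rewrite -St subset_leq_card.
by move=> /(_ S); rewrite St eqxx TS.
Qed.

Lemma pr_neqE (S : {set 'I_n}) i j : #|S| = t -> i \in S -> j \in S ->
  pr_neq mu i j = \sum_(x : assignment S) mu S x * (value_at S x i != value_at S x j)%:R.
Proof.
move=> St iS jS; set T := [set i; j]%SET.
have TS : T \subset S by apply/fintype.subsetP => k; rewrite !inE => /orP[]/eqP ->.
rewrite /pr_neq; under eq_bigr do rewrite (local_marginalE S T) //.
rewrite /marginal (exchange_big_dep xpredT) //=; apply: eq_bigr => x _.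
under eq_bigl do rewrite agree_restrict // andbC.
rewrite big_mkcondr big_pred1_eq separates_restrict ?inE ?eqxx ?orbT //.
by case: ifP => _; rewrite ?mulr1 ?mulr0.
Qed.

Definition moment (i j : 'I_n) : F := 1 - 2 * pr_neq mu i j.

Definition spin (b : bool) : F := if b then 1 else -1.

(** Here [S] is free, by consistency of the marginals, so the moments of any t vertices become
    expectations under one genuine distribution. *)
Lemma momentE (S : {set 'I_n}) i j : #|S| = t -> i \in S -> j \in S ->
  moment i j = \sum_(x : assignment S)
     mu S x * (spin (value_at S x i) * spin (value_at S x j)).
Proof.
move=> St iS jS; rewrite /moment (pr_neqE S) // -[X in X - _](pd_sum mu St) mulr_sumr -sumrB.
apply: eq_bigr => x _; rewrite mulrCA -{1}[mu S x]mulr1 -mulrBr; congr (_ * _).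
by case: value_at; case: value_at; rewrite /spin /= ?mulr1n ?mulr0n; ring.
Qed.

Hypothesis (t2 : (2 <= t)%N) (tn : (t <= n)%N).

Lemma pair_superset (i j : 'I_n) :
  exists S : {set 'I_n}, [/\ #|S| = t, i \in S & j \in S].
Proof.
have [||S St /fintype.subsetP sub] := superset_of_card _ [set i; j]%SET t _ _.
- by rewrite cards2; case: eqP; lia.
- by rewrite card_ord.
by exists S; split; rewrite ?sub ?inE ?eqxx ?orbT.
Qed.

Lemma moment_diag i : moment i i = 1.
Proof.
have [S [St iS _]] := pair_superset i i.
rewrite (momentE S) // -(pd_sum mu St); apply: eq_bigr => x _.
by case: value_at; rewrite /spin; ring.
Qed.

Lemma moment_sym i j : moment i j = moment j i.
Proof.
have [S [St iS jS]] := pair_superset i j.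
by rewrite !(momentE S) //; apply: eq_bigr => x _; rewrite [spin _ * _]mulrC.
Qed.

Lemma pr_neq_ge0 i j : 0 <= pr_neq mu i j.
Proof.
have [S [St iS jS]] := pair_superset i j.
by rewrite (pr_neqE S) //; apply: sumr_ge0 => x _; rewrite mulr_ge0 // pd_ge0.
Qed.

Lemma pr_neq_le1 i j : pr_neq mu i j <= 1.
Proof.
have [S [St iS jS]] := pair_superset i j.
rewrite (pr_neqE S) // -[leRHS](pd_sum mu St); apply: ler_sum => x _.
by rewrite ler_piMr ?lern1 ?leq_b1 //; apply: pd_ge0.
Qed.

Lemma moment_norm i j : `|moment i j| <= 1.
Proof.
rewrite ler_norml /moment; have := pr_neq_ge0 i j; have := pr_neq_le1 i j; lra.
Qed.

(** The form is the expectation of a square under the distribution on a set of size t that contains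
    the image of [g]. Repetitions in [g] are allowed, since independent samples may collide. *)
Lemma moment_psd_local (m : nat) (g : {ffun 'I_m -> 'I_n}) (s : 'I_m -> F) :
  (m <= t)%N -> 0 <= \sum_a \sum_b s a * s b * moment (g a) (g b).
Proof.
move=> mt.
have [||S St /fintype.subsetP sub] := superset_of_card _ [set g a | a : 'I_m] t.
- by apply: leq_trans mt; rewrite (leq_trans (leq_imset_card _ _)) // card_ord.
- by rewrite card_ord.
have gS a : g a \in S by apply: sub; apply: imset_f.
have -> : \sum_a \sum_b s a * s b * moment (g a) (g b)
  = \sum_(x : assignment S) mu S x * (\sum_a s a * spin (value_at S x (g a))) ^+ 2.
  transitivity (\sum_a \sum_b \sum_(x : assignment S)
    mu S x * ((s a * spin (value_at S x (g a))) * (s b * spin (value_at S x (g b))))).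
    apply: eq_bigr => a _; apply: eq_bigr => b _; rewrite (momentE S) // mulr_sumr.
    apply: eq_bigr => x _; ring.
  under eq_bigr do rewrite exchange_big /=.
  rewrite exchange_big /=; apply: eq_bigr => x _.
  rewrite expr2 mulr_suml mulr_sumr; apply: eq_bigr => a _.
  by rewrite !mulr_sumr; apply: eq_bigr => b _.
by apply: sumr_ge0 => x _; rewrite mulr_ge0 ?sqr_ge0 // pd_ge0.
Qed.

(** Independence of two coordinates of a product measure. The indicators [q], inserted in the
    factors a and b, pin g a to i and g b to j, and then the sum over [g] factors over the
    coordinates. *)
Lemma sum_prod_pair (m : nat) (p : 'I_n -> F) (H : 'I_n -> 'I_n -> F) (a b : 'I_m) :
  \sum_i p i = 1 -> a != b ->
  \sum_(g : {ffun 'I_m -> 'I_n}) (\prod_c p (g c)) * H (g a) (g b)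
    = \sum_i \sum_j p i * p j * H i j.
Proof.
move=> p1 ab.
pose q (i j : 'I_n) (c : 'I_m) (k : 'I_n) : F := ((c == a) ==> (k == i))%:R * ((c == b) ==> (k == j))%:R.
have E (g : {ffun 'I_m -> 'I_n}) :
    (\prod_c p (g c)) * H (g a) (g b) =
    \sum_i \sum_j H i j * \prod_c (p (g c) * q i j c (g c)).
  rewrite (bigD1 (g a)) //= (bigD1 (g b)) //=.
  rewrite [X in _ + X + _]big1 ?[X in _ + X]big1 ?addr0.
  - rewrite mulrC; congr (_ * _); apply: eq_bigr => c _; rewrite /q.
    case: (eqVneq c a) => [->|_]; first by rewrite eqxx (negPf ab) !mulr1.
    by case: (eqVneq c b) => [->|_]; rewrite ?eqxx !mulr1.
  - move=> i ia; apply: big1 => j _; rewrite (bigD1 a) //= /q eqxx /=.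
    by rewrite eq_sym (negPf ia) !(mulr0, mul0r).
  move=> j jb; rewrite (bigD1 b) //= /q eqxx (eq_sym b a) (negPf ab) /=.
  by rewrite eq_sym (negPf jb) !(mulr0, mul0r).
under eq_bigr do rewrite E.
rewrite exchange_big /=; apply: eq_bigr => i _.
rewrite exchange_big /=; apply: eq_bigr => j _.
rewrite -mulr_sumr mulrC; congr (_ * _).
rewrite -(bigA_distr_bigA (fun c k => p k * q i j c k)) (bigD1 a) //= (bigD1 b) 1?eq_sym //=.
rewrite [X in _ * (_ * X)]big1 ?mulr1.
  congr (_ * _).
    rewrite (bigD1 i) //= big1 ?addr0 /q ?eqxx ?(negPf ab) ?mulr1 // => k ki.
    by rewrite (negPf ki) mul0r mulr0.
  rewrite (bigD1 j) //= big1 ?addr0 /q ?eqxx eq_sym ?(negPf ab) ?mulr1 // => k kj.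
  by rewrite (negPf kj) mulr0 mulr0.
move=> c /andP[ca cb]; rewrite -p1; apply: eq_bigr => k _.
by rewrite /q (negPf ca) (negPf cb) !mulr1.
Qed.

(* The pseudo-expectation of (s_1 X_{i_1} + ... + s_m X_{i_m})^2 is nonnegative;
   average it over m independent samples i_a drawn from |v| / |v|_1, with signs
   s_a = sg (v i_a). *)
Lemma moment_psd (m : nat) (v : 'I_n -> F) : (1 < m)%N -> (m <= t)%N ->
  - (m.-1%:R^-1 * (\sum_i `|v i|) ^+ 2) <= \sum_i \sum_j v i * v j * moment i j.
Proof.
move=> m1 mt; set N := \sum_i `|v i|.
have [N0|N0] := eqVneq N 0.
  rewrite N0 expr0n mulr0 oppr0 big1 // => i _; apply: big1 => j _.
  have /eqP : v i = 0.
    by apply/eqP; rewrite -normr_eq0; move/eqP: N0; rewrite psumr_eq0 // => /allP /(_ i); rewrite mem_index_enum; apply.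
  by move/eqP=> ->; rewrite !mul0r.
have Ngt0 : 0 < N by rewrite lt_neqAle eq_sym N0 sumr_ge0.
pose p i := `|v i| / N; pose s i := Num.sg (v i).
have ps i : p i * s i = v i / N by rewrite /p /s mulrAC [_ * Num.sg _]mulrC -numEsg.
have p1 : \sum_i p i = 1 by rewrite -mulr_suml divff.
have p0 i : 0 <= p i by rewrite divr_ge0 // ltW.
have prod1 : \sum_(g : {ffun 'I_m -> 'I_n}) \prod_c p (g c) = 1.
  by rewrite -(bigA_distr_bigA (fun _ : 'I_m => p)) big1.
pose X := \sum_i \sum_j p i * p j * (s i * s j * moment i j).
have XE : N ^+ 2 * X = \sum_i \sum_j v i * v j * moment i j.
  rewrite mulr_sumr; apply: eq_bigr => i _; rewrite mulr_sumr; apply: eq_bigr => j _.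
  have -> : p i * p j * (s i * s j * moment i j) = (p i * s i) * (p j * s j) * moment i j by ring.
  by rewrite !ps; field.
have S0 : 0 <= \sum_(g : {ffun 'I_m -> 'I_n}) (\prod_c p (g c)) *
     \sum_a \sum_b s (g a) * s (g b) * moment (g a) (g b).
  apply: sumr_ge0 => g _; rewrite mulr_ge0 ?prodr_ge0 //.
  exact: (moment_psd_local _ _ (fun a => s (g a))).
have S1 : \sum_(g : {ffun 'I_m -> 'I_n}) (\prod_c p (g c)) *
     \sum_a \sum_b s (g a) * s (g b) * moment (g a) (g b) <= m%:R + m%:R * m.-1%:R * X.
  have -> : \sum_(g : {ffun 'I_m -> 'I_n}) (\prod_c p (g c)) *
     \sum_a \sum_b s (g a) * s (g b) * moment (g a) (g b)
    = \sum_a \sum_b \sum_(g : {ffun 'I_m -> 'I_n}) (\prod_c p (g c)) *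
     (s (g a) * s (g b) * moment (g a) (g b)).
    under eq_bigr do rewrite mulr_sumr.
    rewrite exchange_big; apply: eq_bigr => a _.
    under eq_bigr do rewrite mulr_sumr.
    by rewrite exchange_big.
  have -> : m%:R + m%:R * m.-1%:R * X = \sum_(a < m) (1 + m.-1%:R * X).
    by rewrite sumr_const card_ord -mulr_natl; ring.
  (* The diagonal term is at most 1; each of the other m - 1 terms averages to X. Dividing by m
     later leaves the error 1 / (m - 1). *)
  apply: ler_sum => a _; rewrite (bigD1 a) //= lerD //.
    rewrite -[leRHS]prod1; apply: ler_sum => g _; rewrite ler_piMr ?prodr_ge0 //.
    by rewrite moment_diag mulr1 -expr2 sqr_sg lern1 leq_b1.
  rewrite (eq_bigr (fun=> X)); last first.
    move=> b ba; rewrite eq_sym in ba.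
    by rewrite (sum_prod_pair _ _ (fun i j => s i * s j * moment i j) _ _ p1 ba).
  by rewrite sumr_const cardC1 card_ord mulr_natl.
have : - m.-1%:R^-1 <= X.
  have m0 : 0 < m%:R :> F by rewrite ltr0n; lia.
  have m10 : 0 < m.-1%:R :> F by rewrite ltr0n; lia.
  have := le_trans S0 S1.
  have -> : m%:R + m%:R * m.-1%:R * X = m%:R * (1 + m.-1%:R * X) by ring.
  rewrite pmulr_rge0 // => H.
  by rewrite lerNl -[leRHS]mul1r ler_pdivlMr //; lra.
move=> HX; rewrite -XE -mulNr mulrC ler_pM2l // exprn_gt0 //.
Qed.

End Moments.

(** * Partial cuts *)

Section PartialCut.
Context (F : realFieldType) (n : nat) (w : 'I_n -> 'I_n -> F).
Hypothesis w_ge0 : forall i j, 0 <= w i j.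
Hypothesis w_sym : forall i j, w i j = w j i.

Definition weight_total : F := \sum_i \sum_j w i j.

(* A partial cut takes the value 0 at the vertices not placed yet. *)
Definition partial_cut (s : 'I_n -> F) : Prop :=
  forall i, [|| s i == 0, s i == 1 | s i == -1].

Definition free_at (s : 'I_n -> F) (i : 'I_n) : F := (s i == 0)%:R.

Definition restricted (u : 'I_n -> F) (i j : 'I_n) : F := u i * u j * w i j.

(** Twice the cut weight minus the uncut weight among placed vertices, since pairs are ordered.
    Unlike the cut value it makes sense for partial cuts, and it starts at 0. *)
Definition balance (s : 'I_n -> F) : F := - \sum_i \sum_j w i j * (s i * s j).

Definition free_volume (s : 'I_n -> F) : F := volume F n (restricted (free_at s)).

(* Used with theta = 1 for the steps that gain, and with theta = 0 for placing
   the leftover vertices one at a time. *)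
Definition good_step (theta : F) (u z : 'I_n -> F) : Prop :=
  theta * (\sum_i deg F n (restricted u) i * `|z i|)
    <= - 2 * \sum_i \sum_j restricted u i j * (z i * z j).

Lemma partial_cut_free s i : partial_cut s -> free_at s i = 1 - `|s i|.
Proof.
rewrite /free_at => /(_ i) /or3P[]/eqP ->;
  by rewrite ?oppr_eq0 ?oner_eq0 ?eqxx ?normrN ?normr0 ?normr1 ?subr0 ?subrr.
Qed.

Definition extend (sigma : F) (s z : 'I_n -> F) (i : 'I_n) : F := s i + sigma * z i.

Lemma extend_partial_cut sigma s z :
  (sigma == 1) || (sigma == -1) -> partial_cut s -> partial_cut z ->
  (forall i, s i != 0 -> z i = 0) -> partial_cut (extend sigma s z).
Proof.
move=> Hsig Hs Hz sz i; rewrite /extend.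
have [s0|s0] := eqVneq (s i) 0; last by rewrite (sz _ s0) mulr0 addr0; apply: Hs.
rewrite s0 add0r; case/orP: Hsig => /eqP ->; rewrite ?mul1r ?mulN1r; first exact: Hz.
by have := Hz i; rewrite oppr_eq0 eqr_oppLR eqr_opp orbCA orbC -orbA.
Qed.

Lemma extend_norm sigma s z i :
  (sigma == 1) || (sigma == -1) ->
  (forall i, s i != 0 -> z i = 0) -> `|extend sigma s z i| = `|s i| + `|z i|.
Proof.
move=> Hsig sz; rewrite /extend.
have [s0|s0] := eqVneq (s i) 0; last by rewrite (sz _ s0) mulr0 !addr0 normr0 addr0.
rewrite s0 !add0r normr0 add0r normrM.
by case/orP: Hsig => /eqP ->; rewrite ?normrN normr1 mul1r.
Qed.

Lemma extend_balance sigma s z : (sigma == 1) || (sigma == -1) ->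
  balance (extend sigma s z) = balance s
    - 2 * sigma * (\sum_i \sum_j w i j * (s j * z i))
    - \sum_i \sum_j w i j * (z i * z j).
Proof.
move=> Hsig; have S1 : sigma ^+ 2 = 1.
  by case/orP: Hsig => /eqP ->; rewrite ?sqrrN expr1n.
have E : \sum_i \sum_j w i j * (s j * z i) = \sum_i \sum_j w i j * (s i * z j).
  rewrite exchange_big; apply: eq_bigr => i _; apply: eq_bigr => j _.
  by rewrite w_sym.
rewrite /balance -opprD -opprD; congr (- _).
transitivity (\sum_i \sum_j w i j * (s i * s j)
   + sigma * (\sum_i \sum_j w i j * (s j * z i))
   + sigma * (\sum_i \sum_j w i j * (s i * z j))
   + \sum_i \sum_j w i j * (z i * z j)); last by rewrite E; ring.
rewrite !mulr_sumr -!big_split; apply: eq_bigr => i _ /=.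
rewrite !mulr_sumr -!big_split; apply: eq_bigr => j _ /=.
have -> : z i * z j = sigma ^+ 2 * (z i * z j) by rewrite S1 mul1r.
rewrite /extend; ring.
Qed.

(** Inclusion-exclusion: an ordered pair is lost when either end is placed, and the correction for
    both ends placed is the nonnegative product dropped at the end. *)
Lemma extend_free_volume sigma s z : (sigma == 1) || (sigma == -1) ->
  partial_cut s -> partial_cut z -> (forall i, s i != 0 -> z i = 0) ->
  free_volume s - free_volume (extend sigma s z)
    <= 2 * \sum_i deg F n (restricted (free_at s)) i * `|z i|.
Proof.
move=> Hsig Hs Hz sz.
have He := extend_partial_cut _ _ _ Hsig Hs Hz sz.
have fz i : free_at s i * `|z i| = `|z i|.
  rewrite /free_at; case: eqVneq => [_|/sz ->]; first by rewrite mul1r.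
  by rewrite normr0 mulr0.
have -> : 2 * (\sum_i deg F n (restricted (free_at s)) i * `|z i|)
  = \sum_i \sum_j (free_at s j * `|z i| + free_at s i * `|z j|) * w i j.
  have E : \sum_i deg F n (restricted (free_at s)) i * `|z i|
      = \sum_i \sum_j free_at s j * `|z i| * w i j.
    apply: eq_bigr => i _; rewrite mulr_suml; apply: eq_bigr => j _.
    by rewrite /restricted -{2}fz; ring.
  rewrite mulrDl mul1r {1}E E -[X in _ + X]exchange_big /= -big_split /=.
  apply: eq_bigr => i _; rewrite -big_split /=; apply: eq_bigr => j _.
  by rewrite (w_sym j i) mulrDl.
rewrite /free_volume /volume -sumrB; apply: ler_sum => i _.
rewrite /deg -sumrB; apply: ler_sum => j _.
rewrite /restricted !(partial_cut_free (extend _ _ _)) // !extend_norm //.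
rewrite -!mulrBl ler_wpM2r // !(partial_cut_free s) // -subr_ge0.
set a := `|s i|; set b := `|s j|; set c := `|z i|; set d := `|z j|.
have -> : (1 - b) * c + (1 - a) * d
    - ((1 - a) * (1 - b) - (1 - (a + c)) * (1 - (b + d))) = c * d by ring.
exact: mulr_ge0 (normr_ge0 _) (normr_ge0 _).
Qed.

(** The sign [sigma] affects only the cross term with the vertices placed before, and is chosen to
    make it harmless. The gain inside the support is at least theta / 2 times the degrees there,
    hence theta / 4 times the lost volume. *)
Lemma extend_good theta s z :
  partial_cut s -> partial_cut z -> (forall i, s i != 0 -> z i = 0) ->
  0 <= theta -> good_step theta (free_at s) z ->
  forall sigma, (sigma == 1) || (sigma == -1) ->
  sigma * (\sum_i \sum_j w i j * (s j * z i)) <= 0 ->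
  balance s + theta / 4 * (free_volume s - free_volume (extend sigma s z))
    <= balance (extend sigma s z).
Proof.
move=> Hs Hz sz th0 good sigma Hsig Hc.
have := extend_free_volume _ _ _ Hsig Hs Hz sz.
rewrite extend_balance //; move: good; rewrite /good_step.
have -> : \sum_i \sum_j restricted (free_at s) i j * (z i * z j)
   = \sum_i \sum_j w i j * (z i * z j).
  have fz i : free_at s i * z i = z i.
    rewrite /free_at; case: eqVneq => [_|/sz ->]; first by rewrite mul1r.
    by rewrite mulr0.
  apply: eq_bigr => i _; apply: eq_bigr => j _.
  by rewrite -[in RHS]fz -[in X in _ = _ * (_ * X)]fz /restricted; ring.
move: Hc; set c := \sum_i _; set v := \sum_i _; set q := \sum_i _.
set D := free_volume s - _; nra.
Qed.

Lemma balance_single s l : w l l = 0 ->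
  good_step 0 (free_at s) (fun i => (i == l)%:R).
Proof.
move=> wll; rewrite /good_step mul0r big1 ?mulr0 // => i _; apply: big1 => j _.
case: (eqVneq i l) => [->|_]; case: (eqVneq j l) => [->|_];
  by rewrite ?mul0r ?mulr0 // /restricted wll !mulr0 mul0r.
Qed.

Definition walk_vector (u : 'I_n -> F) (l : 'I_n) (j : nat) (i : 'I_n) : F :=
  (halfwalk F n (restricted u) ^+ j) i l.

(** The factor [u i] matters when l itself is placed: it is then isolated in the induced graph and
    the walk vector stays on it. *)
Definition candidate (u : 'I_n -> F) (l : 'I_n) (j : nat) (k i : 'I_n) : F :=
  u i * threshold F n (walk_vector u l j) k i.

Lemma candidate_partial_cut u l j k : (forall i, (u i == 0) || (u i == 1)) ->
  partial_cut (candidate u l j k).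
Proof.
move=> u01 i; rewrite /candidate /threshold.
case/orP: (u01 i) => /eqP ->; first by rewrite mul0r eqxx.
rewrite mul1r; case: (_ <= _); last by rewrite mulr0 eqxx.
rewrite mulr1; have [h|h|->] := ltgtP (walk_vector u l j i) 0.
- by rewrite (ltr0_sg h) eqxx !orbT.
- by rewrite (gtr0_sg h) eqxx orbT.
by rewrite sgr0 eqxx.
Qed.

Lemma free01 s i : (free_at s i == 0) || (free_at s i == 1).
Proof. by rewrite /free_at; case: (s i == 0); rewrite ?eqxx ?orbT. Qed.

Lemma restricted_ge0 u i j : (forall i, (u i == 0) || (u i == 1)) ->
  0 <= restricted u i j.
Proof.
move=> u01; have u0 k : 0 <= u k by case/orP: (u01 k) => /eqP ->.
by rewrite /restricted !mulr_ge0.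
Qed.

Lemma restricted_sym u i j : restricted u i j = restricted u j i.
Proof. by rewrite /restricted w_sym [u i * _]mulrC. Qed.

Section Progress.
Context (t r m : nat) (mu : local_pseudodist F n t) (eps : F).
Hypothesis (tn : (t <= n)%N) (m1 : (1 < m)%N) (mt : (m <= t)%N).
Hypothesis (eps0 : 0 < eps) (eps1 : 3 * eps < 1).
Hypothesis (Hm : 4 * m.-1%:R^-1 <= eps * (1 - 3 * eps) ^+ (2 ^ r)).
Hypothesis (Hn : n%:R * (63 / 64) ^+ (2 ^ r) <= (1 - 3 * eps) ^+ (2 ^ r)).
Hypothesis value : \sum_i \sum_j w i j * (1 - pr_neq mu i j) <= eps * weight_total.

Lemma good_candidate u : (forall i, (u i == 0) || (u i == 1)) ->
  0 < weight_total -> weight_total <= 2 * volume F n (restricted u) ->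
  exists l j k, [/\ (j <= 2 ^ r)%N, good_step 1 u (candidate u l j k)
    & exists i, candidate u l j k i != 0].
Proof.
move=> u01 T0 HV; set A := restricted u; have V0 : 0 < volume F n A by rewrite /A; lra.
have A0 i j : 0 <= A i j by apply: restricted_ge0.
have As i j : A i j = A j i by apply: restricted_sym.
have t2 : (2 <= t)%N by apply: leq_trans mt.
(* Here 1 + M_ij is 2 (1 - Pr), which gives 2 eps times the whole weight; at least half of that
   weight lies in the induced graph, hence the 4. *)
have edges : \sum_i \sum_j A i j * (1 + moment F n t mu i j) <= 4 * eps * volume F n A.
  apply: (@le_trans _ _ (2 * \sum_i \sum_j w i j * (1 - pr_neq mu i j))); last first.
    apply: (@le_trans _ _ (2 * (eps * weight_total))); first by rewrite ler_pM2l.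
    have := ler_wpM2l (ltW eps0) HV; rewrite -/A; lra.
  rewrite mulr_sumr; apply: ler_sum => i _; rewrite mulr_sumr; apply: ler_sum => j _.
  have -> : A i j * (1 + moment F n t mu i j) = (u i * u j) * (2 * (w i j * (1 - pr_neq mu i j))).
    by rewrite /moment /A /restricted; ring.
  have P0 : 0 <= 2 * (w i j * (1 - pr_neq mu i j)).
    by rewrite !mulr_ge0 // subr_ge0; apply: pr_neq_le1.
  case/orP: (u01 i) => /eqP ->; rewrite ?mul0r // mul1r.
  by case/orP: (u01 j) => /eqP ->; rewrite ?mul0r // mul1r.
have k0 : 0 < 63 / 64 :> F by rewrite divr_gt0.
have e0 : 0 <= m.-1%:R^-1 :> F by rewrite invr_ge0.
have [l [j [jr /rayleigh_round H]]] := large_rayleigh _ _ _ A0 As (moment F n t mu) _ _ _ r k0 V0 e0 eps0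
  eps1 (moment_diag _ _ _ _ t2 tn) (moment_sym _ _ _ _ t2 tn) (moment_norm _ _ _ _ t2 tn)
  (fun v => moment_psd _ _ _ _ t2 tn m v m1 mt) edges Hm Hn.
have [k /= Hk] := H A0 As; exists l, j, k.
set z := threshold F n (walk_vector u l j) k; move: Hk; rewrite -/z => Hk.
have Az i j' : A i j' * `|z i + z j'| = A i j' * `|candidate u l j k i + candidate u l j k j'|.
  rewrite /A /restricted /candidate -/z.
  by case/orP: (u01 i) => /eqP ->; case/orP: (u01 j') => /eqP ->; rewrite ?mul0r ?mulr0 ?mul0r // !mul1r.
have dz : \sum_i deg F n A i * `|z i| = \sum_i deg F n A i * `|candidate u l j k i|.
  apply: eq_bigr => i _; rewrite /candidate -/z (normrM (u i)) /deg !mulr_suml.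
  apply: eq_bigr => j' _; rewrite /A /restricted.
  by case/orP: (u01 i) => /eqP ->; rewrite ?mul0r // normr1 !mul1r.
move: Hk; rewrite dz; under eq_bigr do under eq_bigr do rewrite Az.
set c := candidate u l j k; have Hc := candidate_partial_cut u l j k u01; rewrite -/c in Hc.
move=> Hk; have {}Hk : (\sum_i deg F n A i * `|c i|)
    < - 2 * \sum_i \sum_j restricted u i j * (c i * c j).
  have E1 : \sum_i \sum_j A i j * `|c i| = \sum_i deg F n A i * `|c i|.
    by apply: eq_bigr => i _; rewrite mulr_suml.
  have E2 : \sum_i \sum_j A i j * `|c j| = \sum_i deg F n A i * `|c i|.
    rewrite exchange_big -E1; apply: eq_bigr => i _; apply: eq_bigr => j' _.
    by rewrite As.
  (* For a, b in {-1, 0, 1} one has |a| + |b| - 2 |a + b| <= - 2 a b. This turns the rounding bound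
     into the product form of [good_step]. *)
  have : 2 * (- \sum_i \sum_j restricted u i j * (c i * c j)) >=
    \sum_i \sum_j A i j * `|c i| + \sum_i \sum_j A i j * `|c j|
     - 2 * \sum_i \sum_j A i j * `|c i + c j|.
    rewrite -sumrN mulr_sumr [2 * _]mulr_sumr -big_split -sumrB; apply: ler_sum => i _ /=.
    rewrite -sumrN mulr_sumr [2 * _]mulr_sumr -big_split -sumrB; apply: ler_sum => j' _ /=.
    have -> : A i j' * `|c i| + A i j' * `|c j'| - 2 * (A i j' * `|c i + c j'|)
      = A i j' * (`|c i| + `|c j'| - 2 * `|c i + c j'|) by ring.
    have -> : 2 * - (restricted u i j' * (c i * c j')) = A i j' * (- 2 * (c i * c j')).
      by rewrite /A; ring.
    rewrite ler_wpM2l //.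
    case/or3P: (Hc i) => /eqP ->; case/or3P: (Hc j') => /eqP ->;
      rewrite ?add0r ?addr0 ?subrr ?addNr -?opprD ?normrN ?normr0 ?normr1 ?(@ger0_norm _ (1 + 1)) //; lra.
  rewrite E1 E2; move: Hk; set X := \sum_i _; set Y := \sum_i _; set Z := \sum_i _; lra.
split=> //; first by rewrite /good_step mul1r ltW.
apply/not_existsP => H0.
have c0 i : c i = 0 by apply/eqP/negPn/negP/H0.
move: Hk; rewrite big1 ?big1 ?mulr0 ?ltxx // => i _; last by rewrite c0 normr0 mulr0.
by apply: big1 => j' _; rewrite c0 mul0r mulr0.
Qed.

End Progress.

End PartialCut.

(** * Assembling partial cuts into a cut *)

Section Existence.
Context (F : realFieldType) (n : nat) (w : 'I_n -> 'I_n -> F).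
Hypothesis w_ge0 : forall i j, 0 <= w i j.
Hypothesis w_sym : forall i j, w i j = w j i.
Hypothesis w_loopless : forall i, w i i = 0.

Lemma best_sign (c : F) : exists2 sigma : F,
  (sigma == 1) || (sigma == -1) & sigma * c <= 0.
Proof.
have [c0|/ltW c0] := leP c 0; first by exists 1; rewrite ?eqxx ?mul1r.
by exists (-1); rewrite ?eqxx ?orbT // mulN1r oppr_le0.
Qed.

Definition unplaced (s : 'I_n -> F) : nat := #|[pred i | s i == 0]|.

Lemma extend_unplaced sigma s z : (sigma == 1) || (sigma == -1) ->
  (forall i, s i != 0 -> z i = 0) -> (exists i, z i != 0) ->
  (unplaced (extend F n sigma s z) < unplaced s)%N.
Proof.
move=> Hsig sz [i zi]; apply: proper_card; apply/properP; split.
  apply/fintype.subsetP => j; rewrite !inE /extend.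
  have [//|s0] := eqVneq (s j) 0.
  by rewrite (sz _ s0) mulr0 addr0 (negPf s0).
exists i; rewrite !inE; first by apply: contraNT zi => /sz ->.
have si : s i = 0 by apply/eqP; apply: contraNT zi => /sz ->.
rewrite /extend si add0r mulf_neq0 //.
by case/orP: Hsig => /eqP ->; rewrite ?oppr_eq0 oner_eq0.
Qed.

(** A single vertex spans no edge, so placing it with the better sign never lowers the balance. *)
Lemma complete_partial_cut s : partial_cut F n s ->
  exists x : gcut n, balance F n w s <= balance F n w (fun i => spin F (x i)).
Proof.
have [m] := ubnP (unplaced s); elim: m s => // m IH s Hm Hs.
case: (pickP (fun i => s i == 0)) => [l /eqP sl|H0].
  set z := fun i => (i == l)%:R : F.
  have sz i : s i != 0 -> z i = 0.
    by rewrite /z; case: (eqVneq i l) => [->|//]; rewrite sl eqxx.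
  have Hz : partial_cut F n z by move=> i; rewrite /z; case: (i == l); rewrite ?eqxx ?orbT.
  have [sigma Hsig Hc] := best_sign (\sum_i \sum_j w i j * (s j * z i)).
  have := extend_good F n w w_ge0 w_sym 0 s z Hs Hz sz (lexx 0)
    (balance_single F n w s l (w_loopless l)) sigma Hsig Hc.
  rewrite !mul0r addr0 => Hb.
  have [||x Hx] := IH (extend F n sigma s z).
  - rewrite -ltnS (leq_trans _ Hm) // ltnS; apply: extend_unplaced => //.
    by exists l; rewrite /z eqxx oner_eq0.
  - exact: extend_partial_cut.
  by exists x; apply: le_trans Hx.
exists [ffun i => s i == 1]; rewrite (_ : (fun i => _) = s) //.
apply/funext => i; rewrite ffunE; have := Hs i; rewrite H0 /= /spin.
by case: eqVneq => [->|_ /eqP].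
Qed.

Lemma exists_balanced :
  (forall u : 'I_n -> F, (forall i, (u i == 0) || (u i == 1)) ->
     weight_total F n w <= 2 * volume F n (restricted F n w u) ->
     exists l j k, good_step F n w 1 u (candidate F n w u l j k)
       /\ exists i, candidate F n w u l j k i != 0) ->
  0 <= weight_total F n w ->
  exists x : gcut n, weight_total F n w / 8 <= balance F n w (fun i => spin F (x i)).
Proof.
move=> progress T0.
(* Invariant: the balance is at least a quarter of the weight that has left the free graph. When
   more than half has left, this exceeds one eighth of the total. *)
suff H s : partial_cut F n s ->
    weight_total F n w - free_volume F n w s <= 4 * balance F n w s ->
    exists x : gcut n, weight_total F n w / 8 <= balance F n w (fun i => spin F (x i)).
  apply: (H (fun=> 0)); first by move=> i /=; rewrite eqxx.
  rewrite /balance big1 => [|i _]; last by apply: big1 => j _; rewrite mul0r mulr0.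
  rewrite oppr0 mulr0 subr_le0 le_eqVlt; apply/orP; left; apply/eqP.
  apply: eq_bigr => i _; apply: eq_bigr => j _.
  by rewrite /restricted /free_at eqxx !mul1r.
have [m] := ubnP (unplaced s); elim: m s => // m IH s Hm Hs Hb.
have [Hf|Hf] := leP (weight_total F n w) (2 * free_volume F n w s); last first.
  have [x Hx] := complete_partial_cut s Hs; exists x; apply: le_trans Hx; lra.
have [l [j [k [good ex]]]] := progress _ (free01 F n s) Hf.
set z := candidate _ _ _ _ _ _ _ in good ex.
have Hz : partial_cut F n z by apply: candidate_partial_cut => i; apply: free01.
have sz i : s i != 0 -> z i = 0.
  by rewrite /z /candidate /free_at => /negPf ->; rewrite mul0r.
have [sigma Hsig Hc] := best_sign (\sum_i \sum_j w i j * (s j * z i)).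
have := extend_good F n w w_ge0 w_sym 1 s z Hs Hz sz ler01 good sigma Hsig Hc.
move=> Hb'; apply: (IH (extend F n sigma s z)).
- by rewrite -ltnS (leq_trans _ Hm) // ltnS; apply: extend_unplaced.
- exact: extend_partial_cut.
lra.
Qed.

End Existence.

Lemma sum_upper_triangle (F : realFieldType) (n : nat) (f : 'I_n -> 'I_n -> F) :
  (forall i j, f i j = f j i) -> (forall i, f i i = 0) ->
  \sum_i \sum_j f i j = 2 * \sum_(i < n) \sum_(j < n | (i < j)%N) f i j.
Proof.
move=> fs f0.
have -> : \sum_i \sum_j f i j = \sum_(i < n) \sum_(j < n | (i < j)%N) f i j
    + \sum_(i < n) \sum_(j < n | (j < i)%N) f i j.
  rewrite -big_split; apply: eq_bigr => i _ /=.
  rewrite (bigID (fun j : 'I_n => (i < j)%N)) /=; congr (_ + _).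
  rewrite (bigD1 i) ?ltnn //= f0 add0r; apply: eq_bigl => j.
  by rewrite -leqNgt ltn_neqAle andbC.
rewrite mulr_natl mulr2n; congr (_ + _).
rewrite (exchange_big_dep xpredT) //=; apply: eq_bigr => i _; apply: eq_bigr => j _.
exact: fs.
Qed.

(** * Balance, cut value and slack of a graph of total weight 1 *)

Section Weighted.
Context (F : realFieldType) (n : nat) (G : wgraph F n).

Lemma total_weight : weight_total F n G = 2.
Proof.
rewrite /weight_total sum_upper_triangle ?weight_sum ?mulr1 //.
- exact: weight_sym.
- exact: weight_loopless.
Qed.

Lemma cut_value_balance (x : gcut n) :
  cut_value G x = 1 / 2 + balance F n G (fun i => spin F (x i)) / 4.
Proof.
have E : 2 * cut_value G x = \sum_i \sum_j G i j * (x i != x j)%:R.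
  rewrite sum_upper_triangle // => [i j|i]; last by rewrite weight_loopless mul0r.
  by rewrite weight_sym eq_sym.
have : balance F n G (fun i => spin F (x i))
   = 2 * (\sum_i \sum_j G i j * (x i != x j)%:R) - weight_total F n G.
  rewrite /balance /weight_total mulr_sumr -sumrB -sumrN; apply: eq_bigr => i _.
  rewrite mulr_sumr -sumrB -sumrN; apply: eq_bigr => j _.
  by case: (x i); case: (x j); rewrite /spin /= ?mulr1n ?mulr0n; ring.
rewrite total_weight -E; lra.
Qed.

Lemma pd_value_slack (t : nat) (mu : local_pseudodist F n t) (eps : F) :
  (2 <= t)%N -> (t <= n)%N -> 1 - eps <= pd_value G mu ->
  \sum_i \sum_j G i j * (1 - pr_neq mu i j) <= eps * weight_total F n G.
Proof.
move=> t2 tn Hv; rewrite sum_upper_triangle; first last.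
- by move=> i; rewrite weight_loopless mul0r.
- move=> i j; rewrite weight_sym; congr (_ * (1 - _)).
  have := moment_sym F n t mu t2 tn i j; rewrite /moment; lra.
have -> : \sum_(i < n) \sum_(j < n | (i < j)%N) G i j * (1 - pr_neq mu i j) = 1 - pd_value G mu.
  rewrite -[X in X - _](weight_sum G) -sumrB; apply: eq_bigr => i _.
  by rewrite -sumrB; apply: eq_bigr => j _; rewrite mulrBr mulr1.
rewrite total_weight; lra.
Qed.

Lemma exists_half_cut : exists x : gcut n, 1 / 2 <= cut_value G x.
Proof.
have [|x Hx] := complete_partial_cut F n G (weight_ge0 G) (weight_sym G)
  (weight_loopless G) (fun=> 0); first by move=> i /=; rewrite eqxx.
exists x; rewrite cut_value_balance; move: Hx.
rewrite {1}/balance big1 => [|i _]; last by apply: big1 => j _; rewrite mul0r mulr0.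
rewrite oppr0; lra.
Qed.

Lemma pd_value_le1 (t : nat) (mu : local_pseudodist F n t) :
  (2 <= t)%N -> (t <= n)%N -> pd_value G mu <= 1.
Proof.
move=> t2 tn; rewrite -[leRHS](weight_sum G); apply: ler_sum => i _.
by apply: ler_sum => j _; rewrite ler_piMr ?weight_ge0 // pr_neq_le1.
Qed.

End Weighted.

(** * Choice of the parameters *)

Lemma bernoulli (F : realFieldType) (x : F) (k : nat) :
  -1 <= x -> 1 + k%:R * x <= (1 + x) ^+ k.
Proof.
move=> x1; elim: k => [|k IH]; first by rewrite mul0r addr0 expr0.
rewrite exprS; have : 0 <= (1 + x) * ((1 + x) ^+ k - (1 + k%:R * x)).
  by rewrite mulr_ge0 ?subr_ge0 //; lra.
have : 0 <= k%:R * x ^+ 2 by rewrite mulr_ge0 ?sqr_ge0.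
rewrite -natr1; set u := _ ^+ k; nra.
Qed.

Lemma log_lt_linear (n : nat) : (2 ^ 13 <= n)%N ->
  (256 * (trunc_log 2 n).+1 < n)%N.
Proof.
move=> Hn; have n0 : (0 < n)%N by apply: leq_trans Hn.
have H13 : (13 <= trunc_log 2 n)%N by apply: trunc_log_max.
suff H l : (13 <= l)%N -> (256 * l.+1 < 2 ^ l)%N.
  exact: leq_trans (H _ H13) (trunc_logP (isT : 1 < 2)%N n0).
elim: l => // l IH; rewrite leq_eqVlt => /predU1P[<-|]; first by vm_compute.
rewrite ltnS => /IH H; rewrite expnS; lia.
Qed.

Lemma half_pow_127 (F : realFieldType) : (126 / 127) ^+ 127 <= 2^-1 :> F.
Proof.
have B : 1 + 127%:R * 126^-1 <= (1 + 126^-1) ^+ 127 :> F.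
  by apply: bernoulli; lra.
have -> : 126 / 127 = (1 + 126^-1)^-1 :> F by field.
have p0 : 0 < 1 + 126^-1 :> F by lra.
rewrite exprVn lef_pV2 ?posrE ?exprn_gt0 //.
by apply: le_trans B; lra.
Qed.

(** The constants come from 63 / 64 = (126 / 127) (127 / 128): the second factor is at most th, and
    127 powers of the first halve, so 127 L of them absorb n <= 2^L. *)
Lemma decay_upper (F : realFieldType) (th : F) (n L k : nat) :
  127 / 128 <= th -> (n <= 2 ^ L)%N -> (127 * L <= k)%N ->
  n%:R * (63 / 64) ^+ k <= th ^+ k.
Proof.
move=> Hth nL Lk; have th0 : 0 <= th by lra.
have k1 : 63 / 64 <= 126 / 127 * th by lra.
have c0 : 0 <= 126 / 127 :> F by lra.
have c1 : 126 / 127 <= 1 :> F by lra.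
have K : n%:R * (126 / 127) ^+ k <= 1 :> F.
  apply: (@le_trans _ _ (n%:R * (2 ^+ L)^-1)).
    rewrite ler_wpM2l // -exprVn; apply: (@le_trans _ _ ((126 / 127) ^+ (127 * L))).
      exact: ler_wiXn2l.
    by rewrite exprM lerXn2r ?nnegrE ?exprn_ge0 ?invr_ge0 // half_pow_127.
  by rewrite ler_pdivrMr ?exprn_gt0 // mul1r -natrX ler_nat.
apply: (@le_trans _ _ (n%:R * (126 / 127 * th) ^+ k)).
  by rewrite ler_wpM2l // lerXn2r ?nnegrE ?(mulr_ge0 c0 th0) //; lra.
by rewrite exprMn mulrA ler_piMl // exprn_ge0.
Qed.

Lemma decay_lower (F : realFieldType) (eps : F) (q c k : nat) :
  0 <= eps -> 3 * eps <= 1 -> q%:R * (6 * eps) <= 1 -> (k <= q * c)%N ->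
  (2 ^+ c)^-1 <= (1 - 3 * eps) ^+ k.
Proof.
move=> e0 e1 He Hk.
have th0 : 0 <= 1 - 3 * eps by lra.
have th1 : 1 - 3 * eps <= 1 by lra.
apply: (@le_trans _ _ ((1 - 3 * eps) ^+ (q * c))); last exact: ler_wiXn2l.
rewrite -exprVn exprM lerXn2r ?nnegrE ?exprn_ge0 ?invr_ge0 //.
apply: le_trans (_ : 1 + q%:R * (- (3 * eps)) <= _); last by apply: bernoulli; lra.
lra.
Qed.

(* 3072 a = 6 * 512 a, so that (1 - 3 / (3072 a)) ^ (512 a) >= 1 / 2. *)
Definition gap_denominator (a : nat) : nat := (3072 * a)%N.

(** Two demands compete: k = 2^r must be a large multiple of log n, yet (1 - 3 eps)^k must stay well
    above 1 / t. As n <= (t + 1)^a and eps is a small multiple of 1 / a, the power is at least of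
    order t^(-1/2), which leaves room. The bound 2^r < n is for the program, whose loops make n
    passes. *)
Lemma walk_length (a : nat) : (0 < a)%N ->
  exists n0 : nat, forall n t : nat, (n0 <= n)%N -> (t <= n)%N -> (n <= t.+1 ^ a)%N ->
  exists r : nat, [/\ (1 < t)%N, (2 ^ r < n)%N &
    forall F : realFieldType, let eps := (gap_denominator a)%:R^-1 : F in
      4 * t.-1%:R^-1 <= eps * (1 - 3 * eps) ^+ (2 ^ r) /\
      n%:R * (63 / 64) ^+ (2 ^ r) <= (1 - 3 * eps) ^+ (2 ^ r)].
Proof.
move=> a0; have N0 : (3072 <= gap_denominator a)%N by rewrite /gap_denominator; nia.
have NE : gap_denominator a = (6 * (512 * a))%N by rewrite /gap_denominator mulnA.
move: (gap_denominator a) N0 NE => N N0 NE.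
(* Through n <= (t + 1)^a this makes t + 1 at least 256 N^2 + 3, enough for the quadratic inequality
   behind [T2]. *)
exists ((256 * (N * N) + 3) ^ a)%N => n t Hn tn nt.
have Ht : (256 * (N * N) + 3 <= t.+1)%N.
  by have := leq_trans Hn nt; rewrite leq_exp2r.
have n13 : (2 ^ 13 <= n)%N.
  apply: leq_trans Hn; apply: (@leq_trans (256 * (N * N) + 3)).
    rewrite (_ : 2 ^ 13 = 256 * 32)%N; last by vm_compute.
    by apply: leq_trans (leq_addr _ _); rewrite leq_mul2l /=; nia.
  by rewrite -{1}[(_ + 3)%N]expn1 leq_exp2l // addn3.
have n0 : (0 < n)%N by apply: leq_trans n13; rewrite expn_gt0.
set L := (trunc_log 2 n).+1.
have nL : (n < 2 ^ L)%N by apply: trunc_log_ltn.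
have Ln : (2 ^ L <= 2 * n)%N by rewrite expnS leq_mul2l /= trunc_logP.
(* 128 is the power of two above the 127 of [decay_upper]; rounding L up to a power of two costs a
   factor of at most 2. *)
have [r Hr1 Hr2] : exists2 r, (128 * L <= 2 ^ r)%N & (2 ^ r <= 256 * L)%N.
  exists (7 + (trunc_log 2 L).+1)%N; rewrite expnD (_ : 2 ^ 7 = 128)%N //.
    by rewrite leq_mul2l /= ltnW // trunc_log_ltn.
  rewrite expnS (_ : 256 = 128 * 2)%N // -mulnA leq_mul2l /= leq_mul2l /=.
  exact: trunc_logP.
(* With this choice 2^(c - 1) is about n^(1 / (2 a)), so 2^c is at most of order sqrt t. *)
pose c := (L %/ (2 * a)).+1.
have Lc : (2 ^ r <= 512 * a * c)%N.
  apply: (leq_trans Hr2).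
  have La : (L < c * (2 * a))%N by apply: ltn_ceil; lia.
  by apply: (@leq_trans (256 * (c * (2 * a)))); [rewrite leq_mul2l ltnW|lia].
have T2 : (4 * N * 2 ^ c <= t.-1)%N.
  have A1 : (2 ^ c.-1 * 2 ^ c.-1 <= 2 * t.+1)%N.
    rewrite mulnn -(leq_exp2r _ _ a0) -!expnM.
    apply: (@leq_trans (2 ^ L)); first by rewrite leq_exp2l // /c /= leq_divM.
    rewrite (leq_trans Ln) // expnMn leq_mul //.
    by rewrite -{1}[2%N]expn1 leq_exp2l.
  rewrite /c expnS /= -/c.
  move: A1; rewrite /c /=; move: (2 ^ _)%N => x A1.
  rewrite -(leq_exp2r _ _ (isT : 0 < 2)%N) -!mulnn.
  clear -A1 Ht; case: t Ht A1 => [|y] /= Ht A1; first by lia.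
  have A2 := leq_mul (leqnn (64 * (N * N))) A1.
  move: A2 Ht; have -> : (4 * N * (2 * x) * (4 * N * (2 * x)) = 64 * (N * N) * (x * x))%N by ring.
  move: (N * N)%N (x * x)%N => P X A2 Ht; apply: (leq_trans A2).
  have A3 : (256 * P * (y + 2) <= y.-1 * (y + 2))%N by rewrite leq_mul2r; lia.
  have : (y.-1 * (y + 2) <= 2 * (y * y))%N by nia.
  lia.
have t1 : (1 < t)%N by clear -Ht; nia.
exists r; split => //.
  exact: leq_ltn_trans Hr2 (log_lt_linear n n13).
clear n13 Hn nt tn Ht n0 Ln.
move=> F eps.
have NF : 3072 <= N%:R :> F by rewrite (ler_nat _ 3072).
have NF0 : 0 < N%:R :> F by apply: lt_le_trans NF.
have eps0 : 0 < eps by rewrite invr_gt0.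
have eps1 : eps <= 3072^-1 by rewrite lef_pV2 // posrE.
have Ne : (512 * a)%:R * (6 * eps) = 1.
  by rewrite mulrA -natrM mulnC -NE divff // gt_eqF.
clear NE Hr2 N0.
split; last first.
  apply: (decay_upper _ _ _ L); first by clear -eps1; lra.
    exact: ltnW.
  by apply: leq_trans Hr1; rewrite leq_mul2r orbT.
have t0 : 0 < t.-1%:R :> F by rewrite ltr0n -ltnS prednK // ltnW.
have T3 : 4 * N%:R * 2 ^+ c <= t.-1%:R :> F by rewrite -natrX -!natrM ler_nat.
apply: (@le_trans _ _ (eps * (2 ^+ c)^-1)).
  rewrite ler_pdivrMr //; apply: (@le_trans _ _ (eps * (2 ^+ c)^-1 * (4 * N%:R * 2 ^+ c))).
    have p2 : 2 ^+ c != 0 :> F by rewrite expf_neq0 // pnatr_eq0.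
    have pN : N%:R != 0 :> F by rewrite gt_eqF.
    by rewrite le_eqVlt; apply/orP; left; apply/eqP; rewrite /eps; field; apply/andP.
  by rewrite ler_wpM2l // mulr_ge0 ?(ltW eps0) // invr_ge0 exprn_ge0.
rewrite ler_wpM2l ?(ltW eps0) //; apply: (decay_lower _ _ (512 * a)) => //.
- exact: ltW.
- by clear -eps1; lra.
by rewrite Ne.
Qed.

(** * The Sherali-Adams value *)

Section PointMass.
Context (F : realFieldType) (n t : nat) (x : gcut n).

Definition cut_restrict (S : {set 'I_n}) : assignment S := [ffun a => x (val a)].

Lemma value_at_cut (S : {set 'I_n}) k : k \in S ->
  value_at n S (cut_restrict S) k = x k.
Proof. by move=> kS; rewrite /value_at insubT ffunE SubK. Qed.

Lemma cut_restrictE (S T : {set 'I_n}) : T \subset S ->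
  restrict n S T (cut_restrict S) = cut_restrict T.
Proof.
move=> TS; apply/ffunP => a; rewrite !ffunE.
by rewrite value_at_cut //; apply: (fintype.subsetP TS); apply: valP.
Qed.

Definition point_mass (S : {set 'I_n}) (z : assignment S) : F := (z == cut_restrict S)%:R.

Lemma point_mass_ge0 (S : {set 'I_n}) : #|S| = t ->
  forall z : assignment S, 0 <= point_mass S z.
Proof. by []. Qed.

Lemma sum_delta (I : finType) (i0 : I) (f : I -> F) :
  \sum_i (i == i0)%:R * f i = f i0.
Proof.
rewrite (bigD1 i0) //= eqxx mul1r big1 ?addr0 // => i /negPf ->.
by rewrite mul0r.
Qed.

Lemma point_mass_sum (S : {set 'I_n}) : #|S| = t ->
  \sum_(z : assignment S) point_mass S z = 1.
Proof.
by move=> _; rewrite -(sum_delta _ (cut_restrict S) (fun=> 1)); apply: eq_bigr => z _; rewrite mulr1.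
Qed.

Lemma point_mass_marginal (S T : {set 'I_n}) (z : assignment T) : T \subset S ->
  marginal (point_mass S) z = point_mass T z.
Proof.
move=> TS; rewrite /marginal big_mkcond.
under eq_bigr do rewrite agree_restrict //.
rewrite /point_mass -(cut_restrictE S T TS).
rewrite -(sum_delta _ (cut_restrict S) (fun y => (z == restrict n S T y)%:R)).
apply: eq_bigr => y _; case: (z == _); by rewrite ?mulr1 ?mulr0.
Qed.

Lemma point_mass_consistent (T S1 S2 : {set 'I_n}) :
  (#|T| <= t)%N -> #|S1| = t -> #|S2| = t -> T \subset S1 -> T \subset S2 ->
  forall z : assignment T, marginal (point_mass S1) z = marginal (point_mass S2) z.
Proof. by move=> _ _ _ TS1 TS2 z; rewrite !point_mass_marginal. Qed.

(** A cut as a point of the polytope: it shows that the supremum in [SA] is over a nonempty set and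
    that [max_cut] lies below it. *)
Definition cut_pd : local_pseudodist F n t :=
  LocalPseudodist point_mass_ge0 point_mass_sum point_mass_consistent.

Lemma pr_neq_cut (i j : 'I_n) : (2 <= t)%N -> (t <= n)%N ->
  pr_neq cut_pd i j = (x i != x j)%:R.
Proof.
move=> t2 tn; have [S [St iS jS]] := pair_superset n t t2 tn i j.
rewrite (pr_neqE _ _ _ _ S) //= /point_mass sum_delta.
by rewrite !value_at_cut.
Qed.

Lemma pd_value_cut (G : wgraph F n) : (2 <= t)%N -> (t <= n)%N ->
  pd_value G cut_pd = cut_value G x.
Proof.
move=> t2 tn; apply: eq_bigr => i _; apply: eq_bigr => j _.
by rewrite pr_neq_cut.
Qed.

End PointMass.

Section SAValue.
Context (R : realType) (n t : nat) (G : wgraph R n).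
Hypothesis (t2 : (2 <= t)%N) (tn : (t <= n)%N).

Lemma SA_has_sup : has_sup (range (fun mu : local_pseudodist R n t => pd_value G mu)).
Proof.
split; first by exists (pd_value G (cut_pd R n t [ffun=> true])); eexists.
by exists 1 => _ [mu _ <-]; apply: pd_value_le1.
Qed.

Lemma cut_le_SA (x : gcut n) : cut_value G x <= SA t G.
Proof.
rewrite -(pd_value_cut R n t x G t2 tn); apply: ub_le_sup; first exact: (proj2 SA_has_sup).
by eexists.
Qed.

Lemma SA_le1 : SA t G <= 1.
Proof.
apply: ge_sup; first exact: (proj1 SA_has_sup).
by move=> _ [mu _ <-]; apply: pd_value_le1.
Qed.

(** Approximation of the supremum suffices, without compactness of the polytope, because rounding
    works from a threshold strictly below the assumed value. *)
Lemma SA_attained (eps : R) : 0 < eps ->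
  exists mu : local_pseudodist R n t, SA t G - eps < pd_value G mu.
Proof.
move=> e0; have [_ [mu _ <-] H] := sup_adherent e0 SA_has_sup.
by exists mu.
Qed.

Lemma max_cut_le_SA : max_cut G <= SA t G.
Proof.
apply: bigmax_le => [|x _]; last exact: cut_le_SA.
by have [x Hx] := exists_half_cut R n G; apply: le_trans (cut_le_SA x); lra.
Qed.

Lemma cut_le_max_cut (x : gcut n) : cut_value G x <= max_cut G.
Proof. exact: le_bigmax. Qed.

End SAValue.

(** The factor [c] is there because the program works with integer multiples of the weights; walk,
    candidates and good steps do not depend on the scale. *)
Lemma pd_good_candidate (F : realFieldType) (n t r N : nat) (G : wgraph F n)
    (mu : local_pseudodist F n t) (c : F) (w : 'I_n -> 'I_n -> F) :
  0 < c -> (forall i j, w i j = c * G i j) ->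
  (1 < t)%N -> (t <= n)%N -> (4 <= N)%N ->
  (let eps := N%:R^-1 : F in
      4 * t.-1%:R^-1 <= eps * (1 - 3 * eps) ^+ (2 ^ r) /\
      n%:R * (63 / 64) ^+ (2 ^ r) <= (1 - 3 * eps) ^+ (2 ^ r)) ->
  1 - N%:R^-1 <= pd_value G mu ->
  forall u : 'I_n -> F, (forall i, (u i == 0) || (u i == 1)) ->
     weight_total F n w <= 2 * volume F n (restricted F n w u) ->
     exists l j k, [/\ (j <= 2 ^ r)%N,
       good_step F n w 1 u (candidate F n w u l j k)
       & exists i, candidate F n w u l j k i != 0].
Proof.
move=> c0 wE t1 tn N4 [H1 H2] Hv u u01 Hu.
have NF : 4 <= N%:R :> F by rewrite (ler_nat _ 4).
have N0 : 0 < N%:R :> F by lra.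
have e1 : N%:R^-1 <= 4^-1 :> F by rewrite lef_pV2 // posrE.
have w0 i j : 0 <= w i j by rewrite wE mulr_ge0 ?weight_ge0 ?ltW.
have ws i j : w i j = w j i by rewrite !wE weight_sym.
have wt : weight_total F n w = c * weight_total F n G.
  rewrite mulr_sumr; apply: eq_bigr => i _; rewrite mulr_sumr.
  by apply: eq_bigr => j _; rewrite wE.
apply: (good_candidate F n w w0 ws t r t mu N%:R^-1) => //.
- by rewrite invr_gt0.
- lra.
- rewrite wt mulrCA.
  have -> : \sum_i \sum_j w i j * (1 - pr_neq mu i j) = c * \sum_i \sum_j G i j * (1 - pr_neq mu i j).
    rewrite mulr_sumr; apply: eq_bigr => i _; rewrite mulr_sumr.
    by apply: eq_bigr => j _; rewrite wE mulrA.
  by rewrite ler_pM2l //; apply: pd_value_slack.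
by rewrite wt total_weight mulr_gt0.
Qed.

Lemma pd_exists_cut (F : realFieldType) (n t r N : nat) (G : wgraph F n)
    (mu : local_pseudodist F n t) :
  (1 < t)%N -> (t <= n)%N -> (4 <= N)%N ->
  (let eps := N%:R^-1 : F in
      4 * t.-1%:R^-1 <= eps * (1 - 3 * eps) ^+ (2 ^ r) /\
      n%:R * (63 / 64) ^+ (2 ^ r) <= (1 - 3 * eps) ^+ (2 ^ r)) ->
  1 - N%:R^-1 <= pd_value G mu ->
  exists x : gcut n, 9 / 16 <= cut_value G x.
Proof.
move=> t1 tn N4 Hr Hv.
have [||x] := exists_balanced F n G (weight_ge0 G) (weight_sym G) (weight_loopless G).
- move=> u u01 Hu; have [l [j [k [_ H1 H2]]]] := pd_good_candidate _ _ _ _ _ G mu 1 G ltr01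
    (fun i j => esym (mul1r _)) t1 tn N4 Hr Hv u u01 Hu.
  by exists l, j, k.
- by rewrite total_weight.
by rewrite total_weight => Hx; exists x; rewrite cut_value_balance; lra.
Qed.

Lemma sa_degree_le (R : realType) (n : nat) (alpha : R) : (sa_degree n alpha <= n)%N.
Proof. exact: geq_minl. Qed.

(** The successor makes up for the truncation of n^alpha; when the cap n is active the bound is
    immediate. *)
Lemma sa_degree_large (R : realType) (n a : nat) (alpha : R) :
  (0 < n)%N -> 0 < alpha -> (0 < a)%N -> 1 <= alpha * a%:R ->
  (n <= (sa_degree n alpha).+1 ^ a)%N.
Proof.
move=> n0 al0 a0 Ha; rewrite /sa_degree /minn; case: ltnP => _.
  by apply: (@leq_trans (n ^ a)); [rewrite -{1}[n]expn1 leq_pexp2l|rewrite leq_exp2r].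
have n1 : 1 <= n%:R :> R by rewrite ler1n.
have p0 : 0 <= n%:R `^ alpha by apply: powR_ge0.
rewrite -(ler_nat R) natrX; apply: (@le_trans _ _ ((n%:R `^ alpha) ^+ a)).
  by rewrite -powR_mulrn // -powRrM -{1}[n%:R]powRr1 ?ler_powR.
rewrite lerXn2r ?nnegrE //.
by have /andP[_ /ltW] := truncn_itv p0; rewrite -natr1.
Qed.

Local Close Scope ring_scope.

(** * Loop programs *)

Lemma blen_leP k b : 0 < b -> (blen k <= b) = (k < 2 ^ b).
Proof.
case: b => // b _; rewrite /blen ltnS; have [->|k0] := posnP k.
  by rewrite trunc_log0 expn_gt0.
apply/idP/idP => H.
  by apply: leq_trans (trunc_log_ltn k (isT : 1 < 2)) _; rewrite leq_exp2l.
have := leq_ltn_trans (trunc_logP (isT : 1 < 2) k0) H.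
by rewrite ltn_exp2l // ltnS.
Qed.

Lemma lt_blen k : k < 2 ^ blen k.
Proof. by rewrite -blen_leP. Qed.

Lemma leq_blen k l : k <= l -> blen k <= blen l.
Proof. by move=> kl; rewrite blen_leP // (leq_ltn_trans kl) // lt_blen. Qed.

Lemma blen_binop o x y : blen (binop_eval o x y) <= blen x + blen y.
Proof.
case: o => /=.
- rewrite blen_leP ?addn_gt0 //.
  apply: (@leq_trans (2 ^ blen x + 2 ^ blen y)).
    by rewrite -addnS; apply: leq_add; [apply: ltnW|]; apply: lt_blen.
  rewrite expnD.
  have : 2 <= 2 ^ blen x by rewrite -{1}[2]expn1 leq_exp2l.
  have : 2 <= 2 ^ blen y by rewrite -{1}[2]expn1 leq_exp2l.
  move: (2 ^ blen y) (2 ^ blen x) => [|[|X]] [|[|Y]] // _ _; clear; nia.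
- by apply: leq_trans (leq_blen _ _ (leq_subr _ _)) (leq_addr _ _).
- rewrite blen_leP ?addn_gt0 // expnD.
  have [->|y0] := posnP y; first by rewrite muln0 muln_gt0 !expn_gt0.
  apply: (@leq_ltn_trans (2 ^ blen x * y)); first by rewrite leq_mul2r ltnW ?orbT // lt_blen.
  by rewrite ltn_mul2l expn_gt0 lt_blen.
- by apply: leq_trans (leq_blen _ _ (leq_div _ _)) (leq_addr _ _).
Qed.

(* A language of assignments and loops in which every loop makes n passes.
   Array number a occupies the cells a * n, ..., a * n + n - 1; a scalar is
   cell 0 of an array of its own. *)
Inductive cmd :=
  | Asg of nat & expr & expr
  | Sq of cmd & cmd
  | For of nat & cmd.

Definition Nx : expr := Input (Const 0).
Definition addr (a : nat) (i : expr) : expr := Bin OpAdd (Bin OpMul (Const a) Nx) i.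
Definition Arr (a : nat) (i : expr) : expr := Defs.Mem (addr a i).
Definition Var (a : nat) : expr := Arr a (Const 0).

Fixpoint compile (c : cmd) : prog :=
  match c with
  | Asg a i e => Store (addr a i) e
  | Sq c d => Seq (compile c) (compile d)
  | For v c =>
      Seq (Store (addr v (Const 0)) (Const 0))
        (While (Bin OpSub Nx (Var v))
           (Seq (compile c)
                (Store (addr v (Const 0)) (Bin OpAdd (Var v) (Const 1)))))
  end.

Fixpoint mods (c : cmd) : seq nat :=
  match c with
  | Asg a _ _ => [:: a]
  | Sq c d => mods c ++ mods d
  | For v c => v :: mods c
  end.

Fixpoint wf (c : cmd) : bool :=
  match c with
  | Asg _ _ _ => true
  | Sq c d => wf c && wf d
  | For v c => (v \notin mods c) && wf c
  end.

(** Lengths in units of beta: if cells and inputs have at most beta bits, [e] evaluates to at most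
    [bits e * beta] bits. A read from memory brings the count back to 1, so lengths do not build up
    along a run. *)
Fixpoint bits (e : expr) : nat :=
  match e with
  | Const k => blen k
  | Input _ | Defs.Mem _ => 1
  | Bin _ a b => bits a + bits b
  end.

Fixpoint ecost (e : expr) : nat :=
  match e with
  | Const k => blen k
  | Input a | Defs.Mem a => ecost a + bits a + 1
  | Bin _ a b => ecost a + ecost b + bits a + bits b + (bits a + bits b)
  end.

Definition store_cost (a : nat) (i e : expr) : nat :=
  1 + ecost (addr a i) + ecost e + bits (addr a i) + bits e.

Fixpoint ccost (n : nat) (c : cmd) : nat :=
  match c with
  | Asg a i e => store_cost a i e
  | Sq c d => 1 + ccost n c + ccost n d
  | For v c =>
      1 + store_cost v (Const 0) (Const 0)
      + (n * (1 + ecost (Bin OpSub Nx (Var v))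
              + (1 + ccost n c + store_cost v (Const 0) (Bin OpAdd (Var v) (Const 1))))
         + (1 + ecost (Bin OpSub Nx (Var v))))
  end.

Lemma ccost_poly (c : cmd) : exists K d, forall n, ccost n c <= K * n.+1 ^ d.
Proof.
elim: c => [a i e|c [K1 [d1 H1]] d [K2 [d2 H2]]|v c [K [d H]]].
- by exists (store_cost a i e), 0 => n; rewrite expn0 muln1.
- exists (1 + K1 + K2), (d1 + d2) => n /=.
  have P d0 : 0 < n.+1 ^ d0 by rewrite expn_gt0.
  have Q1 : n.+1 ^ d1 <= n.+1 ^ (d1 + d2) by rewrite leq_pexp2l // leq_addr.
  have Q2 : n.+1 ^ d2 <= n.+1 ^ (d1 + d2) by rewrite leq_pexp2l // leq_addl.
  rewrite !mulnDl mul1n !leq_add // ?(leq_trans (H1 n)) ?(leq_trans (H2 n)) //;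
    by rewrite leq_mul2l ?Q1 ?Q2 orbT.
set A := 1 + store_cost v (Const 0) (Const 0) + (1 + ecost (Bin OpSub Nx (Var v)))
  + (1 + ecost (Bin OpSub Nx (Var v)) + (1 + store_cost v (Const 0) (Bin OpAdd (Var v) (Const 1)))).
exists (A + K), d.+1 => n.
apply: (@leq_trans (n.+1 * (A + ccost n c))); first by rewrite /A /=; lia.
have P : 0 < n.+1 ^ d by rewrite expn_gt0.
rewrite expnS mulnCA leq_mul2l /= mulnDl leq_add ?H // leq_pmulr //.
Qed.

(** * Semantics, safety and cost of loop programs *)

Section Semantics.
Variables (s : seq nat) (beta : nat).
Local Notation n := (nth 0 s 0).

Definition get (m : memory) (a i : nat) : nat := m (a * n + i).
Definition put (m : memory) (a i x : nat) : memory := upd m (a * n + i) x.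

Fixpoint run (c : cmd) (m : memory) : memory :=
  match c with
  | Asg a i e => put m a (eval s m i) (eval s m e)
  | Sq c d => run d (run c m)
  | For v c => iteri n (fun k m => put (run c m) v 0 k.+1) (put m v 0 0)
  end.

Definition loop (c : cmd) (v k : nat) (m : memory) : memory :=
  iteri k (fun k m => put (run c m) v 0 k.+1) (put m v 0 0).

(** Indices in range keep the arrays disjoint; bounded stored values keep the cost of every
    operation within a constant times beta. *)
Fixpoint safe (c : cmd) (m : memory) : Prop :=
  match c with
  | Asg a i e => eval s m i < n /\ blen (eval s m e) <= beta
  | Sq c d => safe c m /\ safe d (run c m)
  | For v c => forall k, k < n -> safe c (loop c v k m)
  end.

Definition wp (c : cmd) (m : memory) (Q : memory -> Prop) : Prop :=
  safe c m /\ Q (run c m).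

Hypothesis n_gt0 : 0 < n.

Lemma get_put m a i x b j : i < n -> j < n ->
  get (put m a i x) b j = if (b == a) && (j == i) then x else get m b j.
Proof.
move=> Hi Hj; rewrite /get /put /upd.
suff -> : (b * n + j == a * n + i) = (b == a) && (j == i) by [].
apply/eqP/andP => [E|[/eqP-> /eqP->]//].
have Eb : b = a.
  by have := congr1 (divn^~ n) E; rewrite /= !divnMDl // !divn_small // !addn0.
by split; apply/eqP => //; move: E; rewrite Eb => /addnI.
Qed.

Lemma get_put_same m a i x : get (put m a i x) a i = x.
Proof. by rewrite /get /put /upd eqxx. Qed.

Definition eqoff (l : seq nat) (m m' : memory) : Prop :=
  forall b j, b \notin l -> j < n -> get m' b j = get m b j.

Lemma eqoff_trans l m1 m2 m3 : eqoff l m1 m2 -> eqoff l m2 m3 -> eqoff l m1 m3.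
Proof. by move=> H1 H2 b j bl jn; rewrite H2 // H1. Qed.

Lemma eqoff_put l m a i x : a \in l -> i < n -> eqoff l m (put m a i x).
Proof.
move=> al Hi b j bl jn; rewrite get_put //.
by case: eqP bl => [->|//]; rewrite al.
Qed.

Lemma eqoff_sub l l' m m' : {subset l <= l'} -> eqoff l m m' -> eqoff l' m m'.
Proof. by move=> sub H b j bl jn; apply: H => //; apply: contra bl; apply: sub. Qed.

Lemma loop_eqoff c v m k :
  (forall m, safe c m -> eqoff (mods c) m (run c m)) ->
  (forall j, j < k -> safe c (loop c v j m)) -> eqoff (v :: mods c) m (loop c v k m).
Proof.
move=> IH; elim: k => [|k IHk] H; first by apply: eqoff_put; rewrite ?mem_head.
have {}IHk := IHk (fun j jk => H j (ltnW jk)).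
apply: eqoff_trans IHk _; apply: (@eqoff_trans _ _ (run c (loop c v k m))).
  by apply: eqoff_sub (IH _ (H k (leqnn _))) => b bc; rewrite inE bc orbT.
by apply: eqoff_put; rewrite ?mem_head.
Qed.

Lemma run_eqoff c m : safe c m -> eqoff (mods c) m (run c m).
Proof.
elim: c m => [a i e|c IHc d IHd|v c IHc] m /=.
- by case=> Hi _; apply: eqoff_put; rewrite ?mem_head.
- case=> /IHc H1 /IHd H2; apply: (@eqoff_trans _ _ (run c m)).
    by apply: eqoff_sub H1 => b bc; rewrite mem_cat bc.
  by apply: eqoff_sub H2 => b bc; rewrite mem_cat bc orbT.
move=> H; exact: (loop_eqoff c v m n IHc H).
Qed.

Lemma wp_asg a i e m (Q : memory -> Prop) :
  eval s m i < n -> blen (eval s m e) <= beta ->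
  Q (put m a (eval s m i) (eval s m e)) -> wp (Asg a i e) m Q.
Proof. by []. Qed.

Lemma wp_seq c d m (Q : memory -> Prop) :
  wp c m (fun m1 => wp d m1 Q) -> wp (Sq c d) m Q.
Proof. by case=> [H1 [H2 H3]]. Qed.

(** The frame and the value of the counter are supplied by the rule itself, so an invariant has to
    mention only what the body changes. *)
Lemma wp_for v c m (Inv : nat -> memory -> Prop) (Q : memory -> Prop) :
  v \notin mods c ->
  Inv 0 (put m v 0 0) ->
  (forall k m', k < n -> eqoff (v :: mods c) m m' -> get m' v 0 = k -> Inv k m' ->
     wp c m' (fun m1 => get m1 v 0 = k -> Inv k.+1 (put m1 v 0 k.+1))) ->
  (forall m', eqoff (v :: mods c) m m' -> Inv n m' -> Q m') ->
  wp (For v c) m Q.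
Proof.
move=> vc H0 HS HQ.
have H k : k <= n -> [/\ (forall j, j < k -> safe c (loop c v j m)),
    get (loop c v k m) v 0 = k & Inv k (loop c v k m)].
  elim: k => [|k IH] kn; first by split=> //; rewrite get_put_same.
  have [I1 I2 I3] := IH (ltnW kn).
  have E := loop_eqoff c v m k (run_eqoff c) I1.
  have [S1 S2] := HS k _ kn E I2 I3.
  split; last 1 first.
  - by apply: S2; rewrite (run_eqoff _ _ S1).
  - by move=> j; rewrite ltnS leq_eqVlt => /predU1P[->|/I1].
  by rewrite /= get_put_same.
have [I1 I2 I3] := H n (leqnn _).
by split=> //; apply: HQ => //; apply: loop_eqoff => //; apply: run_eqoff.
Qed.

Hypothesis input_bound : forall i, blen (nth 0 s i) <= beta.

Definition bounded (m : memory) : Prop := forall x, blen (m x) <= beta.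

Lemma beta_gt0 : 0 < beta.
Proof. exact: leq_trans (input_bound 0). Qed.

Lemma eval_bits m e : bounded m -> blen (eval s m e) <= bits e * beta.
Proof.
move=> bm; elim: e => [k|a _|a _|o a IHa b IHb] /=; rewrite ?mul1n //.
  by rewrite leq_pmulr // beta_gt0.
by rewrite mulnDl (leq_trans (blen_binop _ _ _)) // leq_add.
Qed.

Lemma eval_cost_le m e : bounded m -> eval_cost s m e <= ecost e * beta.
Proof.
move=> bm; elim: e => [k|a IHa|a IHa|o a IHa b IHb] /=.
- by rewrite leq_pmulr // beta_gt0.
- by rewrite !mulnDl mul1n !leq_add // eval_bits.
- by rewrite !mulnDl mul1n !leq_add // eval_bits.
have := eval_bits m a bm; have := eval_bits m b bm.
have := blen_binop o (eval s m a) (eval s m b); rewrite !mulnDl; lia.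
Qed.

Lemma store_cost_le m a i e : bounded m ->
  1 + eval_cost s m (addr a i) + eval_cost s m e
    + blen (eval s m (addr a i)) + blen (eval s m e) <= store_cost a i e * beta.
Proof.
move=> bm; rewrite /store_cost.
have := eval_cost_le m (addr a i) bm; have := eval_cost_le m e bm.
have := eval_bits m (addr a i) bm; have := eval_bits m e bm; have := beta_gt0.
move: (ecost (addr a i)) (ecost e) (bits (addr a i)) (bits e) => x y z t.
move: (eval_cost _ _ _) (eval_cost _ _ _) (blen _) (blen _) => x' y' z' t'.
by rewrite !mulnDl mul1n; lia.
Qed.

Lemma bounded_put m a i x : bounded m -> blen x <= beta -> bounded (put m a i x).
Proof. by move=> bm bx y; rewrite /put /upd; case: eqP. Qed.

Lemma exec_cast m p c m1 m2 : m1 = m2 -> exec s m p c m1 -> exec s m p c m2.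
Proof. by move=> ->. Qed.

Lemma compile_exec c m : wf c -> safe c m -> bounded m ->
  bounded (run c m) /\
  exists k, exec s m (compile c) k (run c m) /\ k <= ccost n c * beta.
Proof.
elim: c m => [a i e|c IHc d IHd|v c IHc] m.
- move=> _ [Hi He] bm; split; first exact: bounded_put.
  by eexists; split; [exact: ExecStore|exact: store_cost_le].
- move=> /= /andP[wc wd] [Sc Sd] bm.
  have [b1 [k1 [E1 K1]]] := IHc m wc Sc bm.
  have [b2 [k2 [E2 K2]]] := IHd _ wd Sd b1.
  split=> //; exists (1 + k1 + k2); split; first exact: ExecSeq E1 E2.
  by rewrite !mulnDl mul1n !leq_add ?beta_gt0.
move=> /andP[vc wc] Sc bm.
have bn k : k <= n -> blen k <= beta.
  by move=> kn; apply: leq_trans (leq_blen _ _ kn) (input_bound 0).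
have bl k : k <= n -> bounded (loop c v k m).
  elim: k => [|k IH] kn; first by apply: bounded_put => //; apply: beta_gt0.
  apply: bounded_put; last exact: bn.
  exact: (proj1 (IHc _ wc (Sc k kn) (IH (ltnW kn)))).
have lv k : k <= n -> get (loop c v k m) v 0 = k.
  by case: k => [|k] kn; rewrite /= get_put_same.
split; first exact: bl.
set G := Bin OpSub Nx (Var v).
set body := Seq (compile c) (Store (addr v (Const 0)) (Bin OpAdd (Var v) (Const 1))).
have eG k : k <= n -> eval s (loop c v k m) G = n - k.
  by move=> kn; rewrite /= -/(get _ v 0) lv.
set B := 1 + ecost G + (1 + ccost n c + store_cost v (Const 0) (Bin OpAdd (Var v) (Const 1))).
(* Induction on the passes still to be made: the machine unfolds a loop from its first pass, [loop]
   from its last. *)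
have W d k : k + d = n ->
    exists q, exec s (loop c v k m) (While G body) q (loop c v n m) /\
      q <= (d * B + (1 + ecost G)) * beta.
  elim: d k => [|d IH] k kd.
    have kn : k = n by rewrite -kd addn0.
    exists (1 + eval_cost s (loop c v k m) G); split.
      have -> : loop c v n m = loop c v k m by rewrite kn.
      by apply: ExecWhileFalse; rewrite eG kn ?subnn.
    rewrite mul0n add0n [X in _ <= X]mulnDl mul1n; apply: leq_add; first exact: beta_gt0.
    by apply: eval_cost_le; apply: bl; rewrite kn.
  have kn : k < n by rewrite -kd addnS ltnS leq_addr.
  have [q [Eq Hq]] := IH k.+1 (etrans (addSnnS _ _) kd).
  have [b1 [k1 [E1 K1]]] := IHc _ wc (Sc k kn) (bl k (ltnW kn)).
  set m1 := run c (loop c v k m) in b1 E1.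
  have m1v : get m1 v 0 = k.
    by rewrite (run_eqoff _ _ (Sc k kn)) // lv // ltnW.
  have E2 : exec s (loop c v k m) body
     (1 + k1 + (1 + eval_cost s m1 (addr v (Const 0)) + eval_cost s m1 (Bin OpAdd (Var v) (Const 1))
        + blen (eval s m1 (addr v (Const 0))) + blen (eval s m1 (Bin OpAdd (Var v) (Const 1)))))
     (loop c v k.+1 m).
    apply: ExecSeq E1 _; apply: exec_cast (ExecStore _ _ _ _).
    by rewrite /= /put -/(get m1 v 0) m1v addn1.
  eexists; split; first by apply: ExecWhileTrue E2 Eq; rewrite eG ?subn_eq0 -?ltnNge // ltnW.
  have C1 := eval_cost_le _ G (bl k (ltnW kn)).
  have C2 := store_cost_le _ v (Const 0) (Bin OpAdd (Var v) (Const 1)) b1.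
  have C0 := beta_gt0.
  rewrite mulSn -[in X in _ <= X]addnA [X in _ <= X]mulnDl; apply: leq_add Hq.
  rewrite /B; move: C0 C1 C2 K1.
  move: (store_cost _ _ _) (ecost G) (ccost n c) => x y z.
  rewrite !mulnDl !mul1n.
  move: (eval_cost s (loop c v k m) G) (x * beta) (y * beta) (z * beta) => x' ? ? ?.
  lia.
have [q [Eq Hq]] := W n 0 (add0n _).
have E0 := ExecStore s m (addr v (Const 0)) (Const 0).
eexists; split; first exact: ExecSeq E0 Eq.
have -> : ccost n (For v c) = 1 + store_cost v (Const 0) (Const 0) + (n * B + (1 + ecost G)) by [].
rewrite [X in _ <= X]mulnDl; apply: leq_add Hq.
rewrite mulnDl mul1n; apply: leq_add; first exact: beta_gt0.
exact: store_cost_le.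
Qed.

End Semantics.

Section Loops.
Variables (s : seq nat) (beta : nat).
Local Notation n := (nth 0 s 0).
Hypothesis n_gt0 : 0 < n.
Hypothesis beta_gt0 : 0 < beta.

Lemma eval_Arr m a i : eval s m (Arr a i) = get s m a (eval s m i).
Proof. by []. Qed.
Lemma eval_Var m a : eval s m (Var a) = get s m a 0.
Proof. by []. Qed.
Lemma eval_Nx m : eval s m Nx = n.
Proof. by []. Qed.
Lemma eval_Const m k : eval s m (Const k) = k.
Proof. by []. Qed.
Lemma eval_Input m e : eval s m (Input e) = nth 0 s (eval s m e).
Proof. by []. Qed.
Lemma eval_Bin m o a b : eval s m (Bin o a b) = binop_eval o (eval s m a) (eval s m b).
Proof. by []. Qed.
Definition evalE := (eval_Var, eval_Arr, eval_Nx, eval_Const, eval_Input, eval_Bin).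

Lemma wp_fold v a ix e m (c : nat) (val : nat -> nat) (Q : memory -> Prop) :
  v != a -> c < n ->
  (forall m', eqoff s [:: v; a] m m' -> eval s m' ix = c) ->
  get s m a c = val 0 ->
  (forall k, k < n -> blen (val k.+1) <= beta) ->
  (forall k m', k < n -> eqoff s [:: v; a] m m' -> get s m' v 0 = k ->
     get s m' a c = val k -> eval s m' e = val k.+1) ->
  (forall m', eqoff s [:: v; a] m m' -> get s m' a c = val n ->
     (forall j, j < n -> j != c -> get s m' a j = get s m a j) -> Q m') ->
  wp s beta (For v (Asg a ix e)) m Q.
Proof.
move=> va cn Hix H0 Hb He HQ.
apply: (wp_for _ _ n_gt0 _ _ _ (fun k m' => get s m' a c = val k /\
  forall j, j < n -> j != c -> get s m' a j = get s m a j)).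
- by rewrite inE.
- have na : (a == v) = false by rewrite eq_sym (negPf va).
  by split=> [|j jn jc]; rewrite get_put // na.
- move=> k m' kn E vk [I1 I2]; apply: wp_asg.
  + by rewrite Hix.
  + by rewrite (He k) ?Hb.
  rewrite Hix // (He k) // => _.
  have na : (a == v) = false by rewrite eq_sym (negPf va).
  split=> [|j jn jc]; rewrite get_put // na /= get_put // eqxx ?eqxx //=.
  by rewrite (negPf jc) I2.
by move=> m' E [I1 I2]; apply: HQ.
Qed.

(** Pass i writes cell i only, so [e] may read the old value of that cell: this covers updates in
    place. *)
Lemma wp_map v a e m (f : nat -> nat) (Q : memory -> Prop) :
  v != a ->
  (forall i, i < n -> blen (f i) <= beta) ->
  (forall i m', i < n -> eqoff s [:: v; a] m m' -> get s m' v 0 = i ->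
     get s m' a i = get s m a i -> eval s m' e = f i) ->
  (forall m', eqoff s [:: v; a] m m' -> (forall i, i < n -> get s m' a i = f i) -> Q m') ->
  wp s beta (For v (Asg a (Var v) e)) m Q.
Proof.
move=> va Hb He HQ.
have na : (a == v) = false by rewrite eq_sym (negPf va).
apply: (wp_for _ _ n_gt0 _ _ _ (fun k m' => forall j, j < n ->
   get s m' a j = if j < k then f j else get s m a j)).
- by rewrite inE.
- by move=> j jn; rewrite get_put // na.
- move=> k m' kn E vk I; apply: wp_asg; rewrite ?eval_Var ?vk //.
    by rewrite (He k) ?Hb // I // ltnn.
  move=> _ j jn; rewrite get_put // na /= get_put // eqxx /= ltnS leq_eqVlt.
  by case: eqP => [->|_] /=; [rewrite (He k) // I // ltnn|exact: I].
by move=> m' E I; apply: HQ => // i Hi; rewrite I // Hi.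
Qed.

(** One accumulator runs through the pairs in lexicographic order; [val i n = val i.+1 0] joins
    consecutive rows. *)
Lemma wp_dfold v1 v2 a e m (val : nat -> nat -> nat) (Q : memory -> Prop) :
  uniq [:: v1; v2; a] ->
  get s m a 0 = val 0 0 ->
  (forall i h, i < n -> h < n -> blen (val i h.+1) <= beta) ->
  (forall i, i < n -> val i n = val i.+1 0) ->
  (forall i h m', i < n -> h < n -> eqoff s [:: v1; v2; a] m m' ->
     get s m' v1 0 = i -> get s m' v2 0 = h ->
     get s m' a 0 = val i h -> eval s m' e = val i h.+1) ->
  (forall m', eqoff s [:: v1; v2; a] m m' -> get s m' a 0 = val n 0 -> Q m') ->
  wp s beta (For v1 (For v2 (Asg a (Const 0) e))) m Q.
Proof.
rewrite /= !inE negb_or !andbT => /andP[/andP[v12 v1a] v2a] H0 Hb Hv He HQ.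
apply: (wp_for _ _ n_gt0 _ _ _ (fun k m' => get s m' a 0 = val k 0)).
- by rewrite !inE negb_or v12.
- by rewrite get_put // eq_sym (negPf v1a).
- move=> i m' Hi E vi I; apply: (wp_fold _ _ _ _ _ 0 (val i)) => //.
  + by move=> k; apply: Hb.
  + move=> h m2 hn E2 vh I2; apply: (He i h) => //.
      apply: (eqoff_trans _ _ _ m') E _.
      by apply: eqoff_sub E2 => b; rewrite !inE => ->; rewrite orbT.
    by rewrite (E2 v1 0) // !inE negb_or v12.
  move=> m2 E2 I2 _ _; rewrite get_put // eq_sym (negPf v1a) /= I2; exact: Hv.
by move=> m' E I; apply: HQ.
Qed.

End Loops.

(** * The rounding program *)

Local Notation "a [+] b" := (Bin OpAdd a b) (at level 50, left associativity).
Local Notation "a [-] b" := (Bin OpSub a b) (at level 50, left associativity).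
Local Notation "a [*] b" := (Bin OpMul a b) (at level 40, left associativity).
Local Notation "a [/] b" := (Bin OpDiv a b) (at level 40, left associativity).

(* The memory holds natural numbers only: the partial cut is arr_pos - arr_neg,
   the current walk vector is arr_p - arr_q up to a positive factor, and the
   candidate is arr_zp - arr_zm. The output is read from array 0. *)
Definition arr_pos := 0.
Definition arr_neg := 1.
Definition arr_p := 2.
Definition arr_q := 3.
Definition arr_zp := 4.
Definition arr_zm := 5.
Definition arr_d := 6.
Definition arr_dp := 7.
Definition arr_dq := 8.
Definition var_D := 9.
Definition var_r := 10.
Definition var_l := 11.
Definition var_j := 12.
Definition var_k := 13.
Definition var_i := 14.
Definition var_h := 15.
Definition var_gain := 16.
Definition var_loss := 17.
Definition var_c1 := 18.
Definition var_c2 := 19.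
Definition var_f := 20.
Definition var_g := 21.
Definition var_P := 22.

Definition vi := Var var_i.
Definition vh := Var var_h.

Definition numE (i h : expr) := Input (Const 3 [+] Const 2 [*] (Nx [*] i [+] h)).
Definition denE (i h : expr) := Input (Const 4 [+] Const 2 [*] (Nx [*] i [+] h)).
(* The weights are scaled by a common multiple D of their denominators. *)
Definition weightE (i h : expr) := numE i h [*] (Var var_D [/] denE i h).
Definition freeE (i : expr) := Const 1 [-] Arr arr_pos i [-] Arr arr_neg i.
Definition absE (i : expr) :=
  (Arr arr_p i [-] Arr arr_q i) [+] (Arr arr_q i [-] Arr arr_p i).
(* Comparisons are encoded by truncated subtraction. *)
Definition posE (e : expr) := Const 1 [-] (Const 1 [-] e).
Definition leE (a b : expr) := Const 1 [-] (a [-] b).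

Definition double_sum (a : nat) (e : expr) : cmd :=
  Sq (Asg a (Const 0) (Const 0))
     (For var_i (For var_h (Asg a (Const 0) (Var a [+] e)))).

Definition candidate_cmd : cmd :=
  Sq (For var_i (Asg arr_zp vi
        (freeE vi [*] leE (absE (Var var_k)) (absE vi) [*] posE (Arr arr_p vi [-] Arr arr_q vi))))
     (For var_i (Asg arr_zm vi
        (freeE vi [*] leE (absE (Var var_k)) (absE vi) [*] posE (Arr arr_q vi [-] Arr arr_p vi)))).

(** Each signed quantity becomes two natural sums to be compared: gain against loss decides
    [good_step], and c1 against c2 (cross weight cut when the candidate is kept or flipped) decides
    the sign. *)
Definition tally_cmd (theta : nat) : cmd :=
  Sq (double_sum var_gain (weightE vi vh [*] (Const 2 [*]
        (Arr arr_zp vi [*] Arr arr_zm vh [+] Arr arr_zm vi [*] Arr arr_zp vh))))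
 (Sq (double_sum var_loss (weightE vi vh [*] (Const 2 [*]
        (Arr arr_zp vi [*] Arr arr_zp vh [+] Arr arr_zm vi [*] Arr arr_zm vh)
        [+] Const theta [*] freeE vh [*] (Arr arr_zp vi [+] Arr arr_zm vi))))
 (Sq (double_sum var_c1 (weightE vi vh [*]
        (Arr arr_zp vi [*] Arr arr_neg vh [+] Arr arr_zm vi [*] Arr arr_pos vh)))
     (double_sum var_c2 (weightE vi vh [*]
        (Arr arr_zp vi [*] Arr arr_pos vh [+] Arr arr_zm vi [*] Arr arr_neg vh))))).

Definition blend (a b : nat) : expr :=
  Var var_f [*] (Var var_g [*] Arr a vi [+] (Const 1 [-] Var var_g) [*] Arr b vi).

Definition commit_cmd : cmd :=
  Sq (Asg var_f (Const 0) (leE (Var var_loss) (Var var_gain)))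
 (Sq (Asg var_g (Const 0) (leE (Var var_c2) (Var var_c1)))
 (Sq (For var_i (Asg arr_pos vi (Arr arr_pos vi [+] blend arr_zp arr_zm)))
     (For var_i (Asg arr_neg vi (Arr arr_neg vi [+] blend arr_zm arr_zp))))).

Definition trial_cmd (theta : nat) : cmd :=
  Sq candidate_cmd (Sq (tally_cmd theta) commit_cmd).

Definition row_sum (a : nat) (e : expr) : cmd :=
  Sq (Asg a vi (Const 0)) (For var_h (Asg a vi (Arr a vi [+] e))).

Definition innerE := weightE vi vh [*] (freeE vi [*] freeE vh).

(* One step of the walk, multiplied by 2 P with P a common multiple of the
   degrees, so that all divisions by positive degrees are exact; vertices of
   degree 0 rely on x / 0 = 0. *)
Definition walk_cmd : cmd :=
  Sq (For var_i (row_sum arr_d innerE))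
 (Sq (For var_i (row_sum arr_dp (innerE [*] Arr arr_q vh)))
 (Sq (For var_i (row_sum arr_dq (innerE [*] Arr arr_p vh)))
 (Sq (Asg var_P (Const 0) (Const 1))
 (Sq (For var_i (Asg var_P (Const 0)
        (Var var_P [*] (Arr arr_d vi [+] (Const 1 [-] Arr arr_d vi)))))
 (Sq (For var_i (Asg arr_p vi
        (Var var_P [*] Arr arr_p vi [+] Var var_P [*] Arr arr_dp vi [/] Arr arr_d vi)))
     (For var_i (Asg arr_q vi
        (Var var_P [*] Arr arr_q vi [+] Var var_P [*] Arr arr_dq vi [/] Arr arr_d vi)))))))).

Definition start_cmd : cmd :=
  Sq (For var_i (Asg arr_p vi (leE vi (Var var_l) [*] leE (Var var_l) vi)))
     (For var_i (Asg arr_q vi (Const 0))).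

(** After an accepted trial the walk vector no longer belongs to the current free graph. This is
    harmless, since every trial is tested against the current cut and one change per round is enough
    for progress. *)
Definition round_cmd (theta : nat) : cmd :=
  For var_l (Sq start_cmd
    (For var_j (Sq (For var_k (trial_cmd theta)) walk_cmd))).

(** A round with a good candidate places at least one vertex, so n rounds suffice in each phase. The
    phase theta = 0 completes the cut. *)
Definition main_cmd : cmd :=
  Sq (Sq (Asg var_D (Const 0) (Const 1))
         (For var_i (For var_h (Asg var_D (Const 0) (Var var_D [*] denE vi vh)))))
 (Sq (For var_r (round_cmd 1)) (For var_r (round_cmd 0))).

Lemma main_wf : wf main_cmd. Proof. by []. Qed.

(** * Rules for the blocks of the program *)

Section Blocks.
Variables (s : seq nat) (beta D : nat).
Local Notation n := (nth 0 s 0).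
Hypothesis n_gt0 : 0 < n.
Hypothesis beta_gt0 : 0 < beta.

Definition num (i h : nat) := nth 0 s (3 + 2 * (n * i + h)).
Definition den (i h : nat) := nth 0 s (4 + 2 * (n * i + h)).
Definition W (i h : nat) : nat := num i h * (D %/ den i h).
Definition weight_sum_nat : nat := \sum_(0 <= i < n) \sum_(0 <= h < n) W i h.
Local Notation TW := weight_sum_nat.

Local Notation get := (get s).
Local Notation wp := (wp s beta).
Local Notation eqoff := (eqoff s).

Definition pos m i := get m arr_pos i.
Definition neg m i := get m arr_neg i.
Definition free_nat m i := 1 - pos m i - neg m i.
Definition abs_nat m i := (get m arr_p i - get m arr_q i) + (get m arr_q i - get m arr_p i).
Definition zp m k i := free_nat m i * (1 - (abs_nat m k - abs_nat m i))
   * (1 - (1 - (get m arr_p i - get m arr_q i))).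
Definition zm m k i := free_nat m i * (1 - (abs_nat m k - abs_nat m i))
   * (1 - (1 - (get m arr_q i - get m arr_p i))).

Definition valid (m : memory) : Prop :=
  get m var_D 0 = D /\ forall i, i < n -> pos m i + neg m i <= 1.

Lemma zp_zm_le m k i : zp m k i + zm m k i <= free_nat m i.
Proof.
rewrite /zp /zm -mulnDr -mulnA -[X in _ <= X]muln1 leq_mul2l; apply/orP; right.
move: (get m arr_p i) (get m arr_q i) (abs_nat m k - abs_nat m i) => x y z.
by case: z => [|z] /=; lia.
Qed.

Lemma blen_le1 x : x <= 1 -> blen x <= beta.
Proof. by case: x => [|[|x]]. Qed.

Hypothesis TW_bound : blen (4 * TW) <= beta.

(** Partial sums are dominated by four times the total weight, so every intermediate value fits into
    beta bits. *)
Lemma wp_double_sum a e m (F : nat -> nat -> nat) (Q : memory -> Prop) :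
  uniq [:: var_i; var_h; a] ->
  (forall i h, i < n -> h < n -> F i h <= 4 * W i h) ->
  (forall i h m', i < n -> h < n -> eqoff [:: var_i; var_h; a] m m' ->
     get m' var_i 0 = i -> get m' var_h 0 = h -> eval s m' e = F i h) ->
  (forall m', eqoff [:: var_i; var_h; a] m m' ->
     get m' a 0 = \sum_(0 <= i < n) \sum_(0 <= h < n) F i h -> Q m') ->
  wp (double_sum a e) m Q.
Proof.
move=> ua HF He HQ; apply: wp_seq; apply: wp_asg => //.
set m0 := put _ _ _ _ _.
have E0 : eqoff [:: var_i; var_h; a] m m0.
  by apply: eqoff_put; rewrite // !inE eqxx !orbT.
pose val i h := \sum_(0 <= i' < i) \sum_(0 <= h' < n) F i' h' + \sum_(0 <= h' < h) F i h'.
have row i : i < n -> \sum_(0 <= h < n) F i h <= 4 * \sum_(0 <= h < n) W i h.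
  move=> Hi; rewrite big_distrr /= big_nat [X in _ <= X]big_nat.
  by apply: leq_sum => h /andP[_ Hh]; apply: HF.
have tot k : k <= n -> \sum_(0 <= i < k) \sum_(0 <= h < n) F i h
    <= 4 * \sum_(0 <= i < k) \sum_(0 <= h < n) W i h.
  move=> kn; rewrite big_distrr /= big_nat [X in _ <= X]big_nat.
  by apply: leq_sum => i /andP[_ Hi]; apply: row; apply: leq_trans kn.
have mono k : k <= n -> \sum_(0 <= i < k) \sum_(0 <= h < n) W i h <= TW.
  by move=> kn; rewrite /TW (big_cat_nat (leq0n k) kn) leq_addr.
apply: (wp_dfold _ _ n_gt0 _ _ _ _ _ val) => //.
- by rewrite get_put_same /val !big_nil.
- move=> i h Hi Hh; apply: leq_trans TW_bound; apply: leq_blen.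
  apply: (@leq_trans (\sum_(0 <= i' < i.+1) \sum_(0 <= h' < n) F i' h')).
    rewrite big_nat_recr //= /val leq_add2l (big_cat_nat (leq0n h.+1) Hh) leq_addr //.
  by apply: leq_trans (tot _ Hi) _; rewrite leq_mul2l mono.
- by move=> i Hi; rewrite /val big_nil addn0 big_nat_recr.
- move=> i h m' Hi Hh E Ei Eh Ea; rewrite !evalE /= Ea.
  rewrite (He i h) // ?/val ?[in RHS]big_nat_recr //= ?addnA //.
  exact: eqoff_trans E0 E.
move=> m' E Ea; apply: HQ; first exact: eqoff_trans E0 E.
by rewrite Ea /val big_nil addn0.
Qed.

Lemma eval_num m i h : eval s m (numE i h) = num (eval s m i) (eval s m h).
Proof. by rewrite /numE !evalE. Qed.
Lemma eval_den m i h : eval s m (denE i h) = den (eval s m i) (eval s m h).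
Proof. by rewrite /denE !evalE. Qed.
Lemma eval_weight m i h : get m var_D 0 = D ->
  eval s m (weightE i h) = W (eval s m i) (eval s m h).
Proof. by move=> HD; rewrite /weightE !(eval_Bin, eval_Var) HD eval_num eval_den. Qed.
Lemma eval_free m i : eval s m (freeE i) = free_nat m (eval s m i).
Proof. by []. Qed.
Lemma eval_abs m i : eval s m (absE i) = abs_nat m (eval s m i).
Proof. by []. Qed.
Lemma eval_pos m e : eval s m (posE e) = 1 - (1 - eval s m e).
Proof. by []. Qed.
Lemma eval_le m a b : eval s m (leE a b) = 1 - (eval s m a - eval s m b).
Proof. by []. Qed.

Lemma wp_candidate m k (Q : memory -> Prop) :
  k < n -> get m var_k 0 = k ->
  (forall m', eqoff [:: var_i; arr_zp; arr_zm] m m' ->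
    (forall i, i < n -> get m' arr_zp i = zp m k i) ->
    (forall i, i < n -> get m' arr_zm i = zm m k i) -> Q m') ->
  wp candidate_cmd m Q.
Proof.
move=> kn Hk HQ.
have free1 i : free_nat m i <= 1 by rewrite /free_nat -subnDA leq_subr.
have b1 i : blen (zp m k i) <= beta.
  by apply: blen_le1; apply: leq_trans (free1 i); apply: leq_trans (zp_zm_le m k i); apply: leq_addr.
have b2 i : blen (zm m k i) <= beta.
  by apply: blen_le1; apply: leq_trans (free1 i); apply: leq_trans (zp_zm_le m k i); apply: leq_addl.
have agree m' i : eqoff [:: var_i; arr_zp; arr_zm] m m' -> i < n ->
   (free_nat m' i = free_nat m i) * (abs_nat m' i = abs_nat m i)
   * (get m' arr_p i = get m arr_p i) * (get m' arr_q i = get m arr_q i)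
   * (get m' var_k 0 = k).
  by move=> E Hi; rewrite /free_nat /abs_nat /pos /neg !E.
apply: wp_seq; apply: (wp_map _ _ n_gt0 _ _ _ _ (zp m k)) => //.
  move=> i m' Hi E Ei _.
  have E' : eqoff [:: var_i; arr_zp; arr_zm] m m'.
    by apply: eqoff_sub E => b; rewrite !inE => /orP[]->; rewrite ?orbT.
  rewrite !(eval_Bin, eval_free, eval_le, eval_abs, eval_pos, eval_Arr, eval_Var) /= Ei.
  by rewrite !(agree _ _ E' Hi) !(agree _ _ E' kn).
move=> m1 E1 P1; apply: (wp_map _ _ n_gt0 _ _ _ _ (zm m k)) => //.
  move=> i m' Hi E Ei _.
  have E' : eqoff [:: var_i; arr_zp; arr_zm] m m'.
    apply: (eqoff_trans _ _ _ m1).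
      by apply: eqoff_sub E1 => b; rewrite !inE => /orP[]->; rewrite ?orbT.
    by apply: eqoff_sub E => b; rewrite !inE => /orP[]->; rewrite ?orbT.
  rewrite !(eval_Bin, eval_free, eval_le, eval_abs, eval_pos, eval_Arr, eval_Var) /= Ei.
  by rewrite !(agree _ _ E' Hi) !(agree _ _ E' kn).
move=> m2 E2 P2; apply: HQ => //.
  apply: (eqoff_trans _ _ _ m1).
    by apply: eqoff_sub E1 => b; rewrite !inE => /orP[]->; rewrite ?orbT.
  by apply: eqoff_sub E2 => b; rewrite !inE => /orP[]->; rewrite ?orbT.
by move=> i Hi; rewrite E2 // P1.
Qed.

Definition sum2 (F : nat -> nat -> nat) : nat :=
  \sum_(0 <= i < n) \sum_(0 <= h < n) W i h * F i h.

Lemma wp_tally theta m k m0 (Q : memory -> Prop) : theta <= 1 -> valid m0 ->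
  eqoff [:: var_i; arr_zp; arr_zm] m0 m ->
  (forall i, i < n -> get m arr_zp i = zp m0 k i) ->
  (forall i, i < n -> get m arr_zm i = zm m0 k i) ->
  (forall m', eqoff [:: var_i; var_h; var_gain; var_loss; var_c1; var_c2] m m' ->
    get m' var_gain 0 = sum2 (fun i h => 2 * (zp m0 k i * zm m0 k h + zm m0 k i * zp m0 k h)) ->
    get m' var_loss 0 = sum2 (fun i h => 2 * (zp m0 k i * zp m0 k h + zm m0 k i * zm m0 k h)
        + theta * free_nat m0 h * (zp m0 k i + zm m0 k i)) ->
    get m' var_c1 0 = sum2 (fun i h => zp m0 k i * neg m0 h + zm m0 k i * pos m0 h) ->
    get m' var_c2 0 = sum2 (fun i h => zp m0 k i * pos m0 h + zm m0 k i * neg m0 h) ->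
    Q m') ->
  wp (tally_cmd theta) m Q.
Proof.
move=> th1 [HD Hv] E0 Hp Hm HQ.
set S := [:: var_i; var_h; var_gain; var_loss; var_c1; var_c2].
have free1 i : free_nat m0 i <= 1 by rewrite /free_nat -subnDA leq_subr.
have z1 i : zp m0 k i + zm m0 k i <= 1 by apply: leq_trans (zp_zm_le _ _ _) (free1 i).
have z01 i : [/\ zp m0 k i = 0 & zm m0 k i = 0] \/ [/\ zp m0 k i = 1 & zm m0 k i = 0]
   \/ [/\ zp m0 k i = 0 & zm m0 k i = 1].
  by move: (z1 i); case: (zp m0 k i) => [|[|?]]; case: (zm m0 k i) => [|[|?]] // _; auto.
have rd m' i : eqoff S m m' -> i < n ->
   (get m' var_D 0 = D) * (get m' arr_zp i = zp m0 k i) * (get m' arr_zm i = zm m0 k i)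
   * (pos m' i = pos m0 i) * (neg m' i = neg m0 i)
   * (get m' arr_pos i = pos m0 i) * (get m' arr_neg i = neg m0 i)
   * (free_nat m' i = free_nat m0 i).
  move=> E Hi; rewrite /free_nat /pos /neg !(E arr_zp) // !(E arr_zm) // Hp // Hm //.
  by rewrite !(E arr_pos) // !(E arr_neg) // !(E var_D) // !E0 // HD.
have sub a m1 m2 : a \in S -> eqoff [:: var_i; var_h; a] m1 m2 -> eqoff S m1 m2.
  move=> aS; apply: eqoff_sub => b; rewrite 3!inE => /or3P[]/eqP -> //.
have step a e F m1 (Q' : memory -> Prop) : a \in S -> uniq [:: var_i; var_h; a] ->
   eqoff S m m1 ->
   (forall i h, i < n -> h < n -> F i h <= 4) ->
   (forall m' i h, i < n -> h < n -> eqoff S m m' -> get m' var_i 0 = i -> get m' var_h 0 = h ->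
      eval s m' e = F i h) ->
   (forall m', eqoff S m m' -> eqoff [:: var_i; var_h; a] m1 m' ->
      get m' a 0 = sum2 F -> Q' m') ->
   wp (double_sum a (weightE vi vh [*] e)) m1 Q'.
  move=> aS ua E1 F4 HF HQ'; apply: (wp_double_sum _ _ _ (fun i h => W i h * F i h)) => //.
  - by move=> i h Hi Hh; rewrite mulnC leq_mul2r F4 ?orbT.
  - move=> i h m' Hi Hh E Ei Eh.
    have E' : eqoff S m m' by apply: eqoff_trans E1 (sub _ _ _ aS E).
    have Evi : eval s m' vi = i := Ei; have Evh : eval s m' vh = h := Eh.
    by rewrite eval_Bin eval_weight ?(rd _ _ E' Hi) // (HF _ i h) // Evi Evh.
  move=> m' E; apply: HQ' => //; apply: eqoff_trans E1 (sub _ _ _ aS E).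
apply: wp_seq; apply: (step _ _ (fun i h => 2 * (zp m0 k i * zm m0 k h + zm m0 k i * zp m0 k h))) => //.
- move=> i h _ _; case: (z01 i) => [[-> ->]|[[-> ->]|[-> ->]]];
    by case: (z01 h) => [[-> ->]|[[-> ->]|[-> ->]]].
- move=> m' i h Hi Hh E Ei Eh; rewrite !evalE /= Ei Eh.
  by rewrite !(rd _ _ E Hi) !(rd _ _ E Hh).
move=> m1 S1 E1 G1; apply: wp_seq.
apply: (step _ _ (fun i h => 2 * (zp m0 k i * zp m0 k h + zm m0 k i * zm m0 k h)
        + theta * free_nat m0 h * (zp m0 k i + zm m0 k i))) => //.
- move=> i h _ _; apply: (@leq_trans (2 * (zp m0 k i * zp m0 k h + zm m0 k i * zm m0 k h)
        + 1 * 1 * (zp m0 k i + zm m0 k i))).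
    by rewrite leq_add2l leq_mul2r leq_mul // ?orbT.
  case: (z01 i) => [[-> ->]|[[-> ->]|[-> ->]]];
    by case: (z01 h) => [[-> ->]|[[-> ->]|[-> ->]]].
- move=> m' i h Hi Hh E Ei Eh; rewrite !(eval_Bin, eval_free, eval_Const, eval_Arr, eval_Var) /= Ei Eh.
  by rewrite !(rd _ _ E Hi) !(rd _ _ E Hh).
move=> m2 S2 E2 G2; apply: wp_seq.
have sum4 x y a b : x + y <= 1 -> a + b <= 1 -> x * a + y * b <= 4.
  by case: x => [|[|?]]; case: y => [|[|?]] //=; lia.
apply: (step _ _ (fun i h => zp m0 k i * neg m0 h + zm m0 k i * pos m0 h)) => //.
- by move=> i h Hi Hh; apply: sum4; rewrite // addnC; apply: Hv.
- move=> m' i h Hi Hh E Ei Eh; rewrite !evalE /= Ei Eh.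
  by rewrite !(rd _ _ E Hi) !(rd _ _ E Hh).
move=> m3 S3 E3 G3.
apply: (step _ _ (fun i h => zp m0 k i * pos m0 h + zm m0 k i * neg m0 h)) => //.
- by move=> i h Hi Hh; apply: sum4; rewrite // ?Hv.
- move=> m' i h Hi Hh E Ei Eh; rewrite !evalE /= Ei Eh.
  by rewrite !(rd _ _ E Hi) !(rd _ _ E Hh).
move=> m4 S4 E4 G4; apply: HQ => //.
- by rewrite E4 // E3 // E2.
- by rewrite E4 // E3.
by rewrite E4.
Qed.

Lemma wp_rows a e m (F : nat -> nat -> nat) (B : nat) (Q : memory -> Prop) :
  uniq [:: var_i; var_h; a] -> blen B <= beta ->
  (forall i, i < n -> \sum_(0 <= h < n) F i h <= B) ->
  (forall i h m', i < n -> h < n -> eqoff [:: var_i; var_h; a] m m' ->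
     get m' var_i 0 = i -> get m' var_h 0 = h -> eval s m' e = F i h) ->
  (forall m', eqoff [:: var_i; var_h; a] m m' ->
     (forall i, i < n -> get m' a i = \sum_(0 <= h < n) F i h) -> Q m') ->
  wp (For var_i (row_sum a e)) m Q.
Proof.
rewrite /= !inE negb_or !andbT => /andP[/andP[ih ai] ah] HB HF He HQ.
have na : (a == var_i) = false by rewrite eq_sym (negPf ai).
apply: (wp_for _ _ n_gt0 _ _ _ (fun k m' => forall j, j < k -> get m' a j = \sum_(0 <= h < n) F j h)).
- by rewrite /= !inE !negb_or ih ai.
- by [].
- move=> i m1 Hi E1 Ei I1; apply: wp_seq; apply: wp_asg => //; first by rewrite /vi eval_Var Ei.
  have -> : eval s m1 vi = i := Ei; set m2 := put _ _ _ _ _.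
  have E2 : eqoff [:: var_i; var_h; a] m m2.
    apply: (eqoff_trans _ _ _ m1).
      by apply: eqoff_sub E1 => b; rewrite /= !inE => /or4P[]->; rewrite ?orbT.
    by apply: eqoff_put; rewrite // !inE eqxx !orbT.
  have m2i : get m2 var_i 0 = i by rewrite get_put // [var_i == a]eq_sym na Ei.
  apply: (wp_fold _ _ n_gt0 _ _ _ _ _ i (fun h => \sum_(0 <= h' < h) F i h')) => //.
  + move=> m' E; rewrite /vi eval_Var E //; first by rewrite !inE negb_or ih ai.
  + by rewrite get_put_same big_nil.
  + move=> h Hh; apply: leq_trans HB; apply: leq_blen; apply: leq_trans (HF i Hi).
    by rewrite (big_cat_nat (leq0n h.+1) Hh) leq_addr.
  + move=> h m' Hh E Eh Ea.
    have E' : eqoff [:: var_i; var_h; a] m m'.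
      apply: eqoff_trans E2 _; apply: eqoff_sub E => b.
      by rewrite !inE => /orP[]->; rewrite ?orbT.
    have Evi : get m' var_i 0 = i by rewrite E // !inE negb_or ih ai.
    have Evi' : eval s m' vi = i := Evi.
    by rewrite eval_Bin eval_Arr (He i h) // Evi' /= Ea big_nat_recr.
  move=> m' E Ea Eo _ j ji; have jn : j < n by apply: leq_trans Hi.
  rewrite get_put // na /=; move: ji; rewrite ltnS leq_eqVlt => /predU1P[->//|ji].
  rewrite Eo // ?ltn_eqF // get_put // [j == i]ltn_eqF // andbF.
  exact: I1.
move=> m' E I; apply: HQ => //.
by apply: eqoff_sub E => b; rewrite /= !inE => /or4P[]->; rewrite ?orbT.
Qed.

Definition gain m k := sum2 (fun i h => 2 * (zp m k i * zm m k h + zm m k i * zp m k h)).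
Definition loss theta m k := sum2 (fun i h => 2 * (zp m k i * zp m k h + zm m k i * zm m k h)
        + theta * free_nat m h * (zp m k i + zm m k i)).
Definition keep_cut m k := sum2 (fun i h => zp m k i * neg m h + zm m k i * pos m h).
Definition flip_cut m k := sum2 (fun i h => zp m k i * pos m h + zm m k i * neg m h).
Definition accept theta m k := 1 - (loss theta m k - gain m k).
Definition keep m k := 1 - (flip_cut m k - keep_cut m k).

Lemma wp_trial theta m k (Q : memory -> Prop) : theta <= 1 -> valid m ->
  k < n -> get m var_k 0 = k ->
  (forall m', eqoff (mods (trial_cmd theta)) m m' ->
    (forall i, i < n -> pos m' i = pos m i
       + accept theta m k * (keep m k * zp m k i + (1 - keep m k) * zm m k i)) ->
    (forall i, i < n -> neg m' i = neg m i
       + accept theta m k * (keep m k * zm m k i + (1 - keep m k) * zp m k i)) ->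
    Q m') ->
  wp (trial_cmd theta) m Q.
Proof.
move=> th1 Hv kn Hk HQ; apply: wp_seq; apply: (wp_candidate _ _ _ kn Hk) => m1 E1 P1 P2.
apply: wp_seq; apply: (wp_tally _ _ k m) => // m2 E2 G1 G2 G3 G4.
rewrite -/(gain m k) in G1; rewrite -/(loss theta m k) in G2.
rewrite -/(keep_cut m k) in G3; rewrite -/(flip_cut m k) in G4.
have acc1 : accept theta m k <= 1 by apply: leq_subr.
have keep1 : keep m k <= 1 by apply: leq_subr.
apply: wp_seq; apply: wp_asg => //.
  by rewrite !(eval_le, eval_Var) G1 G2; apply: blen_le1.
rewrite !(eval_le, eval_Var, eval_Const) G1 G2; set m3 := put _ _ _ _ _.
have E3 : eqoff [:: var_f] m2 m3 by apply: eqoff_put.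
apply: wp_seq; apply: wp_asg => //.
  by rewrite !(eval_le, eval_Var) !E3 // G3 G4; apply: blen_le1.
rewrite !(eval_le, eval_Var, eval_Const) !E3 // G3 G4; set m4 := put _ _ _ _ _.
have E4 : eqoff [:: var_g] m3 m4 by apply: eqoff_put.
set T := [:: var_i; var_h; var_gain; var_loss; var_c1; var_c2; var_f; var_g; arr_zp; arr_zm; arr_pos; arr_neg].
have sub l a b : {subset l <= T} -> eqoff l a b -> eqoff T a b by move=> ?; apply: eqoff_sub.
have ET4 : eqoff T m m4.
  apply: (eqoff_trans _ _ _ m1); first by apply: sub E1; apply/allP.
  apply: (eqoff_trans _ _ _ m2); first by apply: sub E2; apply/allP.
  apply: (eqoff_trans _ _ _ m3); first by apply: sub E3; apply/allP.
  by apply: sub E4; apply/allP.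
have f4 : get m4 var_f 0 = accept theta m k by rewrite E4 // get_put_same.
have g4 : get m4 var_g 0 = keep m k by rewrite get_put_same.
have zp4 i : i < n -> get m4 arr_zp i = zp m k i by move=> Hi; rewrite E4 // E3 // E2 // P1.
have zm4 i : i < n -> get m4 arr_zm i = zm m k i by move=> Hi; rewrite E4 // E3 // E2 // P2.
have pos4 i : i < n -> get m4 arr_pos i = pos m i by move=> Hi; rewrite E4 // E3 // E2 // E1.
have neg4 i : i < n -> get m4 arr_neg i = neg m i by move=> Hi; rewrite E4 // E3 // E2 // E1.
have small i x y : i < n -> x + y <= zp m k i + zm m k i -> pos m i + x <= 1 /\ neg m i + y <= 1.
  move=> Hi; have := proj2 Hv i Hi; have := zp_zm_le m k i; rewrite /free_nat; lia.
have mix f g x y : f <= 1 -> g <= 1 ->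
    f * (g * x + (1 - g) * y) + f * (g * y + (1 - g) * x) <= x + y.
  by case: f => [|[|?]] // _; case: g => [|[|?]] // _; rewrite ?(mul0n, mul1n, addn0, add0n, subnn, subn0) // addnC.
apply: wp_seq; apply: (wp_map _ _ n_gt0 _ _ _ _ (fun i => pos m i
       + accept theta m k * (keep m k * zp m k i + (1 - keep m k) * zm m k i))) => //.
- move=> i Hi; apply: blen_le1.
  exact: (proj1 (small _ _ _ Hi (mix _ _ _ _ acc1 keep1))).
- move=> i m' Hi E Ei Ea; have Evi : eval s m' vi = i := Ei.
  rewrite !(eval_Bin, eval_Arr, eval_Var, eval_Const) Ei /=.
  rewrite !(E var_f) // !(E var_g) // !(E arr_zp) // !(E arr_zm) // Ea.
  by rewrite f4 g4 zp4 // zm4 // pos4.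
move=> m5 E5 P5; apply: (wp_map _ _ n_gt0 _ _ _ _ (fun i => neg m i
       + accept theta m k * (keep m k * zm m k i + (1 - keep m k) * zp m k i))) => //.
- move=> i Hi; apply: blen_le1.
  exact: (proj2 (small _ _ _ Hi (mix _ _ _ _ acc1 keep1))).
- move=> i m' Hi E Ei Ea; have Evi : eval s m' vi = i := Ei.
  rewrite !(eval_Bin, eval_Arr, eval_Var, eval_Const) Ei /=.
  rewrite !(E var_f) // !(E var_g) // !(E arr_zp) // !(E arr_zm) // Ea.
  by rewrite !E5 // f4 g4 zp4 // zm4 // neg4.
move=> m6 E6 P6; apply: HQ.
- apply: (@eqoff_sub _ T); first by apply/allP.
  apply: (eqoff_trans _ _ _ m4) => //.
  apply: (eqoff_trans _ _ _ m5); first by apply: sub E5; apply/allP.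
  by apply: sub E6; apply/allP.
- by move=> i Hi; rewrite /pos E6 // P5.
by move=> i Hi; rewrite /neg P6.
Qed.

Definition deg_nat m i := \sum_(0 <= h < n) W i h * (free_nat m i * free_nat m h).
Definition nbr_sum m a i := \sum_(0 <= h < n) W i h * (free_nat m i * free_nat m h) * get m a h.
Definition deg_prod m := \prod_(0 <= i < n) (deg_nat m i + (1 - deg_nat m i)).
(** The neighbours contribute from the other array [b] because the off-diagonal entries of L are not
    positive. *)
Definition walk_next m a b i := deg_prod m * get m a i + deg_prod m * nbr_sum m b i %/ deg_nat m i.
Definition walk_growth := 2 * TW.+1 ^ n.

Lemma deg_nat_le m i : i < n -> deg_nat m i <= TW.
Proof.
move=> Hi; have free1 j : free_nat m j <= 1 by rewrite /free_nat -subnDA leq_subr.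
apply: (@leq_trans (\sum_(0 <= h < n) W i h)).
  by apply: leq_sum => h _; rewrite -[X in _ <= X]muln1 leq_mul2l (leq_mul (n1 := 1) (n2 := 1)) ?orbT.
rewrite /TW [X in _ <= X](big_cat_nat (leq0n i.+1) Hi) /=; apply: leq_trans (leq_addr _ _).
by rewrite big_nat_recr //= leq_addl.
Qed.

Lemma deg_prod_le m k : k <= n ->
  \prod_(0 <= i < k) (deg_nat m i + (1 - deg_nat m i)) <= TW.+1 ^ k.
Proof.
elim: k => [|k IH] kn; first by rewrite big_nil.
rewrite big_nat_recr //= expnSr leq_mul ?IH ?(ltnW kn) //.
by have := deg_nat_le m k kn; lia.
Qed.

Lemma nbr_sum_le m a i X : (forall h, h < n -> get m a h <= X) ->
  nbr_sum m a i <= deg_nat m i * X.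
Proof.
move=> HX; rewrite /nbr_sum /deg_nat big_distrl /= big_nat [X in _ <= X]big_nat.
by apply: leq_sum => h /andP[_ Hh]; rewrite leq_mul2l HX ?orbT.
Qed.

(** The division by the degree undoes the growth caused by summing over neighbours, so one step adds
    about n times the length of the total weight, and n steps stay polynomial. *)
Lemma walk_next_le m a b i X : (forall h, h < n -> get m a h <= X) ->
  (forall h, h < n -> get m b h <= X) -> i < n ->
  walk_next m a b i <= walk_growth * X.
Proof.
move=> Ha Hb Hi; rewrite /walk_next /walk_growth -mulnA mul2n -addnn.
have PP : deg_prod m <= TW.+1 ^ n by apply: deg_prod_le.
apply: leq_add; first by rewrite leq_mul // Ha.
have [->|d0] := posnP (deg_nat m i); first by rewrite divn0.
apply: leq_trans (leq_mul PP (leqnn X)).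
apply: (@leq_trans (deg_prod m * (deg_nat m i * X) %/ deg_nat m i)).
  by apply: leq_div2r; rewrite leq_mul2l nbr_sum_le ?orbT.
by rewrite mulnCA mulKn.
Qed.

Lemma wp_walk m X (Q : memory -> Prop) : valid m -> 0 < X ->
  (forall i, i < n -> get m arr_p i <= X) -> (forall i, i < n -> get m arr_q i <= X) ->
  blen (walk_growth * X) <= beta ->
  (forall m', eqoff (mods walk_cmd) m m' ->
     (forall i, i < n -> get m' arr_p i = walk_next m arr_p arr_q i) ->
     (forall i, i < n -> get m' arr_q i = walk_next m arr_q arr_p i) -> Q m') ->
  wp walk_cmd m Q.
Proof.
move=> [HD Hv] X0 Hp Hq HX HQ.
have TWX : TW * X <= walk_growth * X.
  rewrite leq_mul2r /walk_growth; apply/orP; right.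
  apply: (@leq_trans (1 * TW.+1 ^ n)); last by rewrite leq_mul2r orbT.
  by rewrite mul1n; apply: (@leq_trans TW.+1) => //; rewrite -{1}[TW.+1]expn1 leq_pexp2l.
have BX : blen (TW * X) <= beta by apply: leq_trans HX; apply: leq_blen.
have BT : blen TW <= beta by apply: leq_trans BX; apply: leq_blen; apply: leq_pmulr.
set T := [:: var_i; var_h; arr_d; arr_dp; arr_dq; var_P; arr_p; arr_q].
have sub l a b : {subset l <= T} -> eqoff l a b -> eqoff T a b by move=> ?; apply: eqoff_sub.
set T1 := [:: var_i; var_h; arr_d; arr_dp; arr_dq; var_P].
have sub1 l a b : {subset l <= T1} -> eqoff l a b -> eqoff T1 a b by move=> ?; apply: eqoff_sub.
have free_eq m' i : eqoff T1 m m' -> i < n -> free_nat m' i = free_nat m i.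
  by move=> E Hi; rewrite /free_nat /pos /neg !E.
have inner m' i h : eqoff T1 m m' -> i < n -> h < n -> get m' var_i 0 = i -> get m' var_h 0 = h ->
    eval s m' innerE = W i h * (free_nat m i * free_nat m h).
  move=> E Hi Hh Ei Eh; have Evi : eval s m' vi = i := Ei; have Evh : eval s m' vh = h := Eh.
  rewrite /innerE eval_Bin eval_weight; last by rewrite E.
  by rewrite eval_Bin !eval_free Evi Evh /= !(free_eq _ _ E).
have rows a b m1 (Q' : memory -> Prop) : a \in T1 -> b \notin T1 -> uniq [:: var_i; var_h; a] ->
    (forall h, h < n -> get m b h <= X) -> eqoff T1 m m1 ->
    (forall m', eqoff [:: var_i; var_h; a] m1 m' -> eqoff T1 m m' ->
       (forall i, i < n -> get m' a i = nbr_sum m b i) -> Q' m') ->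
    wp (For var_i (row_sum a (innerE [*] Arr b vh))) m1 Q'.
  move=> aT bT ua Hb E1 HQ'.
  have tr m' : eqoff [:: var_i; var_h; a] m1 m' -> eqoff T1 m m'.
    move=> E; apply: eqoff_trans E1 _; apply: sub1 E => c; rewrite 3!inE => /or3P[]/eqP -> //.
  apply: (wp_rows _ _ _ (fun i h => W i h * (free_nat m i * free_nat m h) * get m b h) (TW * X)) => //.
  - move=> i Hi; apply: (leq_trans (nbr_sum_le m b i X Hb)).
    by rewrite leq_mul2r deg_nat_le ?orbT.
  - move=> i h m' Hi Hh E Ei Eh; have E' := tr _ E; have Evh : eval s m' vh = h := Eh.
    by rewrite eval_Bin (inner _ i h) // eval_Arr Evh /= E'.
  by move=> m' E; apply: HQ' => //; apply: tr.
apply: wp_seq; apply: (wp_rows _ _ _ (fun i h => W i h * (free_nat m i * free_nat m h)) TW) => //.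
- by move=> i Hi; apply: deg_nat_le.
- by move=> i h m' Hi Hh E Ei Eh; apply: inner => //; apply: sub1 E; apply/allP.
move=> m1 E1 P1; have S1 : eqoff T1 m m1 by apply: sub1 E1; apply/allP.
apply: wp_seq; apply: (rows _ arr_q) => // m2 E2 S2 P2.
apply: wp_seq; apply: (rows _ arr_p) => // m3 E3 S3 P3.
apply: wp_seq; apply: wp_asg => //.
set m4 := put _ _ _ _ _.
have E4 : eqoff [:: var_P] m3 m4 by apply: eqoff_put.
have S4 : eqoff T1 m m4 by apply: eqoff_trans S3 _; apply: sub1 E4; apply/allP.
have d4 i : i < n -> get m4 arr_d i = deg_nat m i by move=> Hi; rewrite E4 // E3 // E2 // P1.
have dp4 i : i < n -> get m4 arr_dp i = nbr_sum m arr_q i by move=> Hi; rewrite E4 // E3 // P2.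
have dq4 i : i < n -> get m4 arr_dq i = nbr_sum m arr_p i by move=> Hi; rewrite E4 // P3.
have PPb k : k <= n -> blen (\prod_(0 <= i < k) (deg_nat m i + (1 - deg_nat m i))) <= beta.
  move=> kn; apply: leq_trans HX; apply: leq_blen; apply: (leq_trans (deg_prod_le m k kn)).
  apply: (@leq_trans (TW.+1 ^ n)); first by rewrite leq_pexp2l.
  by rewrite /walk_growth mulnAC leq_pmull // muln_gt0.
apply: wp_seq; apply: (wp_fold _ _ n_gt0 _ _ _ _ _ 0
   (fun k => \prod_(0 <= i < k) (deg_nat m i + (1 - deg_nat m i)))) => //.
- by rewrite get_put_same big_nil.
- by move=> k kn; apply: PPb.
- move=> k m' kn E Ei EP; have Evi : eval s m' vi = k := Ei.
  by rewrite !(eval_Bin, eval_Arr, eval_Var, eval_Const) Ei EP /= !(E arr_d) // d4 // big_nat_recr.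
move=> m5 E5 P5 _; rewrite -/(deg_prod m) in P5.
have S5 : eqoff T1 m m5 by apply: eqoff_trans S4 _; apply: sub1 E5; apply/allP.
have bnd a b i : (forall h, h < n -> get m a h <= X) -> (forall h, h < n -> get m b h <= X) ->
   i < n -> blen (walk_next m a b i) <= beta.
  by move=> Ha Hb Hi; apply: leq_trans HX; apply: leq_blen; apply: walk_next_le.
apply: wp_seq; apply: (wp_map _ _ n_gt0 _ _ _ _ (walk_next m arr_p arr_q)) => //.
- by move=> i Hi; apply: bnd.
- move=> i m' Hi E Ei Ea; have Evi : eval s m' vi = i := Ei.
  rewrite !(eval_Bin, eval_Arr, eval_Var) Ei Ea /= !(E var_P) // !(E arr_dp) // !(E arr_d) //.
  by rewrite P5 !(E5 arr_dp) // !(E5 arr_d) // dp4 // d4 // S5.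
move=> m6 E6 P6; apply: (wp_map _ _ n_gt0 _ _ _ _ (walk_next m arr_q arr_p)) => //.
- by move=> i Hi; apply: bnd.
- move=> i m' Hi E Ei Ea; have Evi : eval s m' vi = i := Ei.
  rewrite !(eval_Bin, eval_Arr, eval_Var) Ei Ea /= !(E var_P) // !(E arr_dq) // !(E arr_d) //.
  by rewrite !E6 // P5 !(E5 arr_dq) // !(E5 arr_d) // dq4 // d4 // S5.
move=> m7 E7 P7; apply: HQ => //.
- apply: (@eqoff_sub _ T); first by apply/allP.
  apply: (eqoff_trans _ _ _ m5); first by apply: sub S5; apply/allP.
  apply: (eqoff_trans _ _ _ m6); first by apply: sub E6; apply/allP.
  by apply: sub E7; apply/allP.
by move=> i Hi; rewrite E7 // P6.
Qed.

Lemma wp_start m l (Q : memory -> Prop) : l < n -> get m var_l 0 = l ->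
  (forall m', eqoff (mods start_cmd) m m' ->
     (forall i, i < n -> get m' arr_p i = (i == l)) ->
     (forall i, i < n -> get m' arr_q i = 0) -> Q m') ->
  wp start_cmd m Q.
Proof.
move=> ln Hl HQ.
apply: wp_seq; apply: (wp_map _ _ n_gt0 _ _ _ _ (fun i => nat_of_bool (i == l))) => //.
- by move=> i _; apply: blen_le1; case: eqP.
- move=> i m' Hi E Ei _; rewrite /vi !(eval_Bin, eval_le, eval_Var) Ei !E // Hl /=.
  by case: ltngtP; lia.
move=> m1 E1 P1; apply: (wp_map _ _ n_gt0 _ _ _ _ (fun=> 0)) => //.
move=> m2 E2 P2; apply: HQ => //.
  apply: (eqoff_trans _ _ _ m1).
    by apply: eqoff_sub E1; apply/allP.
  by apply: eqoff_sub E2; apply/allP.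
by move=> i Hi; rewrite E2 // P1.
Qed.

End Blocks.

Local Open Scope ring_scope.

(** * Correctness of the program *)

Section Improve.
Context (F : realFieldType) (n : nat) (w : 'I_n -> 'I_n -> F).
Hypothesis w_ge0 : forall i j, 0 <= w i j.
Hypothesis w_sym : forall i j, w i j = w j i.

Definition improve (theta : F) (s0 s1 : 'I_n -> F) : Prop :=
  [/\ partial_cut F n s1, forall i, s0 i != 0 -> s1 i != 0,
      balance F n w s0 + theta / 4 * (free_volume F n w s0 - free_volume F n w s1)
        <= balance F n w s1
    & s1 = s0 \/ (unplaced F n s1 < unplaced F n s0)%N].

Lemma improve_refl theta s : partial_cut F n s -> improve theta s s.
Proof. by move=> Hs; split=> //; [rewrite subrr mulr0 addr0|left]. Qed.

Lemma improve_unplaced theta s0 s1 : improve theta s0 s1 -> (unplaced F n s1 <= unplaced F n s0)%N.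
Proof. by case=> _ _ _ [->//|/ltnW]. Qed.

Lemma improve_trans theta s0 s1 s2 : improve theta s0 s1 -> improve theta s1 s2 ->
  improve theta s0 s2.
Proof.
move=> I1 I2; have U2 := improve_unplaced _ _ _ I2.
case: I1 I2 => P1 S1 B1 C1 [P2 S2 B2 C2]; split=> //.
- by move=> i /S1 /S2.
- by move: B1 B2; rewrite !mulrBr; lra.
case: C1 C2 => [-> //|C1 _]; right; exact: leq_ltn_trans U2 C1.
Qed.

(** Every change lowers the number of unplaced vertices, so a state once left is never regained. *)
Lemma improve_back theta s0 s1 s2 : improve theta s0 s1 -> improve theta s1 s2 ->
  s2 = s0 -> s1 = s0.
Proof.
move=> [_ _ _ [//|C1]] I2 E; have := improve_unplaced _ _ _ I2.
by rewrite E leqNgt C1.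
Qed.

Lemma free_volume_mono s0 s1 : (forall i, s0 i != 0 -> s1 i != 0) ->
  free_volume F n w s1 <= free_volume F n w s0.
Proof.
move=> H; have fle i : free_at F n s1 i <= free_at F n s0 i.
  rewrite /free_at; case: (eqVneq (s0 i) 0) => [_|/H /negPf -> //].
  by rewrite lern1 leq_b1.
have f0 s i : 0 <= free_at F n s i by rewrite /free_at ler0n.
apply: ler_sum => i _; apply: ler_sum => j _; rewrite /restricted ler_wpM2r //.
by apply: ler_pM.
Qed.

Lemma extend_improve theta sigma s z :
  partial_cut F n s -> partial_cut F n z -> (forall i, s i != 0 -> z i = 0) ->
  0 <= theta -> good_step F n w theta (free_at F n s) z ->
  (sigma == 1) || (sigma == -1) ->
  sigma * (\sum_i \sum_j w i j * (s j * z i)) <= 0 ->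
  improve theta s (extend F n sigma s z) /\
  ((exists i, z i != 0) -> (unplaced F n (extend F n sigma s z) < unplaced F n s)%N).
Proof.
move=> Hs Hz sz th0 good Hsig Hc.
have U := extend_unplaced F n sigma s z Hsig sz.
split=> //; split.
- exact: extend_partial_cut.
- by move=> i si; rewrite /extend (sz _ si) mulr0 addr0.
- exact: extend_good.
have [ex|nex] := pselect (exists i, z i != 0); first by right; apply: U.
left; apply/funext => i; rewrite /extend.
have -> : z i = 0 by apply/eqP/negPn/negP => zi; apply: nex; exists i.
by rewrite mulr0 addr0.
Qed.

End Improve.

(** * From memory contents to rational vectors *)

Section Bridge.
Context (s : seq nat) (beta D N : nat).
Hypothesis sN : nth 0%N s 0 = N.
Hypothesis N_gt0 : (0 < N)%N.
Hypothesis beta_gt0 : (0 < beta)%N.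
Hypothesis W_sym : forall i h, (i < N)%N -> (h < N)%N -> W s D i h = W s D h i.

Local Notation n := (nth 0%N s 0).
Let n_gt0 : (0 < n)%N. Proof. by rewrite sN. Qed.

Definition wq (i j : 'I_N) : rat := (W s D i j)%:R.

Lemma wq_ge0 i j : 0 <= wq i j. Proof. exact: ler0n. Qed.
Lemma wq_sym i j : wq i j = wq j i. Proof. by rewrite /wq W_sym. Qed.

Definition cut_state (m : memory) (i : 'I_N) : rat := (pos s m i)%:R - (neg s m i)%:R.
Definition trial_vec (m : memory) (k : nat) (i : 'I_N) : rat := (zp s m k i)%:R - (zm s m k i)%:R.
Definition walk_state (m : memory) (i : 'I_N) : rat := (get s m arr_p i)%:R - (get s m arr_q i)%:R.

Lemma ltn_n (i : 'I_N) : (i < n)%N. Proof. by rewrite sN. Qed.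

Lemma natr_sum_n (f : nat -> nat) :
  (\sum_(0 <= h < n) f h)%:R = \sum_(h < N) (f h)%:R :> rat.
Proof. by rewrite sN big_mkord natr_sum. Qed.

Lemma valid_cases m (i : 'I_N) : valid s D m ->
  [\/ pos s m i = 0 /\ neg s m i = 0, pos s m i = 1 /\ neg s m i = 0
    | pos s m i = 0 /\ neg s m i = 1]%N.
Proof.
move=> [_ /(_ i (ltn_n i))].
by case: (pos s m i) => [|[|?]]; case: (neg s m i) => [|[|?]] // _;
  [constructor 1|constructor 3|constructor 2].
Qed.

Lemma cut_state_partial m : valid s D m -> partial_cut rat N (cut_state m).
Proof. by move=> Hv i; rewrite /cut_state; case: (valid_cases m i Hv) => -[-> ->]. Qed.

Lemma free_at_state m i : valid s D m -> free_at rat N (cut_state m) i = (free_nat s m i)%:R.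
Proof.
move=> Hv; rewrite /free_at /free_nat /cut_state.
by case: (valid_cases m i Hv) => -[-> ->].
Qed.

Lemma trial_cases m k (i : 'I_N) : valid s D m ->
  [\/ zp s m k i = 0 /\ zm s m k i = 0,
      [/\ zp s m k i = 1, zm s m k i = 0 & free_nat s m i = 1]
    | [/\ zp s m k i = 0, zm s m k i = 1 & free_nat s m i = 1]]%N.
Proof.
move=> Hv; have := zp_zm_le s beta n_gt0 beta_gt0 m k i.
have : (free_nat s m i <= 1)%N by rewrite /free_nat -subnDA leq_subr.
move: (zp s m k i) (zm s m k i) (free_nat s m i) => [|[|x]] [|[|y]] [|[|f]] //= _ _;
  by [constructor 1|constructor 2|constructor 3].
Qed.

Lemma trial_partial m k : valid s D m -> partial_cut rat N (trial_vec m k).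
Proof.
by move=> Hv i; rewrite /trial_vec; case: (trial_cases m k i Hv) => [[-> ->]|[-> -> _]|[-> -> _]].
Qed.

Lemma trial_support m k i : valid s D m -> cut_state m i != 0 -> trial_vec m k i = 0.
Proof.
move=> Hv si; rewrite /trial_vec; have := free_at_state m i Hv.
rewrite /free_at (negPf si); case: (trial_cases m k i Hv) => [[-> ->]|[-> -> ->]|[-> -> ->]] //.
Qed.

Lemma sum2_rat (f : nat -> nat -> nat) (g : 'I_N -> 'I_N -> rat) :
  (forall i h : 'I_N, (f i h)%:R = g i h) ->
  (sum2 s D f)%:R = \sum_i \sum_h wq i h * g i h.
Proof.
move=> fg; rewrite /sum2 natr_sum_n; apply: eq_bigr => i _; rewrite natr_sum_n.
by apply: eq_bigr => h _; rewrite natrM fg.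
Qed.

Lemma good_stepE theta m k : valid s D m ->
  good_step rat N wq theta%:R (free_at rat N (cut_state m)) (trial_vec m k)
   <-> (loss s D theta m k <= gain s D m k)%N.
Proof.
move=> Hv; rewrite -(ler_nat rat) /loss /gain.
rewrite (sum2_rat _ (fun i h => 2 * ((zp s m k i)%:R * (zp s m k h)%:R + (zm s m k i)%:R * (zm s m k h)%:R)
   + theta%:R * (free_nat s m h)%:R * ((zp s m k i)%:R + (zm s m k i)%:R))); last by move=> i h; ring.
rewrite (sum2_rat _ (fun i h => 2 * ((zp s m k i)%:R * (zm s m k h)%:R + (zm s m k i)%:R * (zp s m k h)%:R)));
  last by move=> i h; ring.
rewrite /good_step.
set L' := (X in is_true (X <= _) <-> _); set R' := (X in is_true (_ <= X) <-> _).
set L := (X in _ <-> is_true (X <= _)); set R := (X in _ <-> is_true (_ <= X)).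
(* The sides of the two inequalities differ, signed here and natural there; only the differences of
   the sides agree. *)
suff E : R - L = R' - L' by rewrite -[L <= R]subr_ge0 -[L' <= R']subr_ge0 E.
have zf (i : 'I_N) : (free_nat s m i)%:R * trial_vec m k i = trial_vec m k i.
  by rewrite /trial_vec; case: (trial_cases m k i Hv) => [[-> ->]|[-> -> ->]|[-> -> ->]];
    rewrite ?subrr ?mulr0 ?mul1r.
have zn (i : 'I_N) : `|trial_vec m k i| = (zp s m k i)%:R + (zm s m k i)%:R.
  by rewrite /trial_vec; case: (trial_cases m k i Hv) => [[-> ->]|[-> -> _]|[-> -> _]].
have zg (i : 'I_N) : (free_nat s m i)%:R * `|trial_vec m k i| = `|trial_vec m k i|.
  by rewrite zn; case: (trial_cases m k i Hv) => [[-> ->]|[-> -> ->]|[-> -> ->]]; rewrite ?mulr0 ?mul1r.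
rewrite {}/R {}/L {}/R' {}/L' !mulr_sumr -!sumrB; apply: eq_bigr => i _.
rewrite /deg mulr_suml !mulr_sumr -!sumrB; apply: eq_bigr => j _.
rewrite /restricted !free_at_state //.
have -> : (free_nat s m i)%:R * (free_nat s m j)%:R * wq i j * (trial_vec m k i * trial_vec m k j)
  = wq i j * (((free_nat s m i)%:R * trial_vec m k i) * ((free_nat s m j)%:R * trial_vec m k j)) by ring.
have -> : (free_nat s m i)%:R * (free_nat s m j)%:R * wq i j * `|trial_vec m k i|
  = wq i j * (free_nat s m j)%:R * ((free_nat s m i)%:R * `|trial_vec m k i|) by ring.
rewrite !zf zg zn /trial_vec; ring.
Qed.

Lemma cross_sumE m k :
  \sum_i \sum_j wq i j * (cut_state m j * trial_vec m k i)
    = (flip_cut s D m k)%:R - (keep_cut s D m k)%:R.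
Proof.
rewrite /flip_cut /keep_cut.
rewrite (sum2_rat _ (fun i h => (zp s m k i)%:R * (pos s m h)%:R + (zm s m k i)%:R * (neg s m h)%:R)); last first.
  by move=> i h; ring.
rewrite (sum2_rat _ (fun i h => (zp s m k i)%:R * (neg s m h)%:R + (zm s m k i)%:R * (pos s m h)%:R)); last first.
  by move=> i h; ring.
rewrite -sumrB; apply: eq_bigr => i _; rewrite -sumrB; apply: eq_bigr => j _.
rewrite /cut_state /trial_vec; ring.
Qed.

(** The improvement holds whatever the walk arrays contain, since acceptance is itself the test of
    [good_step]; their meaning enters only when a target has to be recognised. *)
Lemma trial_step theta m m' k : valid s D m -> get s m' var_D 0 = D ->
  (forall i, (i < n)%N -> pos s m' i = pos s m i
       + accept s D theta m k * (keep s D m k * zp s m k i + (1 - keep s D m k) * zm s m k i))%N ->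
  (forall i, (i < n)%N -> neg s m' i = neg s m i
       + accept s D theta m k * (keep s D m k * zm s m k i + (1 - keep s D m k) * zp s m k i))%N ->
  [/\ valid s D m', improve rat N wq theta%:R (cut_state m) (cut_state m')
    & good_step rat N wq theta%:R (free_at rat N (cut_state m)) (trial_vec m k) ->
      (exists i, trial_vec m k i != 0) ->
      (unplaced rat N (cut_state m') < unplaced rat N (cut_state m))%N].
Proof.
move=> Hv HD Hp Hm.
have f01 : accept s D theta m k = (loss s D theta m k <= gain s D m k)%N.
  by rewrite /accept; case: leqP; lia.
pose sigma : rat := if (flip_cut s D m k <= keep_cut s D m k)%N then 1 else -1.
have g01 : keep s D m k = (flip_cut s D m k <= keep_cut s D m k)%N.
  by rewrite /keep; case: leqP; lia.
have Hsig : (sigma == 1) || (sigma == -1) by rewrite /sigma; case: ifP; rewrite eqxx ?orbT.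
have Hc : sigma * (\sum_i \sum_j wq i j * (cut_state m j * trial_vec m k i)) <= 0.
  rewrite cross_sumE /sigma; case: leqP => H; first by rewrite mul1r subr_le0 ler_nat.
  by rewrite mulN1r oppr_le0 subr_ge0 ler_nat ltnW.
have Hv' : valid s D m'.
  split=> // i Hi; rewrite Hp // Hm // f01 g01.
  move: (loss s D theta m k <= gain s D m k)%N (flip_cut s D m k <= keep_cut s D m k)%N
    (proj2 Hv i Hi) (zp_zm_le s beta n_gt0 beta_gt0 m k i) => a b.
  by rewrite /free_nat; case: a; case: b => /=; lia.
have E : cut_state m' = if (loss s D theta m k <= gain s D m k)%N
    then extend rat N sigma (cut_state m) (trial_vec m k) else cut_state m.
  apply/funext => i; rewrite /cut_state Hp ?ltn_n // Hm ?ltn_n // f01 g01.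
  case: leqP => _; last by rewrite !mul0n !addn0.
  rewrite /extend /cut_state /trial_vec /sigma.
  by case: leqP => _; rewrite ?(subnn, subn0, mul1n, mul0n, addn0, add0n) !natrD; ring.
have HP := cut_state_partial m Hv.
have G := good_stepE theta m k Hv.
split=> //.
  rewrite E; case: ifP => H; last exact: improve_refl.
  apply: (proj1 (extend_improve _ _ _ wq_ge0 wq_sym _ _ _ _ HP (trial_partial m k Hv) _ _ _ Hsig Hc)) => //.
  - by move=> i; apply: trial_support.
  - exact/G.
move=> good ex; rewrite E (proj1 G good).
apply: (proj2 (extend_improve _ _ _ wq_ge0 wq_sym theta%:R _ _ _ HP (trial_partial m k Hv) _ _ good Hsig Hc)) => //.
by move=> i; apply: trial_support.
Qed.

(** Signs and comparisons of absolute values do not see the factor [c], so the walk vector need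
    never be normalised. *)
Lemma trial_vecE m (k : nat) (c : rat) u l j : valid s D m -> 0 < c ->
  u = free_at rat N (cut_state m) ->
  (forall i, walk_state m i = c * walk_vector rat N wq u l j i) ->
  forall (k' : 'I_N), k = k' :> nat -> trial_vec m k = candidate rat N wq u l j k'.
Proof.
move=> Hv c0 Hu HY k' ->; apply/funext => i.
rewrite /trial_vec /zp /zm /candidate Hu free_at_state // /threshold -Hu.
have absE (i' : 'I_N) : (abs_nat s m i')%:R = c * `|walk_vector rat N wq u l j i'|.
  rewrite -{1}(gtr0_norm c0) -normrM -HY /walk_state /abs_nat natrD.
  case: (leqP (get s m arr_p i') (get s m arr_q i')) => H.
    rewrite (eqP (_ : (_ - _ == 0)%N)) ?subn_eq0 // add0r natrB // ler0_norm ?opprB //.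
    by rewrite subr_le0 ler_nat.
  rewrite [X in _ + X%:R](eqP (_ : (_ - _ == 0)%N)) ?subn_eq0 ?(ltnW H) // addr0 natrB ?(ltnW H) //.
  by rewrite ger0_norm // subr_ge0 ler_nat ltnW.
have -> : (`|walk_vector rat N wq u l j k'| <= `|walk_vector rat N wq u l j i|)
    = (abs_nat s m k' <= abs_nat s m i)%N.
  by rewrite -(ler_nat rat) !absE ler_pM2l.
have Hs : Num.sg (walk_vector rat N wq u l j i)
   = (get s m arr_q i < get s m arr_p i)%:R - (get s m arr_p i < get s m arr_q i)%:R.
  have -> : Num.sg (walk_vector rat N wq u l j i) = Num.sg (walk_state m i).
    by rewrite HY sgrM (gtr0_sg c0) mul1r.
  rewrite /walk_state; case: ltngtP => H.
  - by rewrite gtr0_sg ?subr_gt0 ?ltr_nat ?subr0.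
  - by rewrite ltr0_sg ?subr_lt0 ?ltr_nat ?sub0r.
  by rewrite H subrr sgr0 subrr.
rewrite Hs.
have i1 a b : (1 - (1 - (a - b)) = (b < a))%N by case: ltnP; lia.
have i2 a b : (1 - (a - b) = (a <= b))%N by case: leqP; lia.
by rewrite !i1 i2 !natrM; ring.
Qed.

Lemma walk_step m m' u l j (c : rat) : valid s D m -> 0 < c ->
  u = free_at rat N (cut_state m) ->
  (forall i, walk_state m i = c * walk_vector rat N wq u l j i) ->
  (forall i, (i < n)%N -> get s m' arr_p i = walk_next s D m arr_p arr_q i) ->
  (forall i, (i < n)%N -> get s m' arr_q i = walk_next s D m arr_q arr_p i) ->
  exists2 c', 0 < c' & forall i, walk_state m' i = c' * walk_vector rat N wq u l j.+1 i.
Proof.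
move=> Hv c0 Hu HY Hp Hq.
set P := deg_prod s D m.
have P0 : (0 < P)%N.
  rewrite /P /deg_prod prodn_gt0 // => i; lia.
have dE (i : 'I_N) : (deg_nat s D m i)%:R = deg rat N (restricted rat N wq u) i.
  rewrite /deg_nat natr_sum_n /deg; apply: eq_bigr => h _.
  by rewrite /restricted Hu !free_at_state // natrM -/(wq i h) natrM mulrC.
have nE a (i : 'I_N) : (nbr_sum s D m a i)%:R =
    \sum_h restricted rat N wq u i h * (get s m a h)%:R.
  rewrite /nbr_sum natr_sum_n; apply: eq_bigr => h _.
  by rewrite /restricted Hu !free_at_state // 2!natrM -/(wq i h) natrM; ring.
have divE a (i : 'I_N) : (P * nbr_sum s D m a i %/ deg_nat s D m i)%:R
   = P%:R * ((deg rat N (restricted rat N wq u) i)^-1 * (nbr_sum s D m a i)%:R).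
  have [d0|d0] := posnP (deg_nat s D m i).
    by rewrite d0 divn0 -dE d0 invr0 mul0r mulr0.
  have dP : (deg_nat s D m i %| P)%N.
    rewrite /P /deg_prod sN big_mkord (bigD1 i) //=.
    rewrite (_ : 1 - deg_nat s D m i = 0)%N; last by lia.
    by rewrite addn0 dvdn_mulr.
  have /dvdnP [x ->] := dP.
  rewrite mulnAC mulnK // !natrM -dE.
  by rewrite -[RHS]mulrA mulVKf ?natrM // pnatr_eq0 -lt0n.
exists (2 * P%:R * c); first by rewrite !mulr_gt0 // ltr0n.
move=> i; rewrite /walk_state Hp ?ltn_n // Hq ?ltn_n // /walk_next -/P !natrD !divE !natrM.
have -> : P%:R * (get s m arr_p i)%:R
   + P%:R * ((deg rat N (restricted rat N wq u) i)^-1 * (nbr_sum s D m arr_q i)%:R)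
   - (P%:R * (get s m arr_q i)%:R
   + P%:R * ((deg rat N (restricted rat N wq u) i)^-1 * (nbr_sum s D m arr_p i)%:R))
  = P%:R * (walk_state m i - (deg rat N (restricted rat N wq u) i)^-1
       * ((nbr_sum s D m arr_p i)%:R - (nbr_sum s D m arr_q i)%:R)).
  by rewrite /walk_state; ring.
have -> : (nbr_sum s D m arr_p i)%:R - (nbr_sum s D m arr_q i)%:R
   = c * \sum_h restricted rat N wq u i h * walk_vector rat N wq u l j h.
  rewrite !nE -sumrB mulr_sumr; apply: eq_bigr => h _.
  by rewrite -mulrBr -/(walk_state m h) HY; ring.
rewrite HY [walk_vector rat N wq u l j.+1 i]/walk_vector exprS mxE.
have -> : \sum_h halfwalk rat N (restricted rat N wq u) i h * (halfwalk rat N (restricted rat N wq u) ^+ j) h l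
  = (walk_vector rat N wq u l j i - (deg rat N (restricted rat N wq u) i)^-1
     * \sum_h restricted rat N wq u i h * walk_vector rat N wq u l j h) / 2.
  transitivity ((\sum_h (i == h)%:R * walk_vector rat N wq u l j h
     - \sum_h (deg rat N (restricted rat N wq u) i)^-1 * (restricted rat N wq u i h * walk_vector rat N wq u l j h)) / 2).
    rewrite -sumrB mulr_suml; apply: eq_bigr => h _; rewrite mxE /walk_vector; ring.
  congr ((_ - _) / 2); last by rewrite mulr_sumr.
  rewrite (bigD1 i) //= eqxx mul1r big1 ?addr0 // => h; rewrite eq_sym => /negPf ->.
  by rewrite mul0r.
by set e := (deg _ _ _ _)^-1; field.
Qed.

End Bridge.

Section Rounds.
Context (s : seq nat) (beta D N : nat).
Hypothesis sN : nth 0%N s 0 = N.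
Hypothesis N_gt0 : (0 < N)%N.
Hypothesis beta_gt0 : (0 < beta)%N.
Hypothesis W_sym : forall i h, (i < N)%N -> (h < N)%N -> W s D i h = W s D h i.
Hypothesis TW_bound : (blen (4 * weight_sum_nat s D) <= beta)%N.
Hypothesis growth_bound : (blen (walk_growth s D ^ N) <= beta)%N.

Local Notation n := (nth 0%N s 0).
Let n_gt0 : (0 < n)%N. Proof. by rewrite sN. Qed.
Local Notation wN := (wq s D N).
Local Notation state := (cut_state s N).
Local Notation wstate := (walk_state s N).
Local Notation improve := (improve rat N wN).
Local Notation get := (get s).
Local Notation wp := (wp s beta).

Lemma growth_gt0 : (0 < walk_growth s D)%N.
Proof. by rewrite /walk_growth muln_gt0 expn_gt0. Qed.

Lemma eqoff_transfer l m m' : eqoff s l m m' ->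
  all (fun a => a \notin l) [:: arr_pos; arr_neg; arr_p; arr_q; var_D] ->
  [/\ valid s D m -> valid s D m', state m' = state m,
      wstate m' = wstate m,
      forall i, (i < n)%N -> get m' arr_p i = get m arr_p i
    & forall i, (i < n)%N -> get m' arr_q i = get m arr_q i].
Proof.
move=> E /and5P[a0 a1 a2 a3 /andP[a9 _]].
have P i : (i < n)%N -> pos s m' i = pos s m i by move=> Hi; rewrite /pos E.
have M i : (i < n)%N -> neg s m' i = neg s m i by move=> Hi; rewrite /neg E.
split=> [[HD Hv]||||].
- by split=> [|i Hi]; [rewrite E|rewrite P // M // Hv].
- by apply/funext => i; rewrite /cut_state P ?M ?sN.
- by apply/funext => i; rewrite /walk_state !E ?sN.
- by move=> i Hi; rewrite E.
by move=> i Hi; rewrite E.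
Qed.

Lemma put_eqoff a m x : eqoff s [:: a] m (put s m a 0 x).
Proof. by apply: eqoff_put; rewrite ?mem_head. Qed.

(* T says that (l0, j0, k0) is a good candidate for the partial cut s0 at the
   start of the round. As long as the state is still s0, the loop counters have
   not passed it; since they do pass it, the state changes. *)
Lemma wp_round_target theta m (T : Prop) (l0 : 'I_N) (j0 : nat) (k0 : 'I_N) (Q : memory -> Prop) :
  (theta <= 1)%N -> valid s D m -> (j0 < N)%N ->
  let s0 := state m in let u0 := free_at rat N s0 in
  (T -> good_step rat N wN theta%:R u0 (candidate rat N wN u0 l0 j0 k0) /\
     exists i, candidate rat N wN u0 l0 j0 k0 i != 0) ->
  (forall m', eqoff s (mods (round_cmd theta)) m m' -> valid s D m' ->
     improve theta%:R s0 (state m') -> (T -> state m' <> s0) -> Q m') ->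
  wp (round_cmd theta) m Q.
Proof.
move=> th1 Hv0 jN s0 u0 good HQ.
have HP0 : partial_cut rat N s0 by apply: (cut_state_partial s D N sN).
pose InvL (lam : nat) m' := [/\ valid s D m', improve theta%:R s0 (state m')
  & state m' = s0 -> T -> (lam <= l0)%N].
apply: (wp_for _ _ n_gt0 _ _ _ InvL) => //.
- have [V S _ _ _] := eqoff_transfer _ _ _ (put_eqoff var_l m 0) isT.
  split; [exact: V|rewrite S; exact: improve_refl|by []].
- move=> lam m1 lamn E1 Hlam [V1 I1 C1].
  have lamN : (lam < N)%N by rewrite -sN.
  pose l := Ordinal lamN.
  pose walk_ok m' j := exists2 c : rat, 0 < c & forall i, wstate m' i = c * walk_vector rat N wN u0 l j i.
  pose bounded_ok m' j := forall i, (i < n)%N ->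
     (get m' arr_p i <= walk_growth s D ^ j)%N /\ (get m' arr_q i <= walk_growth s D ^ j)%N.
  apply: wp_seq; apply: (wp_start s beta D n_gt0 beta_gt0 TW_bound _ lam) => // m2 E2 P2 Q2.
  have S2 : state m2 = state m1.
    by apply/funext => i; rewrite /cut_state /pos /neg !E2 ?sN.
  have V2 : valid s D m2.
    by case: V1 => HD Hv; split=> [|i Hi]; [rewrite E2|rewrite /pos /neg !E2 // Hv].
  (* The size bound is unconditional, as the cost depends on it; the walk vector is identified only
     while the cut is still [s0]. *)
  pose InvJ j m' := [/\ valid s D m', improve theta%:R s0 (state m'), bounded_ok m' j
    & state m' = s0 -> walk_ok m' j /\
        (T -> (lam <= l0)%N /\ (lam = l0 -> (j <= j0)%N))].
  apply: (wp_for _ _ n_gt0 _ _ _ InvJ) => //.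
  + have [V S Wk P Q'] := eqoff_transfer _ _ _ (put_eqoff var_j m2 0) isT.
    split; [exact: V|by rewrite S S2| |].
      by move=> i Hi; rewrite P // Q' // P2 // Q2 // expn0 leq_b1.
    rewrite S S2 => Es; split; last by move=> t; split=> //; apply: C1.
    exists 1 => // i; rewrite Wk /walk_state P2 ?sN // Q2 ?sN // subr0 mul1r.
    by rewrite /walk_vector expr0 mxE -val_eqE.
  + move=> j m3 jn E3 Ej [V3 I3 B3 C3].
    pose InvK k m' := [/\ valid s D m', improve theta%:R s0 (state m'), bounded_ok m' j
      & state m' = s0 -> walk_ok m' j /\
        (T -> [/\ (lam <= l0)%N, lam = l0 -> (j <= j0)%N & lam = l0 -> j = j0 -> (k <= k0)%N])].
    apply: wp_seq; apply: (wp_for _ _ n_gt0 _ _ _ InvK) => //.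
    * have [V S Wk P Q'] := eqoff_transfer _ _ _ (put_eqoff var_k m3 0) isT.
      split; [exact: V|by rewrite S|by move=> i Hi; rewrite P // Q' //; apply: B3|].
      rewrite S => Es; have [W3 L3] := C3 Es; split.
        by case: W3 => c c0 Hc; exists c => // i; rewrite Wk.
      by move=> t; have [? ?] := L3 t; split.
    * move=> k m4 kn E4 Ek [V4 I4 B4 C4].
      have kN : (k < N)%N by rewrite -sN.
      apply: (wp_trial s beta D n_gt0 beta_gt0 TW_bound theta m4 k) => // m5 E5 P5 M5 _.
      have HD5 : get m5 var_D 0 = D by rewrite E5 //; case: V4.
      have [V5 I5 G5] := trial_step s beta D N sN N_gt0 beta_gt0 W_sym theta m4 m5 k V4 HD5 P5 M5.
      have [V S Wk P Q'] := eqoff_transfer _ _ _ (put_eqoff var_k m5 k.+1) isT.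
      have pq5 i : (i < n)%N -> get m5 arr_p i = get m4 arr_p i /\ get m5 arr_q i = get m4 arr_q i.
        by move=> Hi; rewrite !E5.
      have W5 : wstate m5 = wstate m4.
        by apply/funext => i; rewrite /walk_state !E5 ?sN.
      split; first exact: V.
      - by rewrite S; apply: improve_trans I4 I5.
      - by move=> i Hi; rewrite P // Q' //; have [-> ->] := pq5 i Hi; apply: B4.
      rewrite S => Es; have Es4 := improve_back _ _ _ _ _ _ _ I4 I5 Es.
      have [[c c0 Hc] L4] := C4 Es4.
      split; first by exists c => // i; rewrite Wk W5.
      move=> t; have [L1 L2 L3] := L4 t; split=> // ll0 jj0.
      (* Equality would mean that the pass just made tried the target itself; it would have been
         accepted, against the state being still [s0]. *)
      rewrite ltn_neqAle L3 // andbT; apply/eqP => kk0.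
      have [g1 g2] := good t.
      have El : l = l0 by apply: val_inj.
      have Ez : trial_vec s N m4 k = candidate rat N wN u0 l0 j0 k0.
        rewrite -El -jj0; apply: (trial_vecE s beta D N sN N_gt0 beta_gt0 m4 k c) => //.
        by rewrite /u0 -Es4.
      have := G5; rewrite Ez Es4 => /(_ g1 g2).
      by rewrite Es ltnn.
    move=> m4 E4 [V4 I4 B4 C4].
    apply: (wp_walk s beta D n_gt0 beta_gt0 TW_bound m4 (walk_growth s D ^ j)) => //.
    * by rewrite expn_gt0 growth_gt0.
    * by move=> i /B4[].
    * by move=> i /B4[].
    * rewrite -expnS; apply: leq_trans growth_bound; apply: leq_blen.
      by rewrite leq_pexp2l ?growth_gt0 // -sN.
    move=> m5 E5 P5 Q5 _.
    have S5 : state m5 = state m4.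
      by apply/funext => i; rewrite /cut_state /pos /neg !E5 ?sN.
    have V5 : valid s D m5.
      by case: V4 => HD Hv; split=> [|i Hi]; [rewrite E5|rewrite /pos /neg !E5 // Hv].
    have [V S Wk P Q'] := eqoff_transfer _ _ _ (put_eqoff var_j m5 j.+1) isT.
    split; first exact: V.
    * by rewrite S S5.
    * move=> i Hi; rewrite P // Q' // P5 // Q5 // expnS.
      by split; apply: (walk_next_le s beta D n_gt0 beta_gt0 TW_bound) => // h /B4[].
    rewrite S S5 => Es; have [[c c0 Hc] L4] := C4 Es; split.
      rewrite /walk_ok Wk; apply: (walk_step s beta D N sN N_gt0 beta_gt0 m4 m5 u0 l j c) => //.
      by rewrite /u0 -Es.
    move=> t; have [L1 L2 L3] := L4 t; split=> // ll0.
    rewrite ltn_neqAle L2 // andbT; apply/eqP => jj0.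
    by have := L3 ll0 jj0; rewrite leqNgt sN ltn_ord.
  move=> m3 E3 [V3 I3 B3 C3] _.
  have [V S _ _ _] := eqoff_transfer _ _ _ (put_eqoff var_l m3 lam.+1) isT.
  split; [exact: V|by rewrite S|rewrite S => Es t].
  have [_ L3] := C3 Es; have [L1 L2] := L3 t.
  rewrite ltn_neqAle L1 andbT; apply/eqP => ll0.
  by have := L2 ll0; rewrite leqNgt sN jN.
move=> m' E [V I C]; apply: HQ => // t Es.
by have := C Es t; rewrite leqNgt sN ltn_ord.
Qed.

Definition has_target (theta : rat) (s0 : 'I_N -> rat) : Prop :=
  let u0 := free_at rat N s0 in
  exists l j k, [/\ (j < N)%N, good_step rat N wN theta u0 (candidate rat N wN u0 l j k)
    & exists i, candidate rat N wN u0 l j k i != 0].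

Lemma wp_round theta m (Q : memory -> Prop) : (theta <= 1)%N -> valid s D m ->
  (forall m', eqoff s (mods (round_cmd theta)) m m' -> valid s D m' ->
     improve theta%:R (state m) (state m') ->
     (has_target theta%:R (state m) ->
        (unplaced rat N (state m') < unplaced rat N (state m))%N) -> Q m') ->
  wp (round_cmd theta) m Q.
Proof.
move=> th1 Hv HQ.
have step (T : Prop) m' : improve theta%:R (state m) (state m') ->
    (T -> state m' <> state m) -> T ->
    (unplaced rat N (state m') < unplaced rat N (state m))%N.
  by move=> [_ _ _ [E|//]] H t; case: (H t).
(* A triple must be given in either case; without a target it is arbitrary and [T] is False. *)
have [[l [j [k [jN g ex]]]]|noT] := pselect (has_target theta%:R (state m)).
  apply: (wp_round_target theta m True l j k) => // m' E V I H.
  by apply: HQ => // _; apply: step I H Logic.I.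
apply: (wp_round_target theta m False (Ordinal N_gt0) 0 (Ordinal N_gt0)) => // m' E V I H.
by apply: HQ => // /noT.
Qed.

(** For j = 0 and k = l the thresholded vector is e_l itself, so the general enumeration contains
    every single free vertex and the completion phase can reuse it. *)
Lemma candidate_start (s0 : 'I_N -> rat) (l : 'I_N) : s0 l = 0 ->
  candidate rat N wN (free_at rat N s0) l 0 l = fun i => (i == l)%:R.
Proof.
move=> sl; apply/funext => i.
have E (i' : 'I_N) : walk_vector rat N wN (free_at rat N s0) l 0 i' = (i' == l)%:R.
  by rewrite /walk_vector expr0 mxE.
rewrite /candidate /threshold !E eqxx.
case: (eqVneq i l) => [->|_]; last by rewrite sgr0 mul0r mulr0.
by rewrite /free_at sl eqxx lexx sgr1 !mulr1.
Qed.

Hypothesis W_loopless : forall i, (i < N)%N -> W s D i i = 0%N.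
Hypothesis weight_pos : 0 < weight_total rat N wN.
Hypothesis progress : forall s0 : 'I_N -> rat, partial_cut rat N s0 ->
  weight_total rat N wN <= 2 * free_volume rat N wN s0 -> has_target 1 s0.

Lemma unplaced_le (s0 : 'I_N -> rat) : (unplaced rat N s0 <= N)%N.
Proof. by rewrite -[X in (_ <= X)%N]card_ord max_card. Qed.

Lemma has_target_single (s0 : 'I_N -> rat) : (0 < unplaced rat N s0)%N -> has_target 0 s0.
Proof.
move=> /card_gt0P [l]; rewrite inE => /eqP sl; exists l, 0%N, l.
rewrite candidate_start //; split=> //.
  by apply: balance_single; rewrite /wq W_loopless.
by exists l; rewrite eqxx oner_eq0.
Qed.

Lemma wp_search m (Q : memory -> Prop) : valid s D m -> state m = (fun=> 0) ->
  (forall m', valid s D m' -> unplaced rat N (state m') = 0%N ->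
     weight_total rat N wN / 8 <= balance rat N wN (state m') -> Q m') ->
  wp (Sq (For var_r (round_cmd 1)) (For var_r (round_cmd 0))) m Q.
Proof.
move=> Hv S0 HQ; apply: wp_seq.
have w0 := wq_ge0 s D N.
have HP0 : partial_cut rat N (state m) by apply: (cut_state_partial s D N sN).
move: (weight_pos) HQ (progress); set total := weight_total rat N wN => total_gt0 HQ progr.
(* Either enough weight has been placed, or each of the r rounds has placed a vertex; after N rounds
   the second case leaves no free volume. *)
pose Inv1 r m' := [/\ valid s D m', improve 1 (state m) (state m')
  & 2 * free_volume rat N wN (state m') < total \/ (unplaced rat N (state m') + r <= N)%N].
apply: (wp_for _ _ n_gt0 _ _ _ Inv1) => //.
- have [V S _ _ _] := eqoff_transfer _ _ _ (put_eqoff var_r m 0) isT.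
  split; [exact: V|rewrite S; exact: improve_refl|right].
  by rewrite addn0 unplaced_le.
- move=> r m1 rn E1 Er [V1 I1 C1]; apply: (wp_round 1) => // m2 E2 V2 I2 T2 _.
  have [V S _ _ _] := eqoff_transfer _ _ _ (put_eqoff var_r m2 r.+1) isT.
  split; [exact: V|rewrite S; exact: improve_trans I1 I2|rewrite S].
  have mono : free_volume rat N wN (state m2) <= free_volume rat N wN (state m1).
    by apply: free_volume_mono => //; case: I2.
  case: (ltP (2 * free_volume rat N wN (state m1)) total) => [H|H].
    by left; apply: le_lt_trans H; rewrite ler_pM2l.
  case: C1 => [|C1]; first by rewrite ltNge H.
  right; rewrite addnS -addSn; apply: leq_trans C1; rewrite leq_add2r; apply: T2.
  by apply: progr => //; apply: (cut_state_partial s D N sN).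
move=> m1 E1 [V1 [P1 _ B1 _] C1].
have bal1 : total / 8 <= balance rat N wN (state m1).
  have fv0 : free_volume rat N wN (state m) = total.
    apply: eq_bigr => i _; apply: eq_bigr => j _.
    by rewrite /restricted S0 /free_at eqxx !mul1r.
  have b0 : balance rat N wN (state m) = 0.
    rewrite S0 /balance big1 ?oppr0 // => i _; apply: big1 => j _; by rewrite mul0r mulr0.
  have H : 2 * free_volume rat N wN (state m1) < total.
    case: C1 => // C1; have U : unplaced rat N (state m1) = 0%N by move: C1; rewrite sN; lia.
    rewrite /free_volume /volume big1 ?mulr0 // => i _; rewrite /deg big1 // => j _.
    rewrite /restricted /free_at; have /pred0P /(_ i) /= -> : #|[pred i | state m1 i == 0]| == 0%N by rewrite -/(unplaced rat N (state m1)) U.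
    by rewrite !mul0r.
  move: B1; rewrite fv0 b0; lra.
pose Inv2 r m' := [/\ valid s D m', improve 0 (state m1) (state m')
  & (unplaced rat N (state m') + r <= N)%N].
apply: (wp_for _ _ n_gt0 _ _ _ Inv2) => //.
- have [V S _ _ _] := eqoff_transfer _ _ _ (put_eqoff var_r m1 0) isT.
  split; [exact: V|rewrite S; exact: improve_refl|].
  by rewrite addn0 unplaced_le.
- move=> r m2 rn E2 Er [V2 I2 C2]; apply: (wp_round 0) => // m3 E3 V3 I3 T3 _.
  have [V S _ _ _] := eqoff_transfer _ _ _ (put_eqoff var_r m3 r.+1) isT.
  split; [exact: V|rewrite S; exact: improve_trans I2 I3|rewrite S].
  have [U0|U0] := posnP (unplaced rat N (state m2)).
    have := improve_unplaced _ _ _ _ _ _ I3.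
    by rewrite U0 leqn0 => /eqP ->; rewrite add0n -sN.
  rewrite addnS -addSn; apply: leq_trans C2; rewrite leq_add2r; apply: T3.
  exact: has_target_single.
move=> m2 E2 [V2 [P2 _ B2 _] C2]; apply: HQ => //.
  by move: C2; rewrite sN; lia.
by apply: (le_trans bal1); move: B2; rewrite !mul0r addr0.
Qed.

End Rounds.

(** * Encoding and running time *)

Lemma nth_flatten_const (T : Type) (x0 : T) (c : nat) (ss : seq (seq T)) (tl : seq T) i j :
  (forall r, (r < size ss)%N -> size (nth [::] ss r) = c) ->
  (i < size ss)%N -> (j < c)%N ->
  nth x0 (flatten ss ++ tl) (c * i + j) = nth x0 (nth [::] ss i) j.
Proof.
elim: ss i => // r ss IH i H; rewrite /= -catA nth_cat (H 0%N isT).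
case: i => [|i] Hi Hj; first by rewrite muln0 add0n Hj.
rewrite mulnS -addnA ltnNge leq_addr /= addKn; apply: IH => // k Hk.
exact: (H k.+1).
Qed.

Section Encoding.
Variable x : rounding_instance.
Local Notation N := (ri_n x).
Local Notation G := (ri_graph x).
Local Notation s := (enc_instance x).

Let rows := [seq [seq enc_rat (G i j) | j <- enum 'I_N] | i <- enum 'I_N].

Lemma enc_split : s = [:: N; ri_t x; size (pd_table (ri_pd x))]
  ++ (flatten (flatten rows) ++ flatten (pd_table (ri_pd x))).
Proof. by []. Qed.

Lemma enc_entry (i h : 'I_N) e : (e < 2)%N ->
  nth 0%N s (3 + (2 * (N * i + h) + e)) = nth 0%N (enc_rat (G i h)) e.
Proof.
move=> He.
have rowE r (Hr : (r < N)%N) : nth [::] rows r = [seq enc_rat (G (Ordinal Hr) j) | j <- enum 'I_N].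
  rewrite (nth_map (Ordinal Hr)) ?size_enum_ord //; congr map; apply/funext => j.
  by congr (enc_rat (G _ j)); apply: val_inj; rewrite /= nth_enum_ord.
have rsz r : (r < size rows)%N -> size (nth [::] rows r) = N.
  by rewrite size_map size_enum_ord => Hr; rewrite rowE size_map size_enum_ord.
have entry r c : (r < N)%N -> (c < N)%N -> exists i' j' : 'I_N, [/\ i' = r :> nat, j' = c :> nat &
   nth [::] (flatten rows) (N * r + c) = enc_rat (G i' j')].
  move=> Hr Hc; exists (Ordinal Hr), (Ordinal Hc); split=> //.
  have Hr' : (r < size rows)%N by rewrite size_map size_enum_ord.
  rewrite -[flatten rows]cats0 (nth_flatten_const _ _ N rows [::] r c rsz Hr' Hc).
  rewrite rowE (nth_map (Ordinal Hc)) ?size_enum_ord //.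
  by congr (enc_rat (G _ _)); apply: val_inj; rewrite /= nth_enum_ord.
have fsz : size (flatten rows) = (N * N)%N.
  by rewrite [LHS](size_allpairs (fun i j => enc_rat (G i j))) size_enum_ord.
have lt_entry : (N * i + h < N * N)%N.
  apply: (@leq_trans (N * i.+1)); last by rewrite leq_mul2l ltn_ord orbT.
  by rewrite mulnS addnC ltn_add2r.
transitivity (nth 0%N (flatten (flatten rows) ++ flatten (pd_table (ri_pd x)))
  (2 * (N * i + h) + e)).
  by rewrite enc_split nth_cat -[size [:: _; _; _]]/3%N ltnNge leq_addr addKn.
rewrite (nth_flatten_const _ _ 2) ?fsz //.
  have [i' [h' [Ei Eh ->]]] := entry i h (ltn_ord i) (ltn_ord h).
  by rewrite (val_inj Ei) (val_inj Eh).
move=> r Hr.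
have N0 : (0 < N)%N by apply: leq_ltn_trans (ltn_ord i).
have [|i' [h' [_ _ E]]] := entry (r %/ N)%N (r %% N)%N _ (ltn_pmod _ N0).
  by rewrite ltn_divLR.
by move: E; rewrite mulnC -divn_eq => ->.
Qed.

Lemma enc_size : nth 0%N s 0 = N.
Proof. by []. Qed.

Lemma enc_num (i h : 'I_N) : num s i h = `|numq (G i h)|%N.
Proof. by have := enc_entry i h 0 isT; rewrite addn0. Qed.

Lemma enc_den (i h : 'I_N) : den s i h = `|denq (G i h)|%N.
Proof. by have := enc_entry i h 1 isT; rewrite addn1 addnS. Qed.

(** Every number in the encoding, even 0, has length at least 1. Hence bounds polynomial in the
    number of vertices are polynomial in the input size. *)
Lemma input_entries : (N * N <= input_size s)%N.
Proof.
have le (l : seq nat) : (size l <= \sum_(k <- l) blen k)%N.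
  by rewrite -sum1_size; apply: leq_sum.
apply: leq_trans (le s).
rewrite (_ : size s = (3 + size (flatten (flatten rows) ++ flatten (pd_table (ri_pd x))))%N) //.
rewrite size_cat; apply: (@leq_trans (size (flatten (flatten rows)))); last by lia.
have E (l : seq (seq nat)) : all (fun r => (0 < size r)%N) l -> (size l <= size (flatten l))%N.
  elim: l => //= r l IH /andP[r0 /IH H]; rewrite size_cat.
  by apply: (@leq_trans (1 + size (flatten l))); rewrite ?leq_add2r.
have <- : size (flatten rows) = (N * N)%N.
  by rewrite [LHS](size_allpairs (fun i j => enc_rat (G i j))) size_enum_ord.
apply: E.
by apply/allP => r /allpairsP[? [_ _ ->]].
Qed.

End Encoding.

Lemma blen_le_exp k e : (k <= 2 ^ e)%N -> (blen k <= e.+1)%N.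
Proof. by move=> H; rewrite blen_leP // (leq_ltn_trans H) // ltn_exp2l. Qed.

Lemma nth_bits (l : seq nat) i : l != [::] -> (blen (nth 0%N l i) <= input_size l)%N.
Proof.
move=> l0; have [Hi|Hi] := ltnP i (size l).
  by rewrite /input_size (big_nth 0%N) big_mkord (bigD1 (Ordinal Hi)) //= leq_addr.
rewrite nth_default //; case: l l0 Hi => // k l _ _.
by rewrite /input_size big_cons; apply: leq_trans (leq_addr _ _).
Qed.

(** * Bit lengths and the complete run *)

Section Running.
Variable x : rounding_instance.
Local Notation N := (ri_n x).
Local Notation G := (ri_graph x).
Local Notation s := (enc_instance x).
Local Notation Z := (input_size s).
Hypothesis N_gt0 : (0 < N)%N.

Definition common_den : nat := (\prod_(0 <= i < N) \prod_(0 <= h < N) den s i h)%N.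
Local Notation D := common_den.

Lemma Z_gt0 : (0 < Z)%N.
Proof. by apply: leq_trans (input_entries x); rewrite muln_gt0 N_gt0. Qed.

Lemma N_le_Z : (N <= Z)%N.
Proof. by apply: leq_trans (input_entries x); rewrite leq_pmulr. Qed.

Lemma den_gt0 i h : (i < N)%N -> (h < N)%N -> (0 < den s i h)%N.
Proof.
move=> Hi Hh; rewrite (enc_den x (Ordinal Hi) (Ordinal Hh)).
by rewrite absz_gt0 denq_neq0.
Qed.

Lemma common_denE : D = (\prod_(i < N) \prod_(h < N) den s i h)%N.
Proof. by rewrite /D big_mkord; apply: eq_bigr => i _; rewrite big_mkord. Qed.

Lemma common_den_gt0 : (0 < D)%N.
Proof.
by rewrite common_denE; do 2!(apply: prodn_gt0 => ?); apply: den_gt0.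
Qed.

Lemma den_dvd (i h : 'I_N) : (den s i h %| D)%N.
Proof.
rewrite common_denE (bigD1 i) //= dvdn_mulr // (bigD1 h) //= dvdn_mulr //.
Qed.

Lemma W_rat (i h : 'I_N) : (W s D i h)%:R = D%:R * G i h :> rat.
Proof.
have /dvdnP [y Ey] := den_dvd i h.
have d0 := den_gt0 i h (ltn_ord i) (ltn_ord h).
rewrite /W Ey mulnK // !natrM.
rewrite -[G i h]divq_num_den enc_num enc_den.
have -> : (`|numq (G i h)|%N)%:R = (numq (G i h))%:~R :> rat.
  by rewrite natr_absz ger0_norm // numq_ge0 weight_ge0.
have -> : (`|denq (G i h)|%N)%:R = (denq (G i h))%:~R :> rat.
  by rewrite natr_absz ger0_norm // denq_ge0.
field; by rewrite intr_eq0 denq_neq0.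
Qed.

Lemma W_symm i h : (i < N)%N -> (h < N)%N -> W s D i h = W s D h i.
Proof.
move=> Hi Hh; apply/eqP; rewrite -(eqr_nat rat).
by rewrite (W_rat (Ordinal Hi) (Ordinal Hh)) (W_rat (Ordinal Hh) (Ordinal Hi)) weight_sym.
Qed.

Lemma W_loop i : (i < N)%N -> W s D i i = 0%N.
Proof.
move=> Hi; apply/eqP; rewrite -(eqr_nat rat).
by rewrite (W_rat (Ordinal Hi) (Ordinal Hi)) weight_loopless mulr0.
Qed.

(** The exponents in 4 N^2 2^Z D: Z^2 for D, Z for a numerator, Z for N^2 <= Z <= 2^Z, and 2 for the
    4. The summands of [value_bits] below cover in turn the walk entries, the tallies, D and the raw
    input. *)
Definition weight_bits : nat := (Z * Z + 2 * Z + 2)%N.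
Definition value_bits : nat := ((1 + weight_bits * Z) * Z + weight_bits + Z * Z + Z).+1%N.

Lemma entry_lt i : (nth 0%N s i < 2 ^ Z)%N.
Proof. by rewrite -blen_leP ?Z_gt0 // nth_bits. Qed.

Lemma common_den_le : (D <= 2 ^ (Z * Z))%N.
Proof.
rewrite common_denE; apply: (@leq_trans (2 ^ (Z * (N * N)))).
  apply: (@leq_trans (\prod_(i < N) \prod_(h < N) 2 ^ Z)).
    by do 2!(apply: leq_prod => ? _); apply: ltnW; apply: entry_lt.
  by rewrite !prod_nat_const card_ord -!expnM mulnA.
by rewrite leq_exp2l // leq_mul2l input_entries orbT.
Qed.

Lemma weights_le : (4 * weight_sum_nat s D <= 2 ^ weight_bits)%N.
Proof.
apply: (@leq_trans (4 * (N * (N * (2 ^ Z * D))))).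
  rewrite leq_mul2l /=; apply: (@leq_trans (\sum_(0 <= i < N) \sum_(0 <= h < N) 2 ^ Z * D)).
    do 2!(apply: leq_sum => ? _); apply: leq_mul; last exact: leq_div.
    by apply: ltnW; apply: entry_lt.
  by rewrite !sum_nat_const_nat !subn0.
have E a b c : (4 * (a * (a * (b * c))) = c * (a * a * b) * 2 ^ 2)%N.
  by rewrite -[(2 ^ 2)%N]/4%N; ring.
rewrite E.
rewrite /weight_bits !expnD expn0 muln1 leq_mul2r /=.
apply: leq_mul common_den_le _; rewrite leq_mul2r; apply/orP; right.
exact: leq_trans (input_entries x) (ltnW (ltn_expl _ _)).
Qed.

Lemma growth_le : (walk_growth s D ^ N <= 2 ^ ((1 + weight_bits * Z) * Z))%N.
Proof.
have TW : ((weight_sum_nat s D).+1 <= 2 ^ weight_bits)%N.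
  have := weights_le; have : (4 <= 2 ^ weight_bits)%N.
    by rewrite -[4%N]/(2 ^ 2)%N leq_exp2l // leq_addl.
  by move: (2 ^ _)%N; lia.
rewrite expnM /walk_growth; apply: (@leq_trans ((2 ^ (1 + weight_bits * Z)) ^ N)); last first.
  by rewrite leq_pexp2l ?expn_gt0 // N_le_Z.
rewrite leq_exp2r // expnD expn1 leq_mul2l /= expnM.
apply: (@leq_trans ((2 ^ weight_bits) ^ N)); first by rewrite leq_exp2r.
by rewrite leq_pexp2l ?expn_gt0 // N_le_Z.
Qed.

Lemma value_bits_le : (value_bits <= 16 * Z ^ 4)%N.
Proof.
have Z0 := Z_gt0; rewrite /value_bits /weight_bits !expnS expn0 muln1.
move: Z Z0 => z z0.
have h1 : (z <= z * z)%N by rewrite leq_pmulr.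
have h2 : (z * z <= z * z * z)%N by rewrite leq_pmulr.
have h3 : (z * z * z <= z * z * z * z)%N by rewrite leq_pmulr.
have -> : (((1 + (z * z + 2 * z + 2) * z) * z + (z * z + 2 * z + 2) + z * z + z).+1
  = z * z * z * z + 2 * (z * z * z) + 4 * (z * z) + 4 * z + 3)%N by ring.
have -> : (16 * (z * (z * (z * z))) = 16 * (z * z * z * z))%N by ring.
move: h1 h2 h3; move: (z * z * z * z)%N (z * z * z)%N (z * z)%N => a b c; lia.
Qed.

Lemma bits_beta k e : (k <= 2 ^ e)%N -> (e < value_bits)%N -> (blen k <= value_bits)%N.
Proof. by move=> /blen_le_exp H He; apply: leq_trans H He. Qed.

Lemma wp_init m (Q : memory -> Prop) :
  (forall m', eqoff s [:: var_i; var_h; var_D] m m' -> get s m' var_D 0 = D -> Q m') ->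
  wp s value_bits (Sq (Asg var_D (Const 0) (Const 1))
     (For var_i (For var_h (Asg var_D (Const 0) (Bin OpMul (Var var_D) (denE vi vh)))))) m Q.
Proof.
move=> HQ; have n_gt0 : (0 < nth 0%N s 0)%N by rewrite enc_size.
have b0 : (0 < value_bits)%N by [].
apply: wp_seq; apply: wp_asg => //; set m0 := put _ _ _ _ _.
have E0 : eqoff s [:: var_i; var_h; var_D] m m0 by apply: eqoff_put.
pose val i h := (\prod_(0 <= i' < i) \prod_(0 <= h' < N) den s i' h' * \prod_(0 <= h' < h) den s i h')%N.
have prod_le f a b : (a <= b)%N -> (forall i, (i < b)%N -> (0 < f i)%N) ->
    (\prod_(0 <= i < a) f i <= \prod_(0 <= i < b) f i)%N.
  move=> ab f0; rewrite (big_cat_nat (leq0n a) ab) /= leq_pmulr //.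
  by rewrite big_nat; apply: prodn_cond_gt0 => i /andP[_ /f0].
have row0 i : (i < N)%N -> (0 < \prod_(0 <= h < N) den s i h)%N.
  by move=> Hi; rewrite big_nat; apply: prodn_cond_gt0 => h /andP[_ Hh]; apply: den_gt0.
apply: (wp_dfold _ _ n_gt0 _ _ _ _ _ val) => //.
- by rewrite get_put_same /val !big_nil.
- move=> i h Hi Hh; apply: (bits_beta _ (Z * Z)); last by rewrite /value_bits; lia.
  apply: leq_trans common_den_le.
  apply: (@leq_trans (\prod_(0 <= i' < i.+1) \prod_(0 <= h' < N) den s i' h')).
    rewrite big_nat_recr //= /val leq_mul2l; apply/orP; right.
    by apply: prod_le => // h' Hh'; apply: den_gt0.
  by apply: prod_le => // i' Hi'; apply: row0.
- by move=> i Hi; rewrite /val big_nil muln1 big_nat_recr.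
- move=> i h m' Hi Hh E Ei Eh Ea.
  by rewrite eval_Bin eval_den !eval_Var /= Ea Ei Eh /val big_nat_recr //= mulnA.
move=> m' E Ea; apply: HQ; first exact: eqoff_trans E0 E.
by rewrite Ea /val big_nil muln1.
Qed.

Lemma weight_total_wq : weight_total rat N (wq s D N) = D%:R * 2.
Proof.
rewrite -(total_weight _ _ G) mulr_sumr; apply: eq_bigr => i _; rewrite mulr_sumr.
by apply: eq_bigr => h _; rewrite /wq W_rat.
Qed.

Lemma main_run :
  (forall s0 : 'I_N -> rat, partial_cut rat N s0 ->
     weight_total rat N (wq s D N) <= 2 * free_volume rat N (wq s D N) s0 ->
     has_target s D N 1 s0) ->
  exists c m', [/\ exec s (fun=> 0%N) (compile main_cmd) c m',
    (c <= ccost N main_cmd * value_bits)%N & 9 / 16 <= cut_value G (dec_cut x m')].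
Proof.
move=> progress; have n_gt0 : (0 < nth 0%N s 0)%N by rewrite enc_size.
have b0 : (0 < value_bits)%N by [].
have TWb : (blen (4 * weight_sum_nat s D) <= value_bits)%N.
  by apply: (bits_beta _ weight_bits weights_le); rewrite /value_bits; lia.
have Gb : (blen (walk_growth s D ^ N) <= value_bits)%N.
  by apply: (bits_beta _ _ growth_le); rewrite /value_bits; lia.
have D0 : 0 < D%:R :> rat by rewrite ltr0n common_den_gt0.
pose m0 : memory := fun=> 0%N.
have [S H] : wp s value_bits main_cmd m0 (fun m' => 9 / 16 <= cut_value G (dec_cut x m')).
  apply: wp_seq; apply: wp_init => m1 E1 HD.
  have V1 : valid s D m1 by split=> // i Hi; rewrite /pos /neg !E1.
  apply: (wp_search s value_bits D N (enc_size x) N_gt0 b0 W_symm TWb Gb W_loop).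
  - by rewrite weight_total_wq mulr_gt0.
  - exact: progress.
  - exact: V1.
  - by apply/funext => i; rewrite /cut_state /pos /neg !E1 ?enc_size.
  move=> m2 V2 U2.
  (* Array 0 begins at address 0, so the decoder reads the [pos] entries; as no vertex is unplaced,
     a zero there means the side -1. *)
  have sE i : spin rat (dec_cut x m2 i) = cut_state s N m2 i.
    have /pred0P /(_ i) /= : #|[pred i | cut_state s N m2 i == 0]| == 0%N by rewrite -/(unplaced rat N _) U2.
    rewrite /cut_state ffunE -[m2 i]/(pos s m2 i).
    by case: (valid_cases s D N (enc_size x) m2 i V2) => -[-> ->].
  have -> : balance rat N (wq s D N) (cut_state s N m2)
      = D%:R * balance rat N G (fun i => spin rat (dec_cut x m2 i)).
    rewrite /balance mulrN mulr_sumr; congr (- _); apply: eq_bigr => i _; rewrite mulr_sumr.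
    by apply: eq_bigr => h _; rewrite /wq W_rat !sE -mulrA.
  rewrite weight_total_wq -mulrA (ler_pM2l D0) cut_value_balance.
  by move: (balance _ _ _ _) => b; clear; lra.
have bits i : (blen (nth 0%N s i) <= value_bits)%N.
  by apply: leq_trans (nth_bits s i _) _ => //; rewrite /value_bits; lia.
have [_ [c [Ec Hc]]] := compile_exec s value_bits n_gt0 bits main_cmd m0 main_wf S (fun=> b0).
by exists c, (run s main_cmd m0).
Qed.

End Running.

Lemma main_cost_poly : exists k : nat, forall x : rounding_instance, (0 < ri_n x)%N ->
  (ccost (ri_n x) main_cmd * value_bits x <= k * input_size (enc_instance x) ^ k + k)%N.
Proof.
have [K [d HK]] := ccost_poly main_cmd.
exists (K * 2 ^ d * 16 + d + 4)%N => x N0; apply: leq_trans (leq_addr _ _).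
have Z0 := Z_gt0 x N0; have NZ := N_le_Z x N0; have B := value_bits_le x N0.
move: (input_size _) (value_bits x) (ri_n x) Z0 NZ B N0 => Z b N Z0 NZ B N0.
apply: (@leq_trans (K * (2 * Z) ^ d * (16 * Z ^ 4))).
  apply: leq_mul B; apply: leq_trans (HK N) _; rewrite leq_mul2l; apply/orP; right.
  by apply: leq_exp2r_le || (case: (d) => // d'; rewrite leq_exp2r //; lia).
rewrite expnMn (_ : K * (2 ^ d * Z ^ d) * (16 * Z ^ 4) = K * 2 ^ d * 16 * Z ^ (d + 4))%N; last first.
  by rewrite expnD; move: (2 ^ d)%N (Z ^ d)%N (Z ^ 4)%N => *; ring.
apply: leq_mul; first by rewrite -addnA leq_addr.
by rewrite leq_pexp2l // -[in X in (_ <= X)%N]addnA leq_addl.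
Qed.

Lemma instance_progress (x : rounding_instance) (r M : nat) :
  (0 < ri_n x)%N -> (1 < ri_t x)%N -> (ri_t x <= ri_n x)%N -> (4 <= M)%N -> (2 ^ r < ri_n x)%N ->
  (let eps := M%:R^-1 : rat in
      4 * (ri_t x).-1%:R^-1 <= eps * (1 - 3 * eps) ^+ (2 ^ r) /\
      (ri_n x)%:R * (63 / 64) ^+ (2 ^ r) <= (1 - 3 * eps) ^+ (2 ^ r)) ->
  1 - M%:R^-1 <= pd_value (ri_graph x) (ri_pd x) ->
  let w := wq (enc_instance x) (common_den x) (ri_n x) in
  forall s0 : 'I_(ri_n x) -> rat, partial_cut rat _ s0 ->
     weight_total rat _ w <= 2 * free_volume rat _ w s0 ->
     has_target (enc_instance x) (common_den x) (ri_n x) 1 s0.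
Proof.
move=> N0 t1 tn M4 rn Hr Hv w s0 _ Hs.
have D0 : 0 < (common_den x)%:R :> rat by rewrite ltr0n common_den_gt0.
have [l [j [k [jr g ex]]]] := pd_good_candidate rat _ _ r M (ri_graph x) (ri_pd x) _ w D0
  (W_rat x) t1 tn M4 Hr Hv _ (free01 _ _ s0) Hs.
by exists l, j, k; split=> //; apply: leq_ltn_trans jr rn.
Qed.

Theorem theorem3p8 (R : realType) :
  exists2 C : R, 0 < C &
  forall alpha : R, 0 < alpha ->
  exists eps : R,
    [/\ 0 < eps,
        expR (- (C / Num.min alpha 1 ^+ 3)) <= eps
      & exists n0 : nat,
        [/\ (forall (n : nat) (G : wgraph R n), (n0 <= n)%N ->
               1 - eps <= SA (sa_degree n alpha) G ->
               exists x : gcut n, 1 / 2 + eps <= cut_value G x),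
            (exists p : prog,
               polytime_on enc_instance dec_cut
                 (fun I : rounding_instance =>
                    [/\ (n0 <= ri_n I)%N,
                        ri_t I = sa_degree (ri_n I) alpha
                      & 1 - eps <= ratr (pd_value (ri_graph I) (ri_pd I))])
                 (fun (I : rounding_instance) (x : gcut (ri_n I)) =>
                    1 / 2 + eps <= ratr (cut_value (ri_graph I) x))
                 p)
          & (forall (n : nat) (G : wgraph R n), (n0 <= n)%N ->
               (1 / 2 + eps) * SA (sa_degree n alpha) G <= max_cut G
               /\ max_cut G <= SA (sa_degree n alpha) G)]].
Proof.
(* 24576 = 4 * 3072 * 2. With a <= 2 / min(alpha, 1) one gets 1 / eps = 4 * 3072 a <= 24576 /
   min(alpha, 1), and 1 + x <= exp x gives the exponential form. *)
exists (24576%:R); first by rewrite ltr0n.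
move=> alpha al0; set a' := Num.min alpha 1.
have a'0 : 0 < a' by rewrite lt_min al0 ltr01.
have a'1 : a' <= 1 by rewrite ge_min lexx orbT.
set a := (Num.truncn a'^-1).+1.
have a'V : 0 <= a'^-1 by rewrite invr_ge0 ltW.
have [a_lo a_hi] : a'^-1 <= a%:R /\ a%:R <= 2 / a'.
  have /andP[h1 h2] := truncn_itv a'V; split; first exact: ltW.
  have : 1 <= a'^-1 by rewrite invf_ge1.
  rewrite /a -natr1; lra.
have al_a : 1 <= alpha * a%:R.
  have : a' * a'^-1 <= alpha * a%:R.
    by rewrite ler_pM // ?(ltW a'0) // ge_min lexx.
  by rewrite divff // gt_eqF.
set M := gap_denominator a.
have M0 : (3072 <= M)%N by rewrite /M /gap_denominator -{1}[3072%N]muln1 leq_mul2l.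
have MR : 3072 <= M%:R :> R by rewrite (ler_nat _ 3072).
have MR0 : 0 < M%:R :> R by lra.
have [n0 Hn0] := walk_length a isT.
(* The 4 serves twice: 1 - eps lies strictly above the rounding threshold 1 - 1 / M, and below that
   threshold (1 / 2 + eps) (1 - 4 eps) <= 1 / 2 lets a cut of value 1 / 2 achieve the ratio. *)
exists (4 * M%:R)^-1; split.
- by rewrite invr_gt0 mulr_gt0.
- rewrite expRN lef_pV2 ?posrE ?expR_gt0 ?mulr_gt0 //.
  apply: (@le_trans _ _ (24576%:R / a' ^+ 3)); last first.
    by apply: le_trans (expR_ge1Dx _); lra.
  have MaR : M%:R = 3072 * a%:R :> R by rewrite /M /gap_denominator natrM.
  have p3 : a' ^+ 3 <= a' by rewrite -{2}[a']expr1 ler_wiXn2l // ltW.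
  apply: (@le_trans _ _ (24576%:R / a')); first by rewrite MaR; move: a_hi; lra.
  by rewrite ler_pM2l ?ltr0n // lef_pV2 // posrE exprn_gt0.
set eps := (4 * M%:R)^-1.
have epsE : eps = M%:R^-1 / 4 by rewrite /eps invfM mulrC.
have eps0 : 0 < eps by rewrite invr_gt0 mulr_gt0.
have MV : M%:R^-1 <= 3072^-1 :> R by rewrite lef_pV2 // posrE.
have MV0 : 0 < M%:R^-1 :> R by rewrite invr_gt0.
exists (maxn n0 1).
have degree n : (maxn n0 1 <= n)%N -> [/\ (0 < n)%N, (1 < sa_degree n alpha)%N,
   (sa_degree n alpha <= n)%N & exists2 r, (2 ^ r < n)%N & forall F : realFieldType,
    let e := M%:R^-1 : F in
      4 * (sa_degree n alpha).-1%:R^-1 <= e * (1 - 3 * e) ^+ (2 ^ r) /\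
      n%:R * (63 / 64) ^+ (2 ^ r) <= (1 - 3 * e) ^+ (2 ^ r)].
  rewrite geq_max => /andP[n0n n1].
  have tn := sa_degree_le R n alpha.
  have [r [t1 rn Hr]] := Hn0 n _ n0n tn (sa_degree_large R n a alpha n1 al0 isT al_a).
  by split=> //; exists r.
have M4 : (4 <= M)%N by apply: leq_trans M0.
have round n (G : wgraph R n) : (maxn n0 1 <= n)%N -> 1 - M%:R^-1 < SA (sa_degree n alpha) G ->
    exists x : gcut n, 9 / 16 <= cut_value G x.
  move=> /degree [n1 t1 tn [r rn Hr]] HS.
  have [|mu Hmu] := SA_attained R n _ G t1 tn (SA (sa_degree n alpha) G - (1 - M%:R^-1)).
    by rewrite subr_gt0.
  apply: (pd_exists_cut R n _ r M G mu t1 tn M4 (Hr R)).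
  by apply: ltW; move: Hmu; rewrite subKr.
split.
- move=> n G Hn HS; have [|x Hx] := round n G Hn.
    by apply: lt_le_trans HS; rewrite epsE; lra.
  by exists x; apply: le_trans Hx; rewrite epsE; lra.
- have [k Hk] := main_cost_poly; exists (compile main_cmd), k.
  move=> x [Hn Ht Hv]; have [n1 t1 tn [r rn Hr]] := degree _ Hn.
  rewrite -Ht in t1 tn Hr.
  have Hv' : 1 - M%:R^-1 <= pd_value (ri_graph x) (ri_pd x).
    rewrite -(ler_rat R) rmorphB rmorph1 fmorphV rmorph_nat.
    by apply: le_trans Hv; rewrite epsE; lra.
  have [c [m [Ec Hc Hx]]] := main_run x n1 (instance_progress x r M n1 t1 tn M4 rn (Hr rat) Hv').
  exists c, m; split=> //; first exact: leq_trans Hc (Hk x n1).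
  apply: (@le_trans _ _ (ratr (9 / 16))); last by rewrite ler_rat.
  by rewrite fmorph_div !rmorph_nat epsE; lra.
move=> n G Hn; have [n1 t1 tn _] := degree n Hn; split; last exact: max_cut_le_SA.
have S1 : SA (sa_degree n alpha) G <= 1 by apply: SA_le1.
have half : 1 / 2 <= max_cut G.
  by have [x Hx] := exists_half_cut R n G; apply: le_trans Hx (cut_le_max_cut R n G x).
have S0 : 0 <= SA (sa_degree n alpha) G.
  by apply: le_trans (max_cut_le_SA R n _ G t1 tn); lra.
case: (ltP (1 - M%:R^-1) (SA (sa_degree n alpha) G)) => HS.
  have [x Hx] := round n G Hn HS.
  apply: le_trans (cut_le_max_cut R n G x); apply: le_trans Hx.
  by move: S0 S1; rewrite epsE; set S := SA _ _; nra.
apply: le_trans half; apply: (@le_trans _ _ ((1 / 2 + eps) * (1 - M%:R^-1))).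
  by rewrite ler_wpM2l //; lra.
by rewrite epsE; nra.
Qed.
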